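(* Let $r=\min(r_1,\dots,r_m)\in(0,\frac12]$ and $0<\gamma\le1$. Assume the regularity, capacity and noise assumptions described in the context, and let the local sample sizes be $n_j=\lfloor\frac nm\rfloor$ for $j=1,\dots,m$. If the number $l=l_n$ (with $1\le l\le \frac nm$) of subsampled points on each local set satisfies $$l\sim n^\beta,\qquad\beta=\frac{1+\gamma}{2r+1+\gamma},$$ and if the number $m=m_n$ of local sets satisfies $$m\lesssim n^\alpha,\qquad\alpha\le\frac{2r}{2r+1+\gamma},$$ then the choice $$\lambda_n\simeq\Big(\frac1n\Big)^{\frac1{2r+1+\gamma}}$$ guarantees for the partitioned Nyström estimator $\hat f_{\mathcal D}^{\lambda_n}$ the error bound $$\mathbb E\big[\mathcal E(\hat f_{\mathcal D}^{\lambda_n})-\mathcal E(f_\rho)\big]\;\lesssim\;R^2\Big(\frac1n\Big)^{\frac{2r+1}{2r+1+\gamma}},$$ provided $n$ is sufficiently large.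
   Context: Notation. For positive sequences, $a_n\lesssim b_n$ means $a_n\le C b_n$ for a constant $C<\infty$ not depending on $n$ or $m$ (it may depend on the fixed model parameters: $r,\gamma$, kernel bound $\kappa$, $\sigma,M,R$ and the constants in the assumptions); $a_n\simeq b_n$ and $a_n\sim b_n$ mean $a_n\lesssim b_n$ and $b_n\lesssim a_n$. For $f$ in a Hilbert space, $f\otimes f$ is the operator $h\mapsto\langle h,f\rangle f$. Learning setting. $\mathcal X$ is a standard Borel space, $\rho$ a probability measure on $\mathcal X\times\mathbb R$ with marginal $\nu$ on $\mathcal X$ and conditional distributions $\rho(\cdot|x)$. Put $\mathcal E(f)=\int (f(x)-y)^2\,d\rho(x,y)$ and $f_\rho(x)=\int y\,d\rho(y|x)$. Partition and kernels. $\{\mathcal X_1,\dots,\mathcal X_m\}$ is a partition of $\mathcal X$ into nonempty disjoint measurable sets with $p_j=\nu(\mathcal X_j)>0$, and $\nu_j(A)=p_j^{-1}\nu(A\cap\mathcal X_j)$. The partition, and so $m=m_n$, may depend on $n$; the constants $r,\gamma,R,\sigma,M,\kappa$ do not. For each $j$, $\mathcal H_j$ is a separable RKHS on $\mathcal X_j$ with measurable positive semi-definite kernel $K_j$ with $\sup_x K_j(x,x)\le\kappa_j^2$, $\kappa_j\le\kappa<\infty$. Functions in $\mathcal H_j$ are extended by zero to $\mathcal X$, giving the RKHS $\hat{\mathcal H}_j$ (same norm) with kernel $\hat K_j$ equal to $K_j$ on $\mathcal X_j\times\mathcal X_j$ and zero elsewhere. The direct sum $\mathcal H=\bigoplus_{j=1}^m\hat{\mathcal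 H}_j$ with norm $\|f_1+\dots+f_m\|_{\mathcal H}^2=\sum_j p_j\|f_j\|_{\hat{\mathcal H}_j}^2$ is an RKHS with kernel $K(x,x')=\sum_j p_j^{-1}\hat K_j(x,x')$. Covariance operators: $T=\mathbb E_{X\sim\nu}[K_X\otimes K_X]$ on $\mathcal H$, with $K_x=K(x,\cdot)$, and $T_j=\mathbb E_{X\sim\nu_j}[\hat K_j(X,\cdot)\otimes\hat K_j(X,\cdot)]$ on $\hat{\mathcal H}_j$. Effective dimension: $\mathcal N(A,\lambda)=\mathrm{Trace}[(A+\lambda)^{-1}A]$. Regularity assumption. $f_\rho\in\mathcal H$, so $f_\rho=f_1+\dots+f_m$ uniquely with $f_j\in\hat{\mathcal H}_j$; and for every $j$, $\|T_j^{-r_j}f_j\|_{\hat{\mathcal H}_j}\le R$ with $0<r_j\le\frac12$, $R<\infty$ (i.e. $f_j=T_j^{r_j}h_j$ with $\|h_j\|_{\hat{\mathcal H}_j}\le R$). Capacity assumption. (1) $m\sum_{j=1}^m p_j\,\mathcal N(T_j,\lambda)=O(\mathcal N(T,m\lambda))$; (2) $\mathcal N(T,\lambda)\lesssim\lambda^{-\gamma}$ for some $0<\gamma\le1$ (constants uniform in $\lambda>0$ and $n$). Noise assumption (Bernstein). For some $\sigma,M>0$ and every integer $k\ge2$: $\mathbb E[|Y-f_\rho(X)|^k\,|\,X]\le\frac12 k!\,\sigma^2M^{k-2}$ $\nu$-a.s. Data and estimator. The data $\mathcal D=\{(x_i,y_i)\}_{i=1}^n$ are i.i.d. from $\rho$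 and split into $\mathcal D_j=\{(x_i,y_i):i\in I_j\}$, $I_j=\{i:x_i\in\mathcal X_j\}$, $n_j=|I_j|$. The local sizes $n_j$ are taken as fixed, so $\mathcal D_j$ consists of $n_j$ i.i.d. draws from $\rho$ conditioned on $x\in\mathcal X_j$ (inputs distributed as $\nu_j$), independent over $j$. On each local set, $l$ indices $\tilde I_{j,l}\subseteq I_j$ are drawn uniformly at random without replacement. For $\lambda>0$, $$\hat f_{\mathcal D_j}^\lambda=\sum_{i\in\tilde I_{j,l}}\alpha_j^{(i)}\hat K_j(x_i,\cdot),\qquad \alpha_j=(\mathbf A_j^*\mathbf A_j+n_j\lambda\mathbf B_j)^\dagger\mathbf A_j^*\mathbf y_j\in\mathbb R^l,$$ with $\mathbf A_j=(K_j(x_i,x_k))_{i\in I_j,k\in\tilde I_{j,l}}$, $\mathbf B_j=(K_j(x_i,x_k))_{i,k\in\tilde I_{j,l}}$, $\mathbf y_j=(y_i)_{i\in I_j}$, and $\dagger$ the generalized (Moore–Penrose) inverse. Finally $\hat f_{\mathcal D}^\lambda=\sum_{j=1}^m\hat f_{\mathcal D_j}^\lambda$. Expectations are over data and subsampling. *)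

(* Defs.v *)
From HB Require Import structures.
From mathcomp Require Import all_boot all_order all_algebra.
From mathcomp Require Import all_classical all_reals all_analysis.

Set Implicit Arguments.
Unset Strict Implicit.
Unset Printing Implicit Defensive.

Import Order.TTheory GRing.Theory Num.Theory.
Import numFieldNormedType.Exports.
Local Open Scope classical_set_scope.
Local Open Scope ring_scope.

(* Hilbert spaces are carried by a subset of an ambient vector space V;
   an operator on H is a map V -> V of which only the values on
   [vectors H] are relevant. *)
Section Hilbert.
Context (R : realType) (V : lmodType R).

Record ip_space := IpSpace { vectors : set V ; dot : V -> V -> R }.

Implicit Types (H : ip_space) (A : V -> V) (E : set V).

Definition hnorm H (f : V) : R := Num.sqrt (dot H f f).

Definition is_inner_product H : Prop :=
  [/\ vectors H 0,
      forall (a : R) u v, vectors H u -> vectors H v -> vectors H (a *: u + v),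
      forall u v, vectors H u -> vectors H v -> dot H u v = dot H v u,
      forall (a : R) u v w, vectors H u -> vectors H v -> vectors H w ->
        dot H (a *: u + v) w = a * dot H u w + dot H v w
    & forall u, vectors H u -> 0 <= dot H u u /\ (dot H u u = 0 -> u = 0)].

Definition is_complete H : Prop :=
  forall s : nat -> V, (forall i, vectors H (s i)) ->
    (forall e : R, 0 < e -> exists N : nat, forall i j : nat,
      (N <= i)%N -> (N <= j)%N -> hnorm H (s i - s j) < e) ->
    exists2 u, vectors H u & (fun i => hnorm H (s i - u)) @ \oo --> (0 : R).

Definition is_hilbert H : Prop := is_inner_product H /\ is_complete H.

Definition is_separable H : Prop :=
  exists D : set V, [/\ countable D, D `<=` vectors H
    & forall u (e : R), vectors H u -> 0 < e ->
        exists2 v, D v & hnorm H (u - v) < e].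

Definition orthonormal_basis H E : Prop :=
  [/\ E `<=` vectors H,
      forall e, E e -> dot H e e = 1,
      forall e e', E e -> E e' -> e <> e' -> dot H e e' = 0
    & forall u, vectors H u -> (forall e, E e -> dot H u e = 0) -> u = 0].

Definition onb H : set V := xget set0 [set E | orthonormal_basis H E].

(* Meant for positive operators: [esum] is a supremum of finite sums. *)
Definition trace H A : \bar R :=
  \esum_(e in onb H) (dot H (A e) e)%:E.

Definition op_inv H A (g : V) : V := xget 0 [set f | vectors H f /\ A f = g].

(* Trace [(A + lam)^-1 A] *)
Definition effective_dimension H A (lam : R) : \bar R :=
  trace H (fun h => op_inv H (fun f => A f + lam *: f) (A h)).

(* f = A^s h for s > 0 and a positive operator A having an orthonormal basis
   of eigenvectors (in particular A positive, self-adjoint and compact):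
   functional calculus along such a basis E with eigenvalues mu. *)
Definition is_power H A (s : R) (h f : V) : Prop :=
  exists (E : set V) (mu : V -> R),
    [/\ orthonormal_basis H E,
        forall e, E e -> 0 <= mu e /\ A e = mu e *: e,
        vectors H f
      & forall e, E e -> dot H f e = mu e `^ s * dot H h e].

(* the operator f (x) f *)
Definition tensor_square H (f : V) : V -> V := fun h => dot H h f *: f.

(* Expectation of a random operator, as a weak (Pettis) integral:
   <E[A] h, u> = E <A h, u> for all u in H. *)
Definition op_expectation d (X : measurableType d) (mu : set X -> \bar R) H
    (A : X -> V -> V) : V -> V := fun h =>
  xget 0 [set g | vectors H g /\ forall u, vectors H u ->
    dot H g u = fine (\int[mu]_x (dot H (A x h) u)%:E)%E].

End Hilbert.

Section RKHS.
Context (R : realType) (T : Type).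

Definition psd_kernel (K : T -> T -> R) : Prop :=
  (forall x y, K x y = K y x) /\
  forall (N : nat) (x : 'I_N -> T) (c : 'I_N -> R),
    0 <= \sum_(a < N) \sum_(b < N) c a * c b * K (x a) (x b).

Definition is_rkhs (K : T -> T -> R) (H : ip_space (T -> R^o)) : Prop :=
  [/\ is_hilbert H, forall x, vectors H (K x)
    & forall f x, vectors H f -> f x = dot H f (K x)].

End RKHS.

(* Standard Borel: isomorphic to a Polish space with its Borel sigma-algebra. *)
Definition standard_borel (R : realType) d (X : measurableType d) : Prop :=
  exists (Y : completePseudoMetricType R) (phi : X -> Y),
    [/\ hausdorff_space Y, @second_countable Y, bijective phi
      & forall A : set X,
          measurable A <-> exists2 B, <<s [set U : set Y | open U] >> B
                                    & A = phi @^-1` B].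

Section Learning.
Context (R : realType) d (X : measurableType d).
Implicit Types (rho : probability (X * measurableTypeR R)%type R)
  (rhoc : R.-pker X ~> measurableTypeR R).

Definition marginal rho : set X -> \bar R := pushforward rho fst.

Definition is_conditional rho rhoc : Prop :=
  forall A B, measurable A -> measurable B ->
    rho (A `*` B) = (\int[marginal rho]_(x in A) rhoc x B)%E.

Definition regression rhoc (x : X) : R := \int[rhoc x]_y y.

Definition risk rho (f : X -> R) : \bar R :=
  (\int[rho]_z (((f z.1 - z.2) ^+ 2)%R)%:E)%E.

Definition noise_assumption rho rhoc (sigma M : R) : Prop :=
  forall k : nat, (2 <= k)%N ->
    {ae marginal rho, forall x,
      (\int[rhoc x]_y ((`|y - regression rhoc x| ^+ k)%R)%:E
        <= (2^-1 * k`!%:R * sigma ^+ 2 * M ^+ (k - 2))%:E)%E}.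

(* On each part: the kernel and the RKHS of functions on that part, the kernel
   bound kappa_j and the regularity exponent r_j. *)
Record localization := Localization {
  nloc : nat ;
  part : 'I_nloc -> set X ;
  lkernel : forall j, part j -> part j -> R ;
  lspace : forall j, ip_space (part j -> R^o) ;
  lkappa : 'I_nloc -> R ;
  lexp : 'I_nloc -> R }.

Implicit Types (L : localization).

Definition weight rho L (j : 'I_(nloc L)) : R := fine (marginal rho (part j)).

Definition local_marginal rho L (j : 'I_(nloc L)) : set X -> \bar R :=
  fun A => (((weight rho j)^-1)%:E * marginal rho (A `&` part j))%E.

(* rho conditioned on x in the j-th part *)
Definition local_law rho L (j : 'I_(nloc L)) :
    set (X * measurableTypeR R) -> \bar R :=
  fun B => (((weight rho j)^-1)%:E * rho (B `&` (part j `*` setT)))%E.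

(* hat_kernel and hat_space are the extensions by zero to X. *)
Definition hat_kernel L (j : 'I_(nloc L)) : X -> X -> R :=
  fun x => 'valL_(fun=> 0) (fun u : part j => 'valL_0 (@lkernel L j u)) x.

Definition hat_space L (j : 'I_(nloc L)) : ip_space (X -> R^o) :=
  IpSpace [set 'valL_0 f | f in vectors (@lspace L j)]
          (fun f g => dot (@lspace L j) (sigL (part j) f) (sigL (part j) g)).

(* The component of f in the j-th summand is the restriction of f to the
   j-th part. *)
Definition sum_space rho L : ip_space (X -> R^o) :=
  IpSpace [set f | exists2 g : 'I_(nloc L) -> X -> R^o,
                     forall j, vectors (hat_space j) (g j) & f = \sum_j g j]
          (fun f g => \sum_(j < nloc L) weight rho j *
             dot (hat_space j) (f \_ (part j)) (g \_ (part j))).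

Definition sum_kernel rho L : X -> X -> R :=
  fun x x' => \sum_(j < nloc L) (weight rho j)^-1 * hat_kernel j x x'.

Definition cov_operator rho L : (X -> R^o) -> (X -> R^o) :=
  op_expectation (marginal rho) (sum_space rho L)
    (fun x => tensor_square (sum_space rho L) (sum_kernel rho L x)).

Definition local_cov_operator rho L (j : 'I_(nloc L)) :
    (X -> R^o) -> (X -> R^o) :=
  op_expectation (local_marginal rho j) (hat_space j)
    (fun x => tensor_square (hat_space j) (hat_kernel j x)).

Definition partition_assumption rho L : Prop :=
  [/\ partition [set: 'I_(nloc L)] (@part L) [set: X],
      forall j : 'I_(nloc L), measurable (part j)
    & forall j : 'I_(nloc L), 0 < weight rho j].

Definition kernel_assumption L (kappa : R) : Prop :=
  forall j : 'I_(nloc L),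
    [/\ psd_kernel (@lkernel L j),
        measurable_fun (part j `*` part j)
          (fun z => hat_kernel j z.1 z.2 : measurableTypeR R),
        0 <= lkappa j <= kappa /\
          (forall x : part j, lkernel x x <= lkappa j ^+ 2),
        is_rkhs (@lkernel L j) (lspace j)
      & is_separable (lspace j)].

(* f_rho, being a conditional mean, is determined up to a null set only. *)
Definition regularity_assumption rho rhoc L (rad : R) : Prop :=
  (forall j : 'I_(nloc L), 0 < lexp j <= 2^-1) /\
  exists f : 'I_(nloc L) -> X -> R^o,
    {ae marginal rho, forall x, regression rhoc x = \sum_j f j x} /\
    forall j, exists h, [/\ vectors (hat_space j) h,
      hnorm (hat_space j) h <= rad
    & is_power (hat_space j) (local_cov_operator rho j) (lexp j) h (f j)].

Definition min_exponent L (r : R) : Prop :=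
  (exists j : 'I_(nloc L), lexp j = r) /\ forall j : 'I_(nloc L), r <= lexp j.

Definition capacity_assumption rho L (gamma C1 C2 : R) : Prop :=
  forall lam : R, 0 < lam ->
    ((nloc L)%:R%:E *
       (\sum_(j < nloc L) (weight rho j)%:E *
         effective_dimension (hat_space j) (local_cov_operator rho j) lam)
     <= C1%:E * effective_dimension (sum_space rho L) (cov_operator rho L)
                  ((nloc L)%:R * lam))%E /\
    (effective_dimension (sum_space rho L) (cov_operator rho L) lam
     <= (C2 * lam `^ (- gamma))%:E)%E.

(* The data set on the j-th part is [Z j], with N points, of which those with
   index in [S j] are subsampled; all of these are mutually independent. *)
Definition is_sample dO (Omega : measurableType dO) (P : probability Omega R)
    rho L (N l : nat)
    (Z : 'I_(nloc L) -> 'I_N -> Omega -> X * measurableTypeR R)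
    (S : 'I_(nloc L) -> Omega -> {set 'I_N}) : Prop :=
  [/\ (forall j i, measurable_fun setT (Z j i)) /\
        (forall j s, measurable (S j @^-1` [set s])),
      forall j i B, measurable B -> P (Z j i @^-1` B) = local_law rho j B,
      forall j (s : {set 'I_N}), P (S j @^-1` [set s]) =
        (if #|s| == l then ('C(N, l)%:R)^-1 else 0)%:E
    & forall (B : 'I_(nloc L) -> 'I_N -> set (X * measurableTypeR R))
        (A : 'I_(nloc L) -> set {set 'I_N}),
        (forall j i, measurable (B j i)) ->
        P ((\bigcap_j \bigcap_i (Z j i @^-1` B j i)) `&`
           (\bigcap_j (S j @^-1` A j)))
        = ((\prod_j \prod_i P (Z j i @^-1` B j i)) *
           (\prod_j P (S j @^-1` A j)))%E].

End Learning.

Section MoorePenrose.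
Context (R : realType) (m n : nat).

Definition is_moore_penrose (A : 'M[R]_(m, n)) (G : 'M[R]_(n, m)) : Prop :=
  [/\ A *m G *m A = A, G *m A *m G = G,
      (A *m G)^T = A *m G & (G *m A)^T = G *m A].

Definition moore_penrose (A : 'M[R]_(m, n)) : 'M[R]_(n, m) :=
  xget 0 [set G | is_moore_penrose A G].

End MoorePenrose.

(* The estimator depends only on the set S of subsampled indices, so that
   drawing without replacement amounts to drawing a subset. *)
Section Nystroem.
Context (R : realType) (X : Type) (K : X -> X -> R).

Definition nystroem (N : nat) (z : 'I_N -> X * R) (S : {set 'I_N}) (lam : R) :
    X -> R :=
  let sub (k : 'I_#|S|) : X := (z (enum_val k)).1 in
  let A := \matrix_(i < N, k < #|S|) K (z i).1 (sub k) in
  let B := \matrix_(i < #|S|, k < #|S|) K (sub i) (sub k) in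
  let y := \col_(i < N) (z i).2 in
  let a := moore_penrose (A^T *m A + (N%:R * lam) *: B) *m A^T *m y in
  fun x => \sum_k a k ord0 * K (sub k) x.

End Nystroem.

Definition partitioned_nystroem (R : realType) d (X : measurableType d)
    (L : localization R X) (N : nat)
    (z : 'I_(nloc L) -> 'I_N -> X * measurableTypeR R)
    (S : 'I_(nloc L) -> {set 'I_N}) (lam : R) : X -> R :=
  fun x => \sum_j nystroem (hat_kernel j) (z j) (S j) lam x.

(* Main.v *)
Require Import Defs.
From HB Require Import structures.
From mathcomp Require Import all_boot all_order all_algebra.
From mathcomp Require Import all_classical all_reals all_analysis.
From mathcomp Require Import measurable_realfun.
From mathcomp Require Import ring lra.

Set Implicit Arguments.
Unset Strict Implicit.
Unset Printing Implicit Defensive.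

Import Order.TTheory GRing.Theory Num.Theory.
Import numFieldNormedType.Exports.
Local Open Scope classical_set_scope.
Local Open Scope ring_scope.

(* On each part, write the local space in an eigenbasis (e_i) of its covariance operator,
   as provided by the source condition, put |g|_lam^2 = int g^2 + lam |g|^2, and let f be
   the local component of the regression function.

   Lower tail. A sample controls |g|_lam from below, up to a constant and for all g at once,
   except with small probability. Cut it into q disjoint blocks and let W_b be the Cayley
   transform of the empirical second moment form of block b in the coordinates
   e_i / (mu_i + lam)^(1/2). If every block form were small at g, the product of the W_b would
   map g close to g or -g, which is impossible when this product has small Frobenius norm;
   and by independence of the blocks its expected square is at most
   (kappa^2 / (lam k))^q N(lam), where k is the block size. As lam k grows like a power of n,
   a constant q makes this smaller than any given power of 1/n.

   Main estimate. Compare the estimator with the kernel ridge regression g of the noise-free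
   values of f on the subsample. By the source condition lam <f, u> is at most
   R lam^(s + 1/2) |u|_lam, so that the normal equations of g and the lower tail bound control
   f - g. The difference of the estimator and g lies in the span of the subsample and is
   bounded through the normal equations of the estimator; its noise term has expected dual
   norm N(lam) / n, and f - g is evaluated at the points outside the subsample by independence.
   On the exceptional event the crude bound lam |estimator|^2 <= mean of y_i^2 suffices.
   Finally the excess risk is the weighted sum of the local errors, and the capacity
   assumption sums the local effective dimensions. *)

(** * Cayley transforms of positive semidefinite forms *)

(** Only the lower bound of the empirical form has to hold for all functions at once. The opposite
    comparison is needed for one function, the residual f - g, and there an expectation suffices: g
    is built from the subsample alone, so every local point outside it is fresh for g. This is why
    the comparison function is a ridge regression on the subsample and not on all local data; it
    also lies in the span on which the normal equations of the estimator may be tested. The Cayley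
    transform is chosen because it contracts for every positive semidefinite form, however large, so
    that no upper tail has to be controlled. With p = 2r + 1 + gamma, lam l grows only like
    n^(gamma/p) and one block gives a weak failure probability; a product of independent
    contractions raises it to the power q using second moments only. The matrices live on D
    coordinates, yet D enters no constant: the Frobenius norm is summed over columns weighted by
    mu_i / (mu_i + lam), hence by a trace. So D may be taken as large as the distribution demands,
    and the discarded part of the kernel is made smaller than lam n^-5 in mean. *)

Section EuclideanSpace.
Context (R : realType).
Implicit Types (D : nat).

Definition dotv D (x y : 'cV[R]_D) : R := \sum_i x i ord0 * y i ord0.
Definition sqn D (x : 'cV[R]_D) : R := dotv x x.
Definition nrm D (x : 'cV[R]_D) : R := Num.sqrt (sqn x).

Lemma dotvC D (x y : 'cV[R]_D) : dotv x y = dotv y x.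
Proof. by apply: eq_bigr => i _; rewrite mulrC. Qed.

Lemma dotvDl D (x y z : 'cV[R]_D) : dotv (x + y) z = dotv x z + dotv y z.
Proof. by rewrite -big_split; apply: eq_bigr => i _; rewrite mxE mulrDl. Qed.

Lemma dotvZl D a (x z : 'cV[R]_D) : dotv (a *: x) z = a * dotv x z.
Proof. by rewrite mulr_sumr; apply: eq_bigr => i _; rewrite mxE mulrA. Qed.

Lemma dotvNl D (x z : 'cV[R]_D) : dotv (- x) z = - dotv x z.
Proof. by rewrite -scaleN1r dotvZl mulN1r. Qed.

Lemma dotvDr D (x y z : 'cV[R]_D) : dotv z (x + y) = dotv z x + dotv z y.
Proof. by rewrite dotvC dotvDl !(dotvC z). Qed.

Lemma dotvZr D a (x z : 'cV[R]_D) : dotv z (a *: x) = a * dotv z x.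
Proof. by rewrite dotvC dotvZl dotvC. Qed.

Lemma dotvNr D (x z : 'cV[R]_D) : dotv z (- x) = - dotv z x.
Proof. by rewrite dotvC dotvNl dotvC. Qed.

Definition dotvE := (dotvDl, dotvDr, dotvNl, dotvNr, dotvZl, dotvZr).

Lemma dotv_trmx m D (A : 'M[R]_(m, D)) x y :
  dotv (A *m x) y = dotv x (A^T *m y).
Proof.
rewrite /dotv.
under eq_bigr do rewrite mxE mulr_suml.
under [RHS]eq_bigr do rewrite mxE mulr_sumr.
rewrite exchange_big; apply: eq_bigr => i _; apply: eq_bigr => j _.
by rewrite mxE; ring.
Qed.

Lemma dotv_mx D (x y : 'cV[R]_D) : (x^T *m y) ord0 ord0 = dotv x y.
Proof. by rewrite mxE; apply: eq_bigr => i _; rewrite mxE. Qed.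

Lemma sqnE D (x : 'cV[R]_D) : sqn x = \sum_i x i ord0 ^+ 2.
Proof. by apply: eq_bigr => i _; rewrite expr2. Qed.

Lemma sqn_ge0 D (x : 'cV[R]_D) : 0 <= sqn x.
Proof. by apply: sumr_ge0 => i _; rewrite -expr2 sqr_ge0. Qed.

Lemma sqn_eq0 D (x : 'cV[R]_D) : sqn x = 0 -> x = 0.
Proof.
move=> /eqP; rewrite psumr_eq0 => [/allP x0|i _]; last by rewrite -expr2 sqr_ge0.
apply/matrixP => i j; rewrite ord1 mxE.
by have := x0 i (mem_index_enum i); rewrite /= -expr2 sqrf_eq0 => /eqP.
Qed.

Lemma cauchy_schwarz_disc (a b c : R) :
  0 <= a -> (forall t, 0 <= a * t ^+ 2 + 2 * b * t + c) -> b ^+ 2 <= a * c.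
Proof.
move=> a0 h; have [a_eq0|a_neq0] := eqVneq a 0.
  rewrite a_eq0 mul0r; have [->|b0] := eqVneq b 0; first by rewrite expr0n.
  (* At this point the polynomial, affine when a = 0, would take the value -1. *)
  have := h (- (c + 1) / (2 * b)); rewrite a_eq0 mul0r add0r.
  rewrite (_ : 2 * b * _ = - (c + 1)); last by field.
  lra.
have ap : 0 < a by rewrite lt_neqAle eq_sym a_neq0.
have := h (- b / a).
rewrite (_ : _ + c = (a * c - b ^+ 2) / a); last by field.
by rewrite pmulr_lge0 ?invr_gt0 // subr_ge0.
Qed.

Lemma sum_cauchy_schwarz (I : Type) (s : seq I) (P : pred I) (f g : I -> R) :
  (\sum_(i <- s | P i) f i * g i) ^+ 2 <=
  (\sum_(i <- s | P i) f i ^+ 2) * (\sum_(i <- s | P i) g i ^+ 2).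
Proof.
apply: cauchy_schwarz_disc => [|t]; first by apply: sumr_ge0 => i _; exact: sqr_ge0.
rewrite (_ : _ + _ = \sum_(i <- s | P i) (f i * t + g i) ^+ 2).
  by apply: sumr_ge0 => i _; exact: sqr_ge0.
rewrite mulr_suml mulr_sumr mulr_suml -!big_split /=.
by apply: eq_bigr => i _; ring.
Qed.

(** The form is nonnegative at 2 x - y; the weights are those needed to absorb the last term in
    [cayley_near]. *)
Lemma sqn_psd_cs D (P : 'M[R]_D) x y : P^T = P ->
  (forall z : 'cV_D, 0 <= dotv (P *m z) z) ->
  2 * dotv (P *m x) y <= 2 * dotv (P *m x) x + 2^-1 * dotv (P *m y) y.
Proof.
move=> symP psdP; have := psdP (2 *: x - y).
rewrite mulmxBr -scalemxAr !dotvE (_ : dotv (P *m y) x = dotv (P *m x) y); first lra.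
by rewrite dotv_trmx symP dotvC.
Qed.

Lemma nrm_ge0 D (x : 'cV[R]_D) : 0 <= nrm x. Proof. exact: sqrtr_ge0. Qed.

Lemma sqr_nrm D (x : 'cV[R]_D) : nrm x ^+ 2 = sqn x.
Proof. by rewrite sqr_sqrtr ?sqn_ge0. Qed.

Lemma nrm_le D D' (x : 'cV[R]_D) (y : 'cV[R]_D') : (nrm x <= nrm y) = (sqn x <= sqn y).
Proof. by rewrite ler_sqrt ?sqn_ge0. Qed.

Lemma dotv_le D (x y : 'cV[R]_D) : dotv x y <= nrm x * nrm y.
Proof.
apply: le_trans (ler_norm _) _.
rewrite -(@ler_pXn2r _ 2) ?nnegrE ?mulr_ge0 ?nrm_ge0 //.
rewrite exprMn !sqr_nrm real_normK ?num_real //.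
by apply: le_trans (sum_cauchy_schwarz _ _ _ _) _; rewrite !sqnE.
Qed.

Lemma nrmD D (x y : 'cV[R]_D) : nrm (x + y) <= nrm x + nrm y.
Proof.
rewrite -(@ler_pXn2r _ 2) ?nnegrE ?addr_ge0 ?nrm_ge0 //.
rewrite sqr_nrm sqrrD !sqr_nrm /sqn !dotvE (dotvC y x).
have := dotv_le x y; set a := nrm x * nrm y; lra.
Qed.

Lemma nrmN D (x : 'cV[R]_D) : nrm (- x) = nrm x.
Proof. by rewrite /nrm /sqn !dotvE opprK. Qed.

Definition frob D (A : 'M[R]_D) : R := \sum_i sqn (col i A).

Lemma sqn_mulmx_frob D (A : 'M[R]_D) x : sqn (A *m x) <= frob A * sqn x.
Proof.
rewrite /frob; under eq_bigr do rewrite sqnE.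
rewrite !sqnE exchange_big /= mulr_suml.
apply: ler_sum => a _; rewrite mxE.
apply: le_trans (sum_cauchy_schwarz _ _ _ _) _.
by under [X in _ <= X * _]eq_bigr do rewrite mxE.
Qed.

(* The Cayley transform (1 + P)^-1 (P - 1): it is close to -1 along the
   vectors on which the form P is small, and at most P - 1 in norm. *)
Definition cayley D (P : 'M[R]_D) : 'M[R]_D := invmx (1%:M + P) *m (P - 1%:M).

Section Cayley.
Context (D : nat) (P : 'M[R]_D).
Hypothesis psdP : forall z : 'cV_D, 0 <= dotv (P *m z) z.

Lemma psd_add1_unit : 1%:M + P \in unitmx.
Proof.
rewrite -unitmx_tr -row_free_unit -kermx_eq0; apply/eqP/row_matrixP => i.
rewrite row0; set v := row i _.
have v0 : v *m (1%:M + P)^T = 0 by apply/sub_kermxP; rewrite row_sub.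
have : (1%:M + P) *m v^T = 0.
  by apply: trmx_inj; rewrite trmx_mul trmxK v0 trmx0.
rewrite mulmxDl mul1mx => e.
have : dotv (v^T + P *m v^T) v^T = 0.
  by rewrite e /dotv big1 // => k _; rewrite mxE mul0r.
rewrite dotvDl => e1.
have : sqn v^T = 0.
  have := psdP v^T; have := sqn_ge0 v^T; rewrite /sqn; lra.
by move=> /sqn_eq0/(congr1 trmx); rewrite trmxK trmx0.
Qed.

(** The estimates below use only this equation (1 + P) W y = (P - 1) y and never the inverse
    itself. *)
Lemma cayleyE (y : 'cV_D) : cayley P *m y + P *m (cayley P *m y) = P *m y - y.
Proof.
have -> : cayley P *m y + P *m (cayley P *m y) = (1%:M + P) *m (cayley P *m y).
  by rewrite mulmxDl mul1mx.
by rewrite mulmxA mulmxA mulmxV ?psd_add1_unit // mul1mx mulmxBl mul1mx.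
Qed.

(** With z = W y one has z + y = P (y - z); pairing with y - z gives |y|^2 - |z|^2 >= 0. *)
Lemma cayley_contract (y : 'cV_D) : sqn (cayley P *m y) <= sqn y.
Proof.
set z := cayley P *m y.
have e : z + y = P *m (y - z).
  rewrite mulmxBr; have := cayleyE y; rewrite -/z => e.
  by apply/eqP; rewrite eq_sym subr_eq -addrA [y + _]addrC addrA e subrK.
have := psdP (y - z); rewrite -e !dotvE (dotvC y z) /sqn; lra.
Qed.

(** Pairing (1 + P) z = (P - 1) y with z and dropping <P z, z> gives |z|^2 <= <(P - 1) y, z>. The
    random inverse is thus traded for an expression linear in P - 1, whose second moment can be
    computed. *)
Lemma cayley_le (y : 'cV_D) : sqn (cayley P *m y) <= sqn ((P - 1%:M) *m y).
Proof.
set z := cayley P *m y.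
have e : z + P *m z = (P - 1%:M) *m y by rewrite cayleyE mulmxBl mul1mx.
have h : sqn z <= dotv ((P - 1%:M) *m y) z.
  by rewrite -e dotvDl lerDl psdP.
have := sqn_ge0 ((P - 1%:M) *m y - z).
by rewrite /sqn in h *; rewrite !dotvE (dotvC z); lra.
Qed.

(** The vector z = W u + u solves (1 + P) z = 2 P u. Pairing with z, the term <P z, z> on the left
    absorbs the one produced by the weighted Cauchy-Schwarz inequality. The factor 4 becomes 2 eps
    per transform after taking roots. *)
Lemma cayley_near (u : 'cV_D) : P^T = P ->
  sqn (cayley P *m u + u) <= 4 * dotv (P *m u) u.
Proof.
move=> symP; set z := cayley P *m u + u.
have e : z + P *m z = 2 *: (P *m u).
  rewrite /z mulmxDr addrACA cayleyE addrA subrK.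
  by rewrite scaler_nat mulr2n.
have h : dotv (z + P *m z) z = 2 * dotv (P *m u) z by rewrite e dotvZl.
have := sqn_psd_cs u z symP psdP; have := psdP z; have := psdP u.
by rewrite dotvDl in h; rewrite /sqn; lra.
Qed.

End Cayley.

Definition cayley_prod D (Ps : seq 'M[R]_D) : 'M[R]_D :=
  foldr (fun P A => cayley P *m A) 1%:M Ps.

Lemma cayley_prod_contract D (Ps : seq 'M[R]_D) y :
  (forall P, P \in Ps -> forall z : 'cV_D, 0 <= dotv (P *m z) z) ->
  sqn (cayley_prod Ps *m y) <= sqn y.
Proof.
elim: Ps => [|P Ps IH] psdP /=; first by rewrite mul1mx.
rewrite -mulmxA; apply: le_trans (cayley_contract _ _) _.
  by apply: psdP; rewrite inE eqxx.
by apply: IH => Q QPs; apply: psdP; rewrite inE QPs orbT.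
Qed.

(** Each further transform contracts the error made so far and adds 2 eps of its own, so the errors
    add up. *)
Lemma cayley_prod_near D (Ps : seq 'M[R]_D) (u : 'cV[R]_D) (eps : R) :
  0 <= eps ->
  (forall P, P \in Ps -> P^T = P /\ forall z : 'cV_D, 0 <= dotv (P *m z) z) ->
  (forall P, P \in Ps -> dotv (P *m u) u <= eps ^+ 2 * sqn u) ->
  nrm (cayley_prod Ps *m u - (-1) ^+ size Ps *: u) <= (size Ps)%:R * (2 * eps) * nrm u.
Proof.
move=> eps0; elim: Ps => [|P Ps IH] psdP small /=.
  by rewrite mul1mx expr0 scale1r subrr !mul0r /nrm /sqn /dotv big1 ?sqrtr0 // => i _; rewrite mxE mul0r.
have [symP psdP1] : P^T = P /\ forall z : 'cV_D, 0 <= dotv (P *m z) z.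
  by apply: psdP; rewrite inE eqxx.
have {}IH : nrm (cayley_prod Ps *m u - (-1) ^+ size Ps *: u) <= (size Ps)%:R * (2 * eps) * nrm u.
  by apply: IH => Q QPs; [apply: psdP|apply: small]; rewrite inE QPs orbT.
set v := _ - _ *: u in IH.
rewrite (_ : _ - _ = cayley P *m v + (-1) ^+ size Ps *: (cayley P *m u + u)); last first.
  rewrite /v mulmxBr -mulmxA exprS mulN1r scaleNr opprK scalerDr -scalemxAr.
  by rewrite addrA subrK.
apply: le_trans (nrmD _ _) _.
have -> : (size Ps).+1%:R * (2 * eps) * nrm u =
    (size Ps)%:R * (2 * eps) * nrm u + 2 * eps * nrm u by rewrite -natr1; ring.
apply: lerD; first by apply: le_trans IH; rewrite nrm_le cayley_contract.
rewrite -(@ler_pXn2r _ 2) ?nnegrE ?mulr_ge0 ?nrm_ge0 //.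
rewrite [X in _ <= X]exprMn !sqr_nrm /sqn dotvZl dotvZr mulrA -exprMn mulrNN mulr1 expr1n mul1r.
have := @cayley_near _ _ psdP1 u symP; rewrite /sqn => /le_trans; apply.
have := small P (mem_head _ _); rewrite exprMn /sqn => h.
have -> : (2 : R) ^+ 2 = 4 by ring.
by rewrite -mulrA ler_pM2l.
Qed.

(* If all forms P were small on a common vector u, then the product of their
   Cayley transforms would send u close to u or -u. *)
Lemma cayley_prod_lower D (Ps : seq 'M[R]_D) (u : 'cV[R]_D) :
  (0 < size Ps)%N ->
  (forall P, P \in Ps -> P^T = P /\ forall z : 'cV_D, 0 <= dotv (P *m z) z) ->
  frob (cayley_prod Ps) <= 4^-1 ->
  exists2 P, P \in Ps & sqn u / (64 * (size Ps)%:R ^+ 2) <= dotv (P *m u) u.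
Proof.
move=> q0 psdP small; apply: contrapT => no.
have qR : 0 < (size Ps)%:R :> R by rewrite ltr0n.
(* The q transforms then move u by at most q * 2 eps = 1/4 of its norm away from u or -u, while the
   Frobenius bound leaves an image of at most half the norm. As 1/4 + 1/2 < 1, this forces u = 0. *)
pose eps : R := (8 * (size Ps)%:R)^-1.
have eps0 : 0 < eps by rewrite invr_gt0 mulr_gt0.
have eE : eps ^+ 2 * sqn u = sqn u / (64 * (size Ps)%:R ^+ 2).
  by rewrite /eps; field; rewrite gt_eqF.
have lt P : P \in Ps -> dotv (P *m u) u < eps ^+ 2 * sqn u.
  by move=> PPs; rewrite ltNge; apply/negP => h; apply: no; exists P => //; rewrite -eE.
have := @cayley_prod_near _ Ps u eps (ltW eps0) psdP (fun P PPs => ltW (lt P PPs)).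
have -> : (size Ps)%:R * (2 * eps) = 4^-1 by rewrite /eps; field; rewrite gt_eqF.
set A := cayley_prod Ps *m u => h.
have hA : nrm A <= 2^-1 * nrm u.
  rewrite -(@ler_pXn2r _ 2) ?nnegrE ?mulr_ge0 ?nrm_ge0 // exprMn !sqr_nrm.
  apply: le_trans (sqn_mulmx_frob _ _) _.
  have -> : (2^-1 : R) ^+ 2 = 4^-1 by field.
  by rewrite ler_wpM2r ?sqn_ge0.
have hu : nrm u = nrm ((-1) ^+ size Ps *: u).
  by rewrite /nrm /sqn dotvZl dotvZr mulrA -exprMn mulrNN mulr1 expr1n mul1r.
have tri : nrm u <= nrm A + 4^-1 * nrm u.
  rewrite {1}hu -[X in nrm X](subrK A) addrC; apply: le_trans (nrmD _ _) _.
  by rewrite lerD2l -[_ - A]opprB nrmN.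
have u0 : nrm u = 0.
  by apply/eqP; rewrite eq_le nrm_ge0 andbT; lra.
have u00 : sqn u = 0 by rewrite -sqr_nrm u0 expr0n.
have [P PPs] : exists P, P \in Ps by case: (Ps) q0 => // P ? _; exists P; rewrite inE eqxx.
have := lt P PPs; rewrite u00 mulr0 ltNge => /negP; apply.
by case: (psdP P PPs) => _; apply.
Qed.

End EuclideanSpace.

(** * Regularized least squares and the generalized inverse *)

Section MoorePenroseTheory.
Context (R : realType).

Lemma gram_unit r n (B : 'M[R]_(r, n)) : row_free B -> B *m B^T \in unitmx.
Proof.
move=> freeB; rewrite -row_free_unit -kermx_eq0; apply/eqP/row_matrixP => i.
rewrite row0; set v := row i _.
have v0 : v *m (B *m B^T) = 0 by apply/sub_kermxP; rewrite row_sub.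
have : sqn (v *m B)^T = 0.
  by rewrite /sqn -dotv_mx trmxK trmx_mul mulmxA -(mulmxA v) v0 mul0mx mxE.
move=> /sqn_eq0/(congr1 trmx); rewrite trmxK trmx0 => vB0.
by apply/eqP; rewrite -(mulmx_free_eq0 v freeB) vB0.
Qed.

(** From a rank factorization A = C B with C of full column rank and B of full row rank, the inverse
    is B^T (B B^T)^-1 (C^T C)^-1 C^T. *)
Lemma moore_penrose_ex m n (A : 'M[R]_(m, n)) : exists G, is_moore_penrose A G.
Proof.
have uB : row_base A *m (row_base A)^T \in unitmx.
  by apply: gram_unit; exact: row_base_free.
have uC : (col_base A)^T *m col_base A \in unitmx.
  have := @gram_unit _ _ (col_base A)^T; rewrite trmxK; apply.
  by rewrite /row_free mxrank_tr; exact: col_base_full.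
move: uB uC (mulmx_base A); move: (row_base A) (col_base A).
move: (\rank A) => r B C uB uC eA.
set iB := invmx (B *m B^T); set iC := invmx (C^T *m C).
have iBt : iB^T = iB by rewrite /iB trmx_inv trmx_mul trmxK.
have iCt : iC^T = iC by rewrite /iC trmx_inv trmx_mul trmxK.
pose G := B^T *m iB *m iC *m C^T.
have AG : A *m G = C *m iC *m C^T.
  by rewrite -eA /G -!mulmxA (mulmxA B) (mulmxA _ iB) mulmxV // mul1mx.
have GA : G *m A = B^T *m iB *m B.
  by rewrite -eA /G -!mulmxA (mulmxA C^T) (mulmxA iC) mulVmx // mul1mx.
exists G; split.
- by rewrite AG -eA -!mulmxA (mulmxA C^T) (mulmxA iC) mulVmx // mul1mx.
- by rewrite GA /G -!mulmxA (mulmxA B) (mulmxA (B *m B^T)) mulmxV // mul1mx.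
- by rewrite AG !trmx_mul trmxK iCt mulmxA.
- by rewrite GA !trmx_mul trmxK iBt mulmxA.
Qed.

Lemma moore_penroseP m n (A : 'M[R]_(m, n)) : is_moore_penrose A (moore_penrose A).
Proof.
have [G hG] := moore_penrose_ex A.
exact: (@xgetPex _ 0 [set G | is_moore_penrose A G]) (ex_intro _ G hG).
Qed.

(* The kernel of A^T A + c B is contained in the one of A, so that A^T y lies
   in its range and the generalized inverse solves the normal equations. *)
Lemma moore_penrose_normal m n (A : 'M[R]_(m, n)) (B : 'M[R]_n) (c : R) y :
  0 <= c -> B^T = B -> (forall z : 'cV_n, 0 <= dotv (B *m z) z) ->
  let C := A^T *m A + c *: B in
  C *m (moore_penrose C *m A^T *m y) = A^T *m y :> 'cV_n.
Proof.
move=> c0 symB psdB C; have [CGC _ symCG _] := moore_penroseP C.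
set G := moore_penrose C in CGC symCG *.
have symC : C^T = C by rewrite /C linearD linearZ /= trmx_mul trmxK symB.
have kerA z : C *m z = 0 -> A *m z = 0 :> 'cV_m.
  move=> Cz; apply: sqn_eq0.
  have : dotv (C *m z) z = 0 by rewrite Cz /dotv big1 // => i _; rewrite mxE mul0r.
  rewrite /C mulmxDl -scalemxAl -mulmxA dotvDl dotvZl dotv_trmx trmxK -/(sqn (A *m z)) => e.
  have := sqn_ge0 (A *m z); have := mulr_ge0 c0 (psdB z); lra.
have C0 : C *m (1%:M - C *m G) = 0.
  apply: trmx_inj; rewrite trmx_mul linearB /= symCG trmx1 symC trmx0.
  by rewrite mulmxBl mul1mx CGC subrr.
have A0 : A *m (1%:M - C *m G) = 0.
  apply/matrixP => i j.
  have : A *m col j (1%:M - C *m G) = 0.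
    by apply: kerA; rewrite colE mulmxA C0 mul0mx.
  by rewrite colE mulmxA -colE => /matrixP/(_ i ord0); rewrite !mxE.
have : (1%:M - C *m G) *m A^T = 0.
  by apply: trmx_inj; rewrite trmx_mul trmxK linearB /= symCG trmx1 A0 trmx0.
rewrite mulmxBl mul1mx => /eqP; rewrite subr_eq0 => /eqP e.
by rewrite mulmxA mulmxA -e.
Qed.

End MoorePenroseTheory.

(** * Hilbert spaces with a countable basis *)

Section HilbertTheory.
Context (R : realType) (V : lmodType R) (H : ip_space V).
Hypothesis ipH : is_inner_product H.
Local Notation vec := (vectors H).
Local Notation "\< u , v \>" := (dot H u v) (at level 0, u, v at level 99).

Lemma vec0 : vec 0. Proof. by case: ipH. Qed.

Lemma vecDZ a u v : vec u -> vec v -> vec (a *: u + v).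
Proof. by case: ipH => _ h _ _ _; apply: h. Qed.

Lemma vecD u v : vec u -> vec v -> vec (u + v).
Proof. by move=> hu hv; rewrite -[u]scale1r; exact: vecDZ. Qed.

Lemma vecZ a u : vec u -> vec (a *: u).
Proof. by move=> hu; rewrite -[_ *: _]addr0; apply: vecDZ => //; exact: vec0. Qed.

Lemma vecN u : vec u -> vec (- u).
Proof. by rewrite -scaleN1r; exact: vecZ. Qed.

Lemma vecB u v : vec u -> vec v -> vec (u - v).
Proof. by move=> hu hv; apply: vecD => //; exact: vecN. Qed.

Lemma vec_sum (I : Type) (s : seq I) (P : pred I) (F : I -> V) :
  (forall i, P i -> vec (F i)) -> vec (\sum_(i <- s | P i) F i).
Proof. by move=> h; apply: big_ind => //; [exact: vec0|exact: vecD]. Qed.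

Lemma dotC u v : vec u -> vec v -> \<u, v\> = \<v, u\>.
Proof. by case: ipH => _ _ h _ _; apply: h. Qed.

Lemma dotDZl a u v w : vec u -> vec v -> vec w ->
  \<a *: u + v, w\> = a * \<u, w\> + \<v, w\>.
Proof. by case: ipH => _ _ _ h _; apply: h. Qed.

Lemma dotDl u v w : vec u -> vec v -> vec w -> \<u + v, w\> = \<u, w\> + \<v, w\>.
Proof. by move=> hu hv hw; rewrite -[u]scale1r dotDZl // mul1r scale1r. Qed.

Lemma dot0l w : vec w -> \<0, w\> = 0.
Proof.
move=> hw; have := @dotDl 0 0 w vec0 vec0 hw; rewrite addr0 => /eqP.
by rewrite -subr_eq subrr => /eqP <-.
Qed.

Lemma dotZl a u w : vec u -> vec w -> \<a *: u, w\> = a * \<u, w\>.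
Proof.
by move=> hu hw; rewrite -[_ *: _]addr0 dotDZl ?dot0l ?addr0 //; exact: vec0.
Qed.

Lemma dotNl u w : vec u -> vec w -> \<- u, w\> = - \<u, w\>.
Proof. by move=> hu hw; rewrite -scaleN1r dotZl // mulN1r. Qed.

Lemma dotBl u v w : vec u -> vec v -> vec w -> \<u - v, w\> = \<u, w\> - \<v, w\>.
Proof. by move=> hu hv hw; rewrite dotDl ?dotNl //; exact: vecN. Qed.

Lemma dot_suml (I : Type) (s : seq I) (P : pred I) (F : I -> V) w :
  (forall i, P i -> vec (F i)) -> vec w ->
  \<\sum_(i <- s | P i) F i, w\> = \sum_(i <- s | P i) \<F i, w\>.
Proof.
move=> hF hw; elim: s => [|i s IH]; first by rewrite !big_nil dot0l.
rewrite !big_cons; case: ifPn => // Pi.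
by rewrite dotDl ?IH //; [exact: hF|exact: vec_sum].
Qed.

Lemma dotDr u v w : vec u -> vec v -> vec w -> \<w, u + v\> = \<w, u\> + \<w, v\>.
Proof. by move=> hu hv hw; rewrite dotC ?dotDl ?(dotC hw) //; exact: vecD. Qed.

Lemma dotZr a u w : vec u -> vec w -> \<w, a *: u\> = a * \<w, u\>.
Proof. by move=> hu hw; rewrite dotC ?dotZl ?(dotC hw) //; exact: vecZ. Qed.

Lemma dot0r w : vec w -> \<w, 0\> = 0.
Proof. by move=> hw; rewrite dotC ?dot0l //; exact: vec0. Qed.

Lemma dotNr u w : vec u -> vec w -> \<w, - u\> = - \<w, u\>.
Proof. by move=> hu hw; rewrite -scaleN1r dotZr // mulN1r. Qed.

Lemma dotBr u v w : vec u -> vec v -> vec w -> \<w, u - v\> = \<w, u\> - \<w, v\>.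
Proof. by move=> hu hv hw; rewrite dotDr ?dotNr //; exact: vecN. Qed.

Lemma dot_sumr (I : Type) (s : seq I) (P : pred I) (F : I -> V) w :
  (forall i, P i -> vec (F i)) -> vec w ->
  \<w, \sum_(i <- s | P i) F i\> = \sum_(i <- s | P i) \<w, F i\>.
Proof.
move=> hF hw; rewrite dotC ?dot_suml //; last exact: vec_sum.
by apply: eq_bigr => i Pi; rewrite dotC //; exact: hF.
Qed.

Lemma dot_ge0 u : vec u -> 0 <= \<u, u\>.
Proof. by case: ipH => _ _ _ _ h /h[]. Qed.

Lemma dot_eq0 u : vec u -> \<u, u\> = 0 -> u = 0.
Proof. by case: ipH => _ _ _ _ h /h[]. Qed.

Lemma dot_sub_sqr u v : vec u -> vec v ->
  \<u - v, u - v\> = \<u, u\> - 2 * \<u, v\> + \<v, v\>.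
Proof.
move=> hu hv; have huv := vecB hu hv.
by rewrite dotBl // !dotBr // (dotC hv hu); ring.
Qed.

Lemma dot_subC u v : vec u -> vec v -> \<u - v, u - v\> = \<v - u, v - u\>.
Proof. by move=> hu hv; rewrite !dot_sub_sqr // (dotC hv hu); ring. Qed.

Lemma dot_cs u v : vec u -> vec v -> \<u, v\> ^+ 2 <= \<u, u\> * \<v, v\>.
Proof.
move=> hu hv; apply: cauchy_schwarz_disc => [|t]; first exact: dot_ge0.
have htu := vecZ t hu; have htv := vecD htu hv.
suff -> : \<u, u\> * t ^+ 2 + 2 * \<u, v\> * t + \<v, v\> =
    \<t *: u + v, t *: u + v\> by exact: dot_ge0.
by rewrite dotDl // !dotDr // !dotZl // !dotZr // (dotC hv hu); ring.
Qed.

Lemma sqr_hnorm u : vec u -> hnorm H u ^+ 2 = \<u, u\>.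
Proof. by move=> hu; rewrite sqr_sqrtr // dot_ge0. Qed.

Lemma dot_sub_le u v w : vec u -> vec v -> vec w ->
  \<u - w, u - w\> <= 2 * \<u - v, u - v\> + 2 * \<v - w, v - w\>.
Proof.
move=> hu hv hw.
have ha := vecB hu hv; have hb := vecB hv hw.
have -> : u - w = (u - v) + (v - w) by rewrite addrA subrK.
move: (u - v) (v - w) ha hb => a b ha hb.
have := dot_ge0 (vecB ha hb); rewrite dot_sub_sqr //.
have hab := vecD ha hb; rewrite dotDl // !dotDr // (dotC hb ha).
by move=> h; lra.
Qed.

Lemma hcvg_sqr (s : nat -> V) u : (forall i, vec (s i)) -> vec u ->
  (fun i => hnorm H (s i - u)) @ \oo --> (0 : R) ->
  (fun i => \<s i - u, s i - u\>) @ \oo --> (0 : R).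
Proof.
move=> hs hu c.
rewrite (_ : (fun i => _) = (fun i => hnorm H (s i - u) * hnorm H (s i - u))).
  by rewrite -[X in _ --> X](mul0r 0); exact: cvgM.
by apply/funext => i; rewrite -expr2 sqr_hnorm //; exact: vecB.
Qed.

Lemma hcvg_dot (s : nat -> V) u v : (forall i, vec (s i)) -> vec u -> vec v ->
  (fun i => \<s i - u, s i - u\>) @ \oo --> (0 : R) ->
  (fun i => \<s i, v\>) @ \oo --> \<u, v\>.
Proof.
move=> hs hu hv c; apply/cvgrPdist_le => e e0.
have vv := dot_ge0 hv.
have d0 : 0 < e ^+ 2 / (\<v, v\> + 1) by rewrite divr_gt0 ?exprn_gt0 // ltr_wpDl.
move/cvgrPdist_le : c => /(_ _ d0) [N _ hN]; exists N => // i /hN /=.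
rewrite sub0r normrN (ger0_norm (dot_ge0 (vecB (hs i) hu))) => hi.
rewrite -dotBl // -(@ler_pXn2r _ 2) ?nnegrE ?normr_ge0 ?(ltW e0) //.
rewrite real_normK ?num_real // -[u - s i]opprB dotNl ?sqrrN //; last exact: vecB.
apply: le_trans (dot_cs (vecB (hs i) hu) hv) _.
apply: le_trans (ler_wpM2r vv hi) _.
rewrite mulrAC ler_pdivrMr ?ltr_wpDl //.
by rewrite ler_wpM2l ?sqr_ge0 // lerDl.
Qed.

Hypothesis complH : is_complete H.

Lemma hcomplete (s : nat -> V) : (forall i, vec (s i)) ->
  (forall e : R, 0 < e -> exists N : nat, forall i j : nat,
     (N <= i)%N -> (N <= j)%N -> \<s i - s j, s i - s j\> <= e) ->
  exists2 u, vec u & (fun i => \<s i - u, s i - u\>) @ \oo --> (0 : R).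
Proof.
move=> hs cau; case: (complH hs) => [e e0|u hu c]; last first.
  by exists u => //; exact: hcvg_sqr.
have e20 : 0 < (e / 2) ^+ 2 by rewrite exprn_gt0 // divr_gt0.
have [N hN] := cau _ e20; exists N => i j Ni Nj.
have := hN i j Ni Nj; rewrite -(sqr_hnorm (vecB (hs i) (hs j))) => h.
have : hnorm H (s i - s j) <= e / 2.
  by rewrite -(@ler_pXn2r _ 2) ?nnegrE ?sqrtr_ge0 // divr_ge0 // ltW.
lra.
Qed.

(* Basis vectors are enumerated with possible zeros, so that finite and
   infinite bases are treated alike. *)
Definition frame (e : nat -> V) :=
  [/\ forall i, vec (e i), forall i j, i != j -> \<e i, e j\> = 0,
      forall i, e i = 0 \/ \<e i, e i\> = 1
    & forall u, vec u -> (forall i, \<u, e i\> = 0) -> u = 0].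

Section Frame.
Variable e : nat -> V.
Hypothesis frame_e : frame e.

Lemma frame_vec i : vec (e i). Proof. by case: frame_e. Qed.
Hint Resolve frame_vec : core.

Lemma frame_orth i j : i != j -> \<e i, e j\> = 0.
Proof. by case: frame_e => _ h _ _; apply: h. Qed.

(** Removes the factor that tells zero vectors of the frame from unit ones, so that later sums need
    no case distinction. *)
Lemma frame_idem u i : vec u -> \<u, e i\> * \<e i, e i\> = \<u, e i\>.
Proof.
case: frame_e => _ _ /(_ i)[->|->] _ hu; last by rewrite mulr1.
by rewrite dot0r // mul0r.
Qed.

Definition synth (a : nat -> R) n : V := \sum_(i < n) a i *: e i.

Lemma vec_synth a n : vec (synth a n).
Proof. by apply: vec_sum => i _; exact: vecZ. Qed.
Hint Resolve vec_synth : core.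

Lemma dot_synthl a n u : vec u -> \<synth a n, u\> = \sum_(i < n) a i * \<u, e i\>.
Proof.
move=> hu; rewrite dot_suml // => [|i _]; last exact: vecZ.
by apply: eq_bigr => i _; rewrite dotZl // dotC.
Qed.

Lemma dot_synth_frame a n j :
  \<synth a n, e j\> = if (j < n)%N then a j * \<e j, e j\> else 0.
Proof.
rewrite dot_synthl //; case: ltnP => jn.
  rewrite (bigD1 (Ordinal jn)) //= big1 ?addr0 // => i ij.
  rewrite frame_orth ?mulr0 // eq_sym; apply: contra ij => /eqP ij.
  exact/eqP/val_inj.
rewrite big1 // => i _; rewrite frame_orth ?mulr0 //.
by rewrite gtn_eqF // (leq_trans (ltn_ord i)).
Qed.

Lemma dot_synth_sqr a m n : (m <= n)%N ->
  \<synth a n - synth a m, synth a n - synth a m\> =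
  \sum_(m <= i < n) a i ^+ 2 * \<e i, e i\>.
Proof.
move=> mn; rewrite (_ : synth a n - synth a m = \sum_(m <= i < n) a i *: e i).
  rewrite dot_suml => [|i _|]; [|exact: vecZ|by apply: vec_sum => i _; exact: vecZ].
  apply: eq_big_nat => i /andP[mi ni].
  rewrite dot_sumr => [|j _|]; [|exact: vecZ|exact: vecZ].
  rewrite (bigD1_seq i) ?mem_index_iota ?mi ?iota_uniq //= big1 => [|j ji].
    by rewrite addr0 dotZl ?dotZr //; [ring|exact: vecZ].
  by rewrite dotZl ?dotZr ?frame_orth ?mulr0 // 1?eq_sym //; exact: vecZ.
rewrite /synth -!(big_mkord xpredT (fun i => a i *: e i)).
by apply/eqP; rewrite subr_eq addrC eq_sym; apply/eqP; rewrite -big_cat_nat.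
Qed.

Lemma dot_synth_sqr0 a n :
  \<synth a n, synth a n\> = \sum_(0 <= i < n) a i ^+ 2 * \<e i, e i\>.
Proof.
by have := dot_synth_sqr a (leq0n n); rewrite {2 4}/synth big_ord0 subr0.
Qed.

Lemma bdd_nondecr_cauchy (S : nat -> R) (C : R) :
  (forall m n, (m <= n)%N -> S m <= S n) -> (forall n, S n <= C) ->
  forall d, 0 < d -> exists N, forall i j, (N <= i)%N -> (N <= j)%N -> `|S i - S j| <= d.
Proof.
move=> nd bd d d0.
have cS : cvgn S.
  apply: nondecreasing_is_cvgn => //.
  by exists C => _ [n _ <-]; exact: bd.
have d20 : 0 < d / 2 by rewrite divr_gt0.
have /cvgrPdist_le/(_ _ d20)[N _ hN] := cS.
exists N => i j Ni Nj; have /= := hN i Ni; have /= := hN j Nj.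
set l := lim _ => h1 h2.
have -> : S i - S j = (l - S j) - (l - S i) by ring.
by apply: le_trans (ler_normB _ _) _; lra.
Qed.

(** Riesz-Fischer: squared distances of partial sums are increments of a bounded nondecreasing
    sequence, so completeness applies. *)
Lemma synth_cvg (a : nat -> R) (C : R) :
  (forall n, \sum_(0 <= i < n) a i ^+ 2 * \<e i, e i\> <= C) ->
  exists2 f, vec f & (fun n => \<synth a n - f, synth a n - f\>) @ \oo --> (0 : R)
    /\ forall i, \<f, e i\> = a i * \<e i, e i\>.
Proof.
move=> bd; pose S n := \sum_(0 <= i < n) a i ^+ 2 * \<e i, e i\>.
have nd m n : (m <= n)%N -> S m <= S n.
  move=> mn; rewrite /S (big_cat_nat (leq0n m) mn) //= lerDl.
  by apply: sumr_ge0 => i _; rewrite mulr_ge0 ?sqr_ge0 ?dot_ge0.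
have [|d d0|f hf cf] := @hcomplete (synth a).
- by move=> i; exact: vec_synth.
- have [N hN] := bdd_nondecr_cauchy nd bd d0.
  exists N => i j Ni Nj.
  wlog ij : i j Ni Nj / (i <= j)%N.
    move=> h; have [|/ltnW] := leqP i j; first exact: h.
    move=> ji; have := h j i Nj Ni ji.
    by rewrite dot_subC.
  rewrite dot_subC // dot_synth_sqr //; have := hN j i Nj Ni.
  have -> : S j - S i = \sum_(i <= k < j) a k ^+ 2 * \<e k, e k\>.
    by apply/eqP; rewrite subr_eq addrC eq_sym -big_cat_nat.
  by apply: le_trans; exact: ler_norm.
exists f => //; split=> // i.
have := hcvg_dot (fun n => vec_synth a n) hf (frame_vec i) cf => c.
apply: cvg_unique c _ => //; apply: cvg_near_cst.
by exists i.+1 => // n /= hn; rewrite dot_synth_frame hn.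
Qed.

Lemma bessel_eq u n : vec u ->
  \<u - synth (fun i => \<u, e i\>) n, u - synth (fun i => \<u, e i\>) n\> =
  \<u, u\> - \sum_(0 <= i < n) \<u, e i\> ^+ 2.
Proof.
move=> hu; set s := synth _ n; have hs : vec s by exact: vec_synth.
rewrite dot_sub_sqr // (dotC hu) // {1}/s dot_synthl //.
rewrite /s dot_synth_sqr0.
rewrite -(big_mkord xpredT (fun i => \<u, e i\> * \<u, e i\>)).
under eq_bigr do rewrite -expr2.
under [X in _ + X]eq_bigr do rewrite expr2 -mulrA frame_idem // -expr2.
by ring.
Qed.

Lemma bessel u n : vec u -> \sum_(0 <= i < n) \<u, e i\> ^+ 2 <= \<u, u\>.
Proof.
move=> hu; rewrite -subr_ge0 -bessel_eq // dot_ge0 //; exact: vecB.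
Qed.

Lemma fourier_cvg u : vec u ->
  (fun n => \<u - synth (fun i => \<u, e i\>) n,
              u - synth (fun i => \<u, e i\>) n\>) @ \oo --> (0 : R).
Proof.
move=> hu.
have [n|f hf [cf fe]] := @synth_cvg (fun i => \<u, e i\>) \<u, u\>.
  apply: le_trans (bessel n hu).
  by apply: ler_sum => i _; rewrite expr2 -mulrA frame_idem.
have fu : f = u.
  apply/eqP; rewrite -subr_eq0; apply/eqP.
  case: frame_e => _ _ _; apply; first exact: vecB.
  by move=> i; rewrite dotBl // fe frame_idem // subrr.
by under eq_fun do rewrite dot_subC //; rewrite fu in cf.
Qed.

Lemma parseval u : vec u ->
  (fun n => \sum_(0 <= i < n) \<u, e i\> ^+ 2) @ \oo --> \<u, u\>.
Proof.
move=> hu; have := fourier_cvg hu.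
have -> : (fun n => \<u - synth (fun i => \<u, e i\>) n,
              u - synth (fun i => \<u, e i\>) n\>) =
    (fun n => \<u, u\> - \sum_(0 <= i < n) \<u, e i\> ^+ 2).
  by apply/funext => n; rewrite bessel_eq.
move=> /(cvgB (@cvg_cst _ \<u, u\> nat \oo _)); rewrite subr0 => c.
have -> : (fun n => \sum_(0 <= i < n) \<u, e i\> ^+ 2) = (fun n =>
    \<u, u\> - (\<u, u\> - \sum_(0 <= i < n) \<u, e i\> ^+ 2)).
  by apply/funext => n; rewrite opprB addrC subrK.
exact: c.
Qed.

Lemma parseval2 u v : vec u -> vec v ->
  (fun n => \sum_(0 <= i < n) \<u, e i\> * \<v, e i\>) @ \oo --> \<u, v\>.
Proof.
move=> hu hv; set s := synth (fun i => \<u, e i\>).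
rewrite (_ : (fun n => _) = (fun n => \<s n, v\>)); last first.
  apply/funext => n; rewrite dot_synthl // -(big_mkord xpredT (fun i => \<u, e i\> * \<v, e i\>)) //.
have hs n : vec (s n) by exact: vec_synth.
apply: hcvg_dot => //; have := fourier_cvg hu; rewrite -/s.
suff -> : (fun n => \<u - s n, u - s n\>) = (fun n => \<s n - u, s n - u\>) by [].
by apply/funext => n; rewrite dot_subC.
Qed.

(** The representer is synthesized from its coordinates phi (e_i). On a partial sum both phi and the
    squared norm equal S, so the bound reads S^2 <= C S and gives square summability. *)
Lemma riesz (phi : V -> R) (C : R) :
  (forall a u v, vec u -> vec v -> phi (a *: u + v) = a * phi u + phi v) ->
  0 <= C -> (forall u, vec u -> phi u ^+ 2 <= C * \<u, u\>) ->
  exists2 g, vec g & forall u, vec u -> \<g, u\> = phi u.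
Proof.
move=> lin C0 bd.
have phi0 : phi 0 = 0.
  have := lin 1 0 0 vec0 vec0; rewrite scaler0 addr0 mul1r => /eqP.
  by rewrite -subr_eq subrr => /eqP <-.
have phiZ a u : vec u -> phi (a *: u) = a * phi u.
  by move=> hu; rewrite -[_ *: _]addr0 lin ?phi0 ?addr0 //; exact: vec0.
have phiB u v : vec u -> vec v -> phi (u - v) = phi u - phi v.
  by move=> hu hv; rewrite addrC -scaleN1r lin // mulN1r addrC.
have phiS a n : phi (synth a n) = \sum_(i < n) a i * phi (e i).
  elim: n => [|n IH]; first by rewrite /synth !big_ord0.
  by rewrite /synth !big_ord_recr /= addrC lin ?IH 1?addrC //; exact: vec_synth.
pose a i := phi (e i).
have ae i : a i * \<e i, e i\> = a i.
  by case: frame_e => _ _ /(_ i)[h|->] _; rewrite ?mulr1 // /a h phi0 mul0r.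
have bda n : \sum_(0 <= i < n) a i ^+ 2 * \<e i, e i\> <= C.
  have := bd _ (vec_synth a n); rewrite phiS.
  rewrite dot_synth_sqr0.
  set S := \sum_(0 <= _ < n) _.
  have -> : \sum_(i < n) a i * phi (e i) = S.
    by rewrite /S big_mkord; apply: eq_bigr => i _; rewrite expr2 -mulrA ae.
  have S0 : 0 <= S by apply: sumr_ge0 => i _; rewrite mulr_ge0 ?sqr_ge0 ?dot_ge0.
  have [->//|Sn0] := eqVneq S 0.
  by rewrite expr2 ler_pM2r // lt_neqAle eq_sym Sn0.
have [g hg [cg ge]] := synth_cvg bda.
exists g => // u hu; apply/eqP; rewrite -subr_eq0; apply/eqP.
pose psi u := \<g, u\> - phi u.
have psie i : psi (e i) = 0 by rewrite /psi ge ae subrr.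
have psiS b n : psi (synth b n) = 0.
  rewrite /psi phiS dotC // dot_synthl // -sumrB big1 // => i _.
  by rewrite -mulrBr; have := psie i; rewrite /psi => ->; rewrite mulr0.
pose s n := synth (fun i => \<u, e i\>) n.
have hs n : vec (s n) by exact: vec_synth.
have le n : psi u ^+ 2 <= (2 * \<g, g\> + 2 * C) * \<u - s n, u - s n\>.
  have hus := vecB hu (hs n).
  have -> : psi u = psi (u - s n).
    have : psi u - psi (s n) = psi (u - s n) by rewrite /psi phiB // dotBr //; ring.
    by rewrite psiS subr0.
  rewrite /psi; have := bd _ hus; have := dot_cs hg hus.
  set A := \<g, _\>; set B := phi _ => h1 h2.
  have := sqr_ge0 (A + B); rewrite mulrDl -!mulrA.
  by rewrite sqrrB sqrrD => h; lra.
have : (fun n => (2 * \<g, g\> + 2 * C) * \<u - s n, u - s n\>) @ \oo --> (0 : R).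
  rewrite -[X in _ --> X](mulr0 (2 * \<g, g\> + 2 * C)).
  by apply: cvgMr; exact: fourier_cvg.
move=> c; have : psi u ^+ 2 <= 0.
  rewrite -(cvg_lim _ c) //; apply: limr_ge; first by apply/cvg_ex; exists 0.
  by apply: nearW => n; exact: le.
by rewrite -/(psi u) le_eqVlt ltNge sqr_ge0 orbF sqrf_eq0 => /eqP.
Qed.

End Frame.

(** Orthonormal vectors have squared distance 2, so points of a countable dense set chosen within
    1/2 of them are distinct. Their numbers index the basis; the remaining indices get the vector
    0. *)
Lemma onb_frame E : orthonormal_basis H E -> is_separable H ->
  exists e, [/\ frame e, forall i, E (e i) \/ e i = 0,
    forall i j, E (e i) -> e i = e j -> i = j & forall x, E x -> exists i, e i = x].
Proof.
move=> [Ev E1 E0 Ecompl] [D [cD Dv dD]].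
have pick (x : V) : exists y, E x -> D y /\ hnorm H (x - y) < 2^-1.
  have [Ex|] := pselect (E x); last by exists x.
  by have [|y Dy xy] := dD x 2^-1 (Ev _ Ex); [rewrite invr_gt0|exists y].
have [p hp] := choice pick.
have [g gi] : exists g : V -> nat, {in D &, injective g}.
  by case/countable_injP : cD => g gi; exists g.
pose h x := g (p x).
have hi x y : E x -> E y -> h x = h y -> x = y.
  move=> Ex Ey hxy; apply: contrapT => xy.
  have [Dx dx] := hp _ Ex; have [Dy dy] := hp _ Ey.
  have pxy : p x = p y by apply: gi => //; rewrite inE.
  have vx := Ev _ Ex; have vy := Ev _ Ey; have vp := Dv _ Dx.
  have := dot_sub_le vx vp vy; rewrite dot_sub_sqr // (E1 _ Ex) (E1 _ Ey) (E0 _ _ Ex Ey xy).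
  rewrite (dot_subC vp vy).
  have sm z : vec (z - p x) -> hnorm H (z - p x) < 2^-1 -> \<z - p x, z - p x\> < 4^-1.
    move=> hz hlt; rewrite -sqr_hnorm //.
    have -> : (4^-1 : R) = 2^-1 ^+ 2 by field.
    by rewrite ltr_pXn2r ?nnegrE ?sqrtr_ge0.
  have := sm x (vecB vx vp) dx; rewrite -pxy in dy.
  by have := sm y (vecB vy vp) dy; lra.
pose e i : V := xget 0 [set x | E x /\ h x = i].
have eP i : (E (e i) /\ h (e i) = i) \/ e i = 0.
  rewrite /e; have [[x [Ex hx]]|no] := pselect (exists x, E x /\ h x = i).
    left; have /= := @xgetPex _ 0 [set x | E x /\ h x = i] (ex_intro _ x (conj Ex hx)).
    by [].
  by right; apply: xgetPN => x Ex; apply: no; exists x.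
have N0 : ~ E 0.
  by move=> /E1; rewrite (dot0r vec0) => /eqP; rewrite eq_sym oner_eq0.
have es x : E x -> e (h x) = x.
  move=> Ex; have [[Ee he]|e0] := eP (h x); first exact: hi.
  have : E (e (h x)) /\ h (e (h x)) = h x.
    by have /= := @xgetPex _ 0 [set y | E y /\ h y = h x] (ex_intro _ x (conj Ex erefl)).
  by rewrite e0 => -[/N0].
exists e; split.
- split.
  + by move=> i; have [[/Ev]|->] := eP i => //; exact: vec0.
  + move=> i j ij.
    have [[Ei hEi]|->] := eP i; last first.
      by rewrite dot0l //; have [[/Ev]|->] := eP j => //; exact: vec0.
    have [[Ej hEj]|->] := eP j; last by rewrite dot0r //; exact: Ev.
    by apply: E0 => // eij; move: ij; rewrite -hEi -hEj eij eqxx.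
  + by move=> i; have [[/E1]|] := eP i; [right|left].
  + move=> u hu h0; apply: Ecompl => // x Ex.
    by rewrite -(es _ Ex) h0.
- by move=> i; have [[]|] := eP i; [left|right].
- move=> i j Ei eij; have [[_ <-]|ei0] := eP i; last by rewrite ei0 in Ei.
  have [[_ <-]|ej0] := eP j; last by rewrite eij ej0 in Ei.
  by rewrite eij.
- by move=> x Ex; exists (h x); exact: es.
Qed.

(** [Sp] is not assumed closed, so the projection g is a limit of elements of [Sp]. The sequence is
    kept in the conclusion because properties such as measurability pass along it to g. *)
Lemma projection (Sp : set V) f : Sp 0 ->
  (forall a u v, Sp u -> Sp v -> Sp (a *: u + v)) -> Sp `<=` vec -> vec f ->
  exists g (s : nat -> V), [/\ vec g, forall i, Sp (s i),
    (fun i => \<s i - g, s i - g\>) @ \oo --> (0 : R)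
    & forall v, Sp v -> \<f - g, v\> = 0].
Proof.
move=> sp0 spD spv hf.
pose A : set R := [set \<f - v, f - v\> | v in Sp].
have A0 : A !=set0 by exists \<f - 0, f - 0\>; exists 0.
have lbA : has_lbound A.
  by exists 0 => _ [v Sv <-]; apply: dot_ge0; apply: vecB => //; exact: spv.
have infA : has_inf A by [].
pose d := inf A.
have dle v : Sp v -> d <= \<f - v, f - v\> by move=> Sv; apply: ge_inf => //; exists v.
have pick (i : nat) : exists v, Sp v /\ \<f - v, f - v\> < d + i.+1%:R^-1.
  have [_ [v Sv <-] lt] := @inf_adherent _ A i.+1%:R^-1 ltac:(by rewrite invr_gt0) infA.
  by exists v.
have [s hs] := choice pick.
have Ss i : Sp (s i) by case: (hs i).
have vs i : vec (s i) by exact: spv.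
have spH u v : Sp u -> Sp v -> Sp (2^-1 *: (u + v)).
  move=> Su Sv; rewrite -[_ *: _]addr0; apply: (spD) => //.
  by rewrite -[u]scale1r; exact: spD.
(* Parallelogram law, the midpoint of [s i] and [s j] being a competitor for the infimum d. *)
have near i j : \<s i - s j, s i - s j\> <= 2 * i.+1%:R^-1 + 2 * j.+1%:R^-1.
  have := dle _ (spH _ _ (Ss i) (Ss j)).
  have [_ ] := hs i; have [_] := hs j.
  have hsum := vecD (vs i) (vs j).
  rewrite !dot_sub_sqr //; last exact: vecZ.
  rewrite dotZr // (dotDr (vs i)) // dotZl // ?dotZr //; last exact: vecZ.
  rewrite dotDl // !dotDr // (dotC (vs j) (vs i)).
  by move: (i.+1%:R^-1) (j.+1%:R^-1) => x y; lra.
have [e e0|g hg cg] := hcomplete vs.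
  have [N _ hN] := near_infty_natSinv_lt (PosNum (divr_gt0 e0 (ltr0n R 4))).
  exists N => i j Ni Nj; apply: le_trans (near i j) _.
  have := hN i Ni; have := hN j Nj; rewrite /=.
  by move: (i.+1%:R^-1) (j.+1%:R^-1) => x y; lra.
exists g, s; split=> // v Sv; have vv := spv _ Sv.
(* Minimality against [t *: v + s i] gives, in the limit, a nonnegative quadratic polynomial in t
   without constant term; its linear coefficient must vanish. *)
suff : (- \<f - g, v\>) ^+ 2 <= \<v, v\> * 0.
  by rewrite mulr0 sqrrN le_eqVlt ltNge sqr_ge0 orbF sqrf_eq0 => /eqP.
apply: cauchy_schwarz_disc => [|t]; first exact: dot_ge0.
have key i : 0 <= \<v, v\> * t ^+ 2 + 2 * - \<f - s i, v\> * t + i.+1%:R^-1.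
  have hfs := vecB hf (vs i).
  have := dle (t *: v + s i) (spD _ _ _ Sv (Ss i)).
  have -> : f - (t *: v + s i) = (f - s i) - t *: v by rewrite opprD addrA addrAC.
  rewrite dot_sub_sqr //; last exact: vecZ.
  rewrite dotZl ?dotZr //; last exact: vecZ.
  by have [_] := hs i; move: (i.+1%:R^-1) => x; lra.
have c : (fun i => \<v, v\> * t ^+ 2 + 2 * - \<f - s i, v\> * t + i.+1%:R^-1) @ \oo
    --> \<v, v\> * t ^+ 2 + 2 * - \<f - g, v\> * t + 0.
  apply: cvgD; last exact: cvg_harmonic.
  apply: cvgD; first exact: cvg_cst.
  apply: cvgMl; apply: cvgMr; apply: cvgN.
  have -> : (fun i => \<f - s i, v\>) = (fun i => \<f, v\> - \<s i, v\>).
    by apply/funext => i; rewrite dotBl.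
  by rewrite dotBl //; apply: cvgB; [exact: cvg_cst|exact: hcvg_dot].
rewrite -(cvg_lim _ c) //; apply: limr_ge; last exact: nearW.
by apply/cvg_ex; eexists; exact: c.
Qed.

End HilbertTheory.

(** * Expectations and independence *)

Section MatrixMeasurability.
Context (R : realType) d (T : measurableType d).

Lemma measurable_funV (f : T -> R) :
  measurable_fun setT f -> measurable_fun setT (fun t => (f t)^-1).
Proof.
suff mV : measurable_fun [set: R] (fun x : R => x^-1).
  by move=> mf; exact: measurableT_comp mV mf.
have open0 : open (~` [set (0 : R)]).
  apply: closed_openC.
  exact/accessible_closed_set1/hausdorff_accessible/Rhausdorff.
rewrite -(setvU [set (0 : R)]); apply/measurable_funU.
- exact: open_measurable.
- exact: measurable_set1.
split; last exact: measurable_fun_set1.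
apply: open_continuous_measurable_fun => // x; rewrite inE /= => /eqP x0.
exact: inv_continuous.
Qed.

Definition measurable_mx m n (A : T -> 'M[R]_(m, n)) :=
  forall i j, measurable_fun setT (fun t => A t i j).

Lemma measurable_mulmx m n p (A : T -> 'M[R]_(m, n)) (B : T -> 'M[R]_(n, p)) :
  measurable_mx A -> measurable_mx B -> measurable_mx (fun t => A t *m B t).
Proof.
move=> mA mB i j; under eq_fun do rewrite mxE.
by apply: measurable_sum => k; exact: measurable_funM.
Qed.

Lemma measurable_addmx m n (A B : T -> 'M[R]_(m, n)) :
  measurable_mx A -> measurable_mx B -> measurable_mx (fun t => A t + B t).
Proof.
by move=> mA mB i j; under eq_fun do rewrite mxE; exact: measurable_funD.
Qed.

Lemma measurable_cstmx m n (A : 'M[R]_(m, n)) : measurable_mx (fun=> A).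
Proof. by move=> i j; exact: measurable_cst. Qed.

Lemma measurable_det n (A : T -> 'M[R]_n) :
  measurable_mx A -> measurable_fun setT (fun t => \det (A t)).
Proof.
move=> mA; rewrite /determinant; apply: measurable_sum => s.
apply: measurable_funM; first exact: measurable_cst.
by apply: measurable_prod => i _; exact: mA.
Qed.

Lemma measurable_invmx n (A : T -> 'M[R]_n) :
  (forall t, A t \in unitmx) -> measurable_mx A ->
  measurable_mx (fun t => invmx (A t)).
Proof.
move=> uA mA i j; rewrite /invmx.
under eq_fun => t do rewrite uA !mxE.
apply: measurable_funM; first by apply: measurable_funV; exact: measurable_det.
rewrite /cofactor; apply: measurable_funM; first exact: measurable_cst.
apply: measurable_det => k l; under eq_fun do rewrite !mxE; exact: mA.
Qed.

End MatrixMeasurability.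

Section Expectation.
Context (R : realType) d (T : measurableType d) (mu : {measure set T -> \bar R}).
Implicit Types f g : T -> R.

Definition Ex f : R := \int[mu]_x f x.
Definition integr f := mu.-integrable setT (EFin \o f).

Lemma integr_meas f : integr f -> measurable_fun setT f.
Proof. by move=> /measurable_int/measurable_EFinP. Qed.

Lemma eq_integr f g : f =1 g -> integr f -> integr g.
Proof. by move=> /funext ->. Qed.

Lemma eq_Ex f g : f =1 g -> Ex f = Ex g.
Proof. by move=> /funext ->. Qed.

Lemma integrD f g : integr f -> integr g -> integr (fun t => f t + g t).
Proof.
move=> hf hg; have := integrableD measurableT hf hg.
by apply: eq_integrable => // x _.
Qed.

Lemma integrZ a f : integr f -> integr (fun t => a * f t).
Proof.
move=> hf; have := integrableZl measurableT a hf.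
by apply: eq_integrable => // x _.
Qed.

Lemma integr0 : integr (fun=> 0).
Proof. exact: integrable0. Qed.

Lemma integrB f g : integr f -> integr g -> integr (fun t => f t - g t).
Proof.
move=> hf hg; apply: integrD => //.
by apply: eq_integr (integrZ (-1) hg) => t; rewrite mulN1r.
Qed.

Lemma integr_sum (I : Type) (s : seq I) (P : pred I) (F : I -> T -> R) :
  (forall i, P i -> integr (F i)) -> integr (fun t => \sum_(i <- s | P i) F i t).
Proof.
move=> hF; elim: s => [|i s IH].
  by apply: eq_integr integr0 => t; rewrite big_nil.
case: (boolP (P i)) => Pi.
  by apply: eq_integr (integrD (hF i Pi) IH) => t; rewrite big_cons Pi.
by apply: eq_integr IH => t; rewrite big_cons (negbTE Pi).
Qed.

Lemma integr_le f g : measurable_fun setT f -> (forall t, `|f t| <= g t) ->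
  integr g -> integr f.
Proof.
move=> mf fg hg; apply: (le_integrable _ _ _ hg) => //; first exact/measurable_EFinP.
by move=> t _ /=; rewrite lee_fin; apply: le_trans (fg t) (ler_norm _).
Qed.

Lemma EFin_Ex f : integr f -> (\int[mu]_x (f x)%:E)%E = (Ex f)%:E.
Proof. by move=> hf; rewrite /Ex /Rintegral fineK // integrable_fin_num. Qed.

Lemma ExD f g : integr f -> integr g -> Ex (fun t => f t + g t) = Ex f + Ex g.
Proof. by move=> hf hg; rewrite /Ex RintegralD. Qed.

Lemma ExZ a f : integr f -> Ex (fun t => a * f t) = a * Ex f.
Proof. by move=> hf; rewrite /Ex RintegralZl. Qed.

Lemma ExB f g : integr f -> integr g -> Ex (fun t => f t - g t) = Ex f - Ex g.
Proof. by move=> hf hg; rewrite /Ex RintegralB. Qed.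

Lemma Ex0 : Ex (fun=> 0) = 0.
Proof. by rewrite /Ex /Rintegral integral0. Qed.

Lemma Ex_sum (I : Type) (s : seq I) (P : pred I) (F : I -> T -> R) :
  (forall i, P i -> integr (F i)) ->
  Ex (fun t => \sum_(i <- s | P i) F i t) = \sum_(i <- s | P i) Ex (F i).
Proof.
move=> hF; elim: s => [|i s IH].
  by rewrite big_nil -[RHS]Ex0; apply: eq_Ex => t; rewrite big_nil.
rewrite big_cons -IH; case: (boolP (P i)) => Pi.
  rewrite -ExD //; [|exact: hF|exact: integr_sum].
  by apply: eq_Ex => t; rewrite big_cons Pi.
by apply: eq_Ex => t; rewrite big_cons (negbTE Pi).
Qed.

Lemma Ex_ge0 f : (forall t, 0 <= f t) -> 0 <= Ex f.
Proof. by move=> h; apply: Rintegral_ge0. Qed.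

Lemma Ex_le f g : integr f -> integr g -> (forall t, f t <= g t) -> Ex f <= Ex g.
Proof. by move=> hf hg fg; apply: le_Rintegral. Qed.

Lemma integr_bdd_ge0 f (C : R) : measurable_fun setT f -> (forall t, 0 <= f t) ->
  (\int[mu]_x (f x)%:E <= C%:E)%E -> integr f /\ Ex f <= C.
Proof.
move=> mf f0 le.
have hf : integr f.
  apply/integrableP; split; first exact/measurable_EFinP.
  under eq_integral => t _ do rewrite /= ger0_norm //.
  exact: le_lt_trans le (ltry _).
by split=> //; rewrite -lee_fin -EFin_Ex.
Qed.

(* No measurability is needed of F, whose integral is a supremum over simple
   functions below it. *)
Lemma integral_le_Ex (F : T -> \bar R) f : integr f -> (forall t, 0 <= f t) ->
  (forall t, F t <= (f t)%:E)%E -> (\int[mu]_t F t <= (Ex f)%:E)%E.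
Proof.
move=> hf f0 Ff; rewrite -EFin_Ex // integralE.
have neg0 : (0 <= \int[mu]_t F^\- t)%E by exact: integral_ge0.
apply: (@le_trans _ _ (\int[mu]_t F^\+ t)%E); first by rewrite -[leRHS]adde0 leeD2l // oppe_le0.
rewrite !ge0_integralTE//.
apply: ub_ereal_sup => _ [h hF <-]; apply: ereal_sup_ubound; exists h => // t.
apply: le_trans (hF t) _; rewrite funeposE ge_max Ff /=.
by rewrite lee_fin.
Qed.

End Expectation.

Section ProbabilityExpectation.
Context (R : realType) d (T : measurableType d) (P : probability T R).

Lemma integr_cst (c : R) : integr P (fun=> c).
Proof.
exact: finite_measure_integrable_cst.
Qed.

Lemma Ex_cst (c : R) : Ex P (fun=> c) = c.
Proof.
rewrite /Ex -[RHS]mulr1 -[X in _ = _ * X]/(fine 1%E) -(@probability_setT _ _ _ P).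
exact: Rintegral_cst.
Qed.

Lemma integr_bdd (f : T -> R) (C : R) : measurable_fun setT f ->
  (forall t, `|f t| <= C) -> integr P f.
Proof. by move=> mf fC; apply: integr_le mf fC _; exact: integr_cst. Qed.

End ProbabilityExpectation.

(** * Independence from the sigma-algebra of a pi-system *)

Section Independence.
Context (R : realType) d1 d2 (O : measurableType d1) (T : measurableType d2).
Context (P : probability O R) (Z : O -> T) (G : set (set O)).
Hypotheses (mZ : measurable_fun setT Z) (mG : G `<=` measurable).
Hypotheses (GI : setI_closed G) (GT : G setT).
Hypothesis indG : forall B A, measurable B -> G A ->
  P (Z @^-1` B `&` A) = (P (Z @^-1` B) * P A)%E.

(** For fixed B both sides are finite measures in A that agree on the pi-system G. *)
Lemma indep_sigma B A : measurable B -> <<s G >> A ->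
  P (Z @^-1` B `&` A) = (P (Z @^-1` B) * P A)%E.
Proof.
move=> mB.
have mZB : measurable (Z @^-1` B) by rewrite -[_ @^-1` _]setTI; exact: mZ.
have PB0 : (0 <= fine (P (Z @^-1` B)))%R by rewrite fine_ge0.
pose m1 := mrestr P mZB.
pose m2 := mscale (NngNum PB0) P.
have -> : P (Z @^-1` B `&` A) = m1 A by rewrite /m1 /mrestr setIC.
have -> : (P (Z @^-1` B) * P A)%E = m2 A.
  by rewrite /m2 /mscale /= fineK // fin_num_measure.
apply: (g_sigma_algebra_measure_unique G mG (fun=> setT)) => //.
- by rewrite bigcup_const //; exists 0%N.
- move=> C GC; rewrite /= /m1 /mrestr setIC indG // /m2 /mscale /= fineK //.
  by rewrite fin_num_measure.
- move=> _; rewrite /= /m1 /mrestr setTI.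
  by rewrite -ge0_fin_numE // fin_num_measure.
Qed.

(** The joint law of [h \o Z] and [eta] is identified with the product of their laws on rectangles;
    the expectation then factors by Fubini. *)
Lemma indep_Ex (h : T -> R) (eta : O -> R) :
  measurable_fun setT h ->
  measurable_fun setT (eta : g_sigma_algebraType G -> R) ->
  integr P (h \o Z) -> integr P eta ->
  integr P (fun w => h (Z w) * eta w) /\
  Ex P (fun w => h (Z w) * eta w) = Ex P (h \o Z) * Ex P eta.
Proof.
move=> mh meta ih ieta.
have mu := integr_meas ih; have mv := integr_meas ieta.
pose U : {mfun O >-> R} := HB.pack (h \o Z) (isMeasurableFun.Build _ _ _ _ _ mu).
pose W : {mfun O >-> R} := HB.pack eta (isMeasurableFun.Build _ _ _ _ _ mv).
pose phi (w : O) : R * R := (U w, W w).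
have mphi : measurable_fun setT phi by apply: measurable_fun_pair.
pose m1 := distribution P U; pose m2 := distribution P W.
have law (C : set (R * R)) : measurable C -> (m1 \x m2)%E C = pushforward P phi C.
  apply: (@product_measure_unique _ _ _ _ _ m1 m2 (pushforward P phi)) => A B mA mB.
  rewrite /pushforward /= /m1 /m2 /distribution /pushforward /=.
  have -> : phi @^-1` (A `*` B) = Z @^-1` (h @^-1` A) `&` eta @^-1` B by [].
  have mhA : measurable (h @^-1` A) by rewrite -[_ @^-1` _]setTI; exact: mh.
  rewrite indep_sigma //.
  by have := meta measurableT B mB; rewrite setTI.
pose f (z : R * R) : \bar R := (z.1 * z.2)%:E.
have mf : measurable_fun setT f.
  by apply/measurable_EFinP; apply: measurable_funM;
    [exact: measurable_fst|exact: measurable_snd].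
have ih1 : m1.-integrable setT (EFin : R -> \bar R).
  by apply: integrable_pushforward.
have ih2 : m2.-integrable setT (EFin : R -> \bar R).
  by apply: integrable_pushforward.
have intf : (m1 \x m2)%E.-integrable setT f.
  apply/integrable12ltyP => //.
  have inner (x : R) : (\int[m2]_y `|f (x, y)| =
      `|x%:E| * \int[m2]_y `|(y : R)%:E|)%E.
    rewrite -ge0_integralZl //; last by apply/measurable_EFinP; exact: normr_measurable.
    by apply: eq_integral => y _; rewrite /f EFinM abseM.
  under eq_integral do rewrite inner.
  have /integrableP[_ fin2] := ih2; have /integrableP[_ fin1] := ih1.
  rewrite ge0_integralZr //=; last 2 first.
  - by apply/measurable_EFinP; exact: normr_measurable.
  - exact: integral_ge0.
  by rewrite lte_mul_pinfty // ?integral_ge0 // ge0_fin_numE // integral_ge0.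
have e1 : (\int[m1 \x m2]_z f z = (Ex P (h \o Z) * Ex P eta)%:E)%E.
  rewrite -integral12_prod_meas1 //.
  rewrite (eq_integral (fun x : R => (x * Ex P eta)%:E)); last first.
    move=> x _; rewrite /fubini_F /f /=.
    under eq_integral do rewrite EFinM.
    rewrite integralZl // EFinM; congr (_ * _)%E.
    by rewrite integral_distribution // -EFin_Ex.
  under eq_integral do rewrite EFinM.
  rewrite integralZr // EFinM; congr (_ * _)%E.
  by rewrite integral_distribution // -EFin_Ex.
have intp : (pushforward P phi).-integrable setT f.
  move/integrableP : intf => [_ fin]; apply/integrableP; split=> //.
  apply: le_lt_trans fin; rewrite le_eqVlt; apply/orP; left; apply/eqP.
  by apply: eq_measure_integral => C mC _; exact/esym/law.
have iprod : integr P (fun w => h (Z w) * eta w).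
  move/integrableP : intp => [_ fin]; apply/integrableP; split.
    by apply/measurable_EFinP; exact: measurable_funM.
  move: fin; rewrite ge0_integral_pushforward //.
  exact: measurableT_comp.
split=> //; apply: EFin_inj; rewrite -e1 -EFin_Ex //.
rewrite (eq_measure_integral (pushforward P phi)) => [|C mC _]; last exact: law.
by rewrite integral_pushforward.
Qed.

End Independence.

(** * Independent points together with a random index set *)

Section Sampling.
Context (R : realType) dO dT (O : measurableType dO) (T : measurableType dT).
Context (P : probability O R) (Q : probability T R).

(** The points are independent of law Q and jointly independent of S, while the law of S is left
    free. *)
Record sampling N (Z : 'I_N -> O -> T) (S : O -> {set 'I_N}) : Prop := Sampling {
  sampling_Z : forall i, measurable_fun setT (Z i) ;
  sampling_S : forall s, measurable (S @^-1` [set s]) ;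
  sampling_law : forall (B : 'I_N -> set T) (A : set {set 'I_N}),
    (forall i, measurable (B i)) ->
    P ((\bigcap_i (Z i @^-1` B i)) `&` S @^-1` A) =
    ((\prod_i fine (Q (B i)))%:E * P (S @^-1` A))%E }.

Section SamplingTheory.
Context N (Z : 'I_N -> O -> T) (S : O -> {set 'I_N}).
Hypothesis hZS : sampling Z S.

(** Pi-system of the events that concern S and all points except the t-th; [B t = setT] says that
    [Z t] is not consulted. *)
Definition others (t : 'I_N) : set (set O) :=
  [set C | exists (B : 'I_N -> set T) (A : set {set 'I_N}),
    [/\ forall i, measurable (B i), B t = setT
      & C = (\bigcap_i (Z i @^-1` B i)) `&` S @^-1` A]].

Lemma measurable_preS A : measurable (S @^-1` A).
Proof.
have -> : S @^-1` A = \bigcup_(s in A) (S @^-1` [set s]).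
  apply/seteqP; split => w /=; first by move=> Aw; exists (S w).
  by move=> [s As /= ->].
by apply: fin_bigcup_measurable => // s _; exact: (sampling_S hZS).
Qed.

Lemma measurable_preZ i B : measurable B -> measurable (Z i @^-1` B).
Proof. by move=> mB; rewrite -[_ @^-1` _]setTI; exact: (sampling_Z hZS). Qed.

Lemma others_measurable t : others t `<=` measurable.
Proof.
move=> _ [B [A [mB _ ->]]]; apply: measurableI; last exact: measurable_preS.
by apply: fin_bigcap_measurable => // i _; exact: measurable_preZ.
Qed.

Lemma others_setI t : setI_closed (others t).
Proof.
move=> _ _ [B [A [mB Bt ->]]] [B' [A' [mB' Bt' ->]]].
exists (fun i => B i `&` B' i), (A `&` A'); split.
- by move=> i; exact: measurableI.
- by rewrite Bt Bt' setIT.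
- rewrite setIACA preimage_setI -bigcapI; congr (_ `&` _).
Qed.

Lemma others_setT t : others t setT.
Proof.
exists (fun=> setT), setT; split => //.
by rewrite preimage_setT setIT; apply/seteqP; split => // w _ i _.
Qed.

Lemma sampling_marginal t B : measurable B -> P (Z t @^-1` B) = Q B.
Proof.
move=> mB.
have := @sampling_law _ _ _ hZS (fun i => if i == t then B else setT) setT.
rewrite preimage_setT probability_setT setIT mule1.
rewrite (bigD1 t) //= eqxx big1 ?mulr1; last first.
  by move=> i /negbTE ->; rewrite probability_setT.
rewrite fineK ?fin_num_measure // => <-; last by move=> i; case: ifP.
congr (P _); apply/seteqP; split => [w Bw i _|w h].
  by case: eqP => // ->.
by have := h t I; rewrite eqxx.
Qed.

Lemma others_indep t B A : measurable B -> others t A ->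
  P (Z t @^-1` B `&` A) = (P (Z t @^-1` B) * P A)%E.
Proof.
move=> mB [B' [A' [mB' Bt ->]]].
rewrite sampling_marginal // (sampling_law hZS) //.
have := @sampling_law _ _ _ hZS (fun i => if i == t then B else B' i) A'.
rewrite (bigD1 t) //= eqxx => e.
rewrite [in RHS](bigD1 t) //= Bt probability_setT /= mul1r.
have -> : \prod_(i < N | i != t) fine (Q (B' i)) =
    \prod_(i < N | i != t) fine (Q (if i == t then B else B' i)).
  by apply: eq_bigr => i /negbTE ->.
rewrite -[Q B]fineK ?fin_num_measure // muleA -EFinM -e; last by move=> i; case: ifP.
congr (P _); rewrite setIA; congr (_ `&` _).
apply/seteqP; split => [w [Bw h] i _|w h].
  by case: eqP => [->//|_]; exact: h.
split; first by have := h t I; rewrite eqxx.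
move=> i _; have := h i I; case: eqP => // -> _.
by rewrite Bt.
Qed.

Lemma integr_sample t (h : T -> R) : integr Q h -> integr P (h \o Z t).
Proof.
move=> ih; have mh := integr_meas ih.
pose U : {mfun O >-> T} := HB.pack (Z t) (isMeasurableFun.Build _ _ _ _ _ (sampling_Z hZS t)).
move/integrableP : ih => [_ fin]; apply/integrableP; split.
  by apply/measurable_EFinP; apply: measurableT_comp => //; exact: (sampling_Z hZS).
move: fin.
rewrite (eq_measure_integral (distribution P U)) => [|A mA _]; last first.
  exact/esym/sampling_marginal.
rewrite ge0_integral_distribution //.
by apply: measurableT_comp => //; exact/measurable_EFinP.
Qed.

Lemma Ex_sample t (h : T -> R) : integr Q h -> Ex P (h \o Z t) = Ex Q h.
Proof.
move=> ih; have mh := integr_meas ih; have ih' := integr_sample t ih.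
pose U : {mfun O >-> T} := HB.pack (Z t) (isMeasurableFun.Build _ _ _ _ _ (sampling_Z hZS t)).
apply: EFin_inj; rewrite -!EFin_Ex //.
rewrite [RHS](eq_measure_integral (distribution P U)) => [|A mA _]; last first.
  exact/esym/sampling_marginal.
by rewrite integral_distribution //; exact/measurable_EFinP.
Qed.

(** The form in which independence is used throughout: [eta] may be any statistic of S and of the
    other points, for instance a coefficient of a function fitted to them. *)
Lemma sampling_indep t (h : T -> R) (eta : O -> R) : integr Q h ->
  measurable_fun setT (eta : g_sigma_algebraType (others t) -> R) ->
  integr P eta ->
  integr P (fun w => h (Z t w) * eta w) /\
  Ex P (fun w => h (Z t w) * eta w) = Ex Q h * Ex P eta.
Proof.
move=> ih meta ieta; rewrite -(Ex_sample t ih).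
apply: (@indep_Ex _ _ _ _ _ _ _ (others t)) => //.
- exact: (sampling_Z hZS).
- exact: others_measurable.
- exact: others_setI.
- exact: others_setT.
- exact: others_indep.
- exact: integr_meas ih.
- exact: integr_sample.
Qed.

Lemma others_Z t i : i != t ->
  measurable_fun setT (Z i : g_sigma_algebraType (others t) -> T).
Proof.
move=> it _ B mB; rewrite setTI; apply: sub_sigma_algebra.
exists (fun j => if j == i then B else setT), setT; split.
- by move=> j; case: ifP.
- by rewrite eq_sym (negbTE it).
- rewrite preimage_setT setIT; apply/seteqP; split => [w Bw j _|w h].
    by case: eqP => // ->.
  by have := h i I; rewrite eqxx.
Qed.

Definition indS s (w : O) : R := (S w == s)%:R.

Lemma others_indS t s :
  measurable_fun setT (indS s : g_sigma_algebraType (others t) -> R).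
Proof.
have mS : measurable (S @^-1` [set s] : set (g_sigma_algebraType (others t))).
  apply: sub_sigma_algebra; exists (fun=> setT), [set s]; split => //.
  rewrite (_ : \bigcap_i _ = setT) ?setTI //.
  by apply/seteqP; split => // w _ i _.
rewrite (_ : indS s = \1_(S @^-1` [set s])); first exact: measurable_indic.
apply/funext => w; rewrite /indS indicE; congr (nat_of_bool _)%:R.
by apply/idP/idP => [/eqP h|]; [rewrite inE|rewrite inE => /eqP].
Qed.

Lemma measurable_others t (eta : O -> R) :
  measurable_fun setT (eta : g_sigma_algebraType (others t) -> R) ->
  measurable_fun setT eta.
Proof.
move=> meta _ B mB; have := meta measurableT B mB; rewrite !setTI => h.
by apply: (@smallest_sub _ _ (others t)) h; [exact: sigma_algebra_measurable|exact: others_measurable].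
Qed.

End SamplingTheory.
End Sampling.

(** * Lower tail of empirical second moments *)

Section LowerTail.
Context (R : realType) dO dT (O : measurableType dO) (T : measurableType dT).
Context (P : probability O R) (Q : probability T R).
Context (N : nat) (Z : 'I_N -> O -> T) (S : O -> {set 'I_N}).
Hypothesis hZS : sampling P Q Z S.
Context (D : nat) (v : T -> 'cV[R]_D) (Lam : 'I_D -> R) (b : R).
Hypotheses (mv : measurable_mx v) (vb : forall z, sqn (v z) <= b).
Hypothesis Lam01 : forall a, 0 <= Lam a <= 1.
Hypothesis vLam : forall a c,
  Ex Q (fun z => v z a ord0 * v z c ord0) = (a == c)%:R * Lam a.

Let b_ge0 : 0 <= b.
Proof. exact: le_trans (sqn_ge0 (v point)) (vb point). Qed.

Definition Lam_mx : 'M[R]_D := diag_mx (\row_a Lam a).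

Definition centered z : 'M[R]_D := v z *m (v z)^T - Lam_mx.

(** In the application Lam_i = mu_i / (mu_i + lam), so that 1 - Lam carries the penalty lam |g|^2
    and the sum carries the empirical second moment on the block. When B has k elements, the
    expectation is the identity. *)
Definition block_form (k : nat) (B : {set 'I_N}) (zs : 'I_N -> T) : 'M[R]_D :=
  1%:M - Lam_mx + k%:R^-1 *: \sum_(t in B) v (zs t) *m (v (zs t))^T.

Lemma vvT z a c : (v z *m (v z)^T) a c = v z a ord0 * v z c ord0.
Proof. by rewrite mxE big_ord1 mxE. Qed.

Lemma dotv_Lam (x y : 'cV[R]_D) :
  dotv (Lam_mx *m x) y = \sum_a Lam a * x a ord0 * y a ord0.
Proof. by apply: eq_bigr => a _; rewrite mul_diag_mx !mxE. Qed.

Lemma block_form_sym k (B : {set 'I_N}) (zs : 'I_N -> T) : (block_form k B zs)^T = block_form k B zs.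
Proof.
rewrite /block_form !linearD /= linearN linearZ /= trmx1 tr_diag_mx linear_sum /=.
by under eq_bigr do rewrite trmx_mul trmxK.
Qed.

Lemma dotv_block_form k (B : {set 'I_N}) (zs : 'I_N -> T) (x : 'cV[R]_D) :
  dotv (block_form k B zs *m x) x = \sum_a (1 - Lam a) * x a ord0 ^+ 2 +
    k%:R^-1 * \sum_(t in B) dotv (v (zs t)) x ^+ 2.
Proof.
rewrite /block_form !mulmxDl mulNmx mul1mx -scalemxAl !dotvE dotv_Lam.
congr (_ + _).
  rewrite -sumrB; apply: eq_bigr => a _; ring.
congr (_ * _); rewrite mulmx_suml.
elim/big_ind2 : _ => [|x1 x2 y1 y2 <- <-|t _].
- by rewrite /dotv big1 // => i _; rewrite mxE mul0r.
- by rewrite dotvDl.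
- by rewrite -mulmxA dotv_trmx {1}/dotv big_ord1 !dotv_mx expr2.
Qed.

Lemma block_form_psd k (B : {set 'I_N}) (zs : 'I_N -> T) (x : 'cV[R]_D) : 0 <= dotv (block_form k B zs *m x) x.
Proof.
rewrite dotv_block_form addr_ge0 ?mulr_ge0 ?invr_ge0 ?ler0n //.
  apply: sumr_ge0 => a _; rewrite mulr_ge0 ?sqr_ge0 // subr_ge0.
  by case/andP: (Lam01 a).
by apply: sumr_ge0 => t _; exact: sqr_ge0.
Qed.

Lemma block_form_sub1 k (B : {set 'I_N}) (zs : 'I_N -> T) : #|B| = k -> (0 < k)%N ->
  block_form k B zs - 1%:M = k%:R^-1 *: \sum_(t in B) centered (zs t).
Proof.
move=> Bk k0; rewrite /block_form addrAC [_ - 1%:M]addrAC subrr add0r.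
have kL : k%:R^-1 *: (Lam_mx *+ k) = Lam_mx.
  by rewrite -[Lam_mx *+ k]scaler_nat scalerA mulVf ?scale1r // pnatr_eq0 -lt0n.
by rewrite sumrB sumr_const Bk scalerBr kL addrC.
Qed.

Lemma normM_v z a c : `|v z a ord0 * v z c ord0| <= b.
Proof.
have sq i : v z i ord0 ^+ 2 <= b.
  apply: le_trans (vb z); rewrite sqnE (bigD1 i) //= lerDl.
  by apply: sumr_ge0 => j _; exact: sqr_ge0.
have := sq a; have := sq c.
rewrite normrM -(real_normK (num_real (v z a ord0))) -(real_normK (num_real (v z c ord0))).
have := sqr_ge0 (`|v z a ord0| - `|v z c ord0|); rewrite sqrrB.
by set x := `|_|; set y := `|_|; lra.
Qed.

Lemma measurable_centered : measurable_mx centered.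
Proof.
apply: measurable_addmx; last exact: measurable_cstmx.
apply: measurable_mulmx => // i j; under eq_fun do rewrite mxE; exact: mv.
Qed.

Lemma centered_bdd z a c : `|centered z a c| <= b + 1.
Proof.
rewrite mxE vvT; apply: le_trans (ler_normD _ _) _.
apply: lerD; first exact: normM_v.
rewrite !mxE normrN normrMn; have /andP[L0 L1] := Lam01 a.
by rewrite ger0_norm //; case: (a == c); rewrite ?mulr1n // mulr0n.
Qed.

Lemma integr_vv a c : integr Q (fun z => v z a ord0 * v z c ord0).
Proof. by apply: integr_bdd => [|z]; [exact: measurable_funM|exact: normM_v]. Qed.

Lemma integr_centered a c : integr Q (fun z => centered z a c).
Proof. by apply: integr_bdd => [|z]; [exact: measurable_centered|exact: centered_bdd]. Qed.

Lemma Ex_centered a c : Ex Q (fun z => centered z a c) = 0.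
Proof.
rewrite -[RHS](subrr ((a == c)%:R * Lam a)) -{1}vLam.
rewrite -[X in _ = _ - X](Ex_cst Q) -ExB; [|exact: integr_vv|exact: integr_cst].
apply: eq_Ex => z; rewrite /centered mxE vvT !mxE.
by rewrite mulr_natl.
Qed.

Lemma Ex_dotv2 (x y : 'cV[R]_D) :
  integr Q (fun z => dotv (v z) x * dotv (v z) y) /\
  Ex Q (fun z => dotv (v z) x * dotv (v z) y) = dotv (Lam_mx *m x) y.
Proof.
have e z : dotv (v z) x * dotv (v z) y =
    \sum_a \sum_c (x a ord0 * y c ord0) * (v z a ord0 * v z c ord0).
  rewrite /dotv mulr_suml; apply: eq_bigr => a _.
  by rewrite mulr_sumr; apply: eq_bigr => c _; ring.
have i1 a c : integr Q (fun z => (x a ord0 * y c ord0) * (v z a ord0 * v z c ord0)).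
  by apply: integrZ; exact: integr_vv.
split.
  apply: (eq_integr (fun z => esym (e z))).
  by apply: integr_sum => a _; apply: integr_sum => c _.
rewrite (eq_Ex _ e) Ex_sum => [|a _]; last by apply: integr_sum => c _.
rewrite dotv_Lam; apply: eq_bigr => a _.
rewrite Ex_sum // (bigD1 a) //= big1 ?addr0 => [|c ca].
  by rewrite ExZ ?vLam ?eqxx ?mul1r; [ring|exact: integr_vv].
by rewrite ExZ ?vLam 1?eq_sym ?(negbTE ca) ?mul0r ?mulr0 //; exact: integr_vv.
Qed.

Lemma integr_sqn_centered (x : 'cV[R]_D) : integr Q (fun z => sqn (centered z *m x)).
Proof.
have -> : (fun z => sqn (centered z *m x)) = fun z =>
    \sum_a (\sum_c centered z a c * x c ord0) ^+ 2.
  by apply/funext => z; rewrite sqnE; apply: eq_bigr => a _; rewrite mxE.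
apply: integr_sum => a _.
apply: (@integr_bdd _ _ _ _ _ ((\sum_c (b + 1) * `|x c ord0|) ^+ 2)).
  apply: measurable_funX; apply: measurable_sum => c.
  by apply: measurable_funM; [exact: measurable_centered|exact: measurable_cst].
move=> z; rewrite normrX lerXn2r ?nnegrE ?normr_ge0 //.
  by apply: sumr_ge0 => c _; rewrite mulr_ge0 // addr_ge0.
apply: le_trans (ler_norm_sum _ _ _) _; apply: ler_sum => c _.
by rewrite normrM ler_wpM2r // centered_bdd.
Qed.

(** After expanding the square, |v|^2 <= b bounds the first term and the others contribute - |Lam
    x|^2, which is dropped. Keeping <Lam x, x> instead of |x|^2 is what later produces a trace in
    place of the dimension D. *)
Lemma Ex_sqn_centered (x : 'cV[R]_D) :
  Ex Q (fun z => sqn (centered z *m x)) <= b * dotv (Lam_mx *m x) x.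
Proof.
have [i1 e1] := Ex_dotv2 x x; have [i2 e2] := Ex_dotv2 x (Lam_mx *m x).
pose c := sqn (Lam_mx *m x).
have le z : sqn (centered z *m x) <=
    b * (dotv (v z) x * dotv (v z) x) - 2 * (dotv (v z) x * dotv (v z) (Lam_mx *m x)) + c.
  have -> : centered z *m x = dotv (v z) x *: v z - Lam_mx *m x.
    rewrite mulmxBl -mulmxA; congr (_ - _).
    apply/matrixP => i j; rewrite ord1 mxE big_ord1 [RHS]mxE mulrC; congr (_ * _).
    by rewrite -dotv_mx.
  rewrite /sqn !dotvE -/(sqn (v z)) -/(sqn (Lam_mx *m x)) -/c (dotvC (Lam_mx *m x)).
  have := vb z; have := sqr_ge0 (dotv (v z) x).
  by move: (sqn (v z)) (dotv (v z) x) (dotv (v z) _) => p q r; nra.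
apply: le_trans (_ : b * dotv (Lam_mx *m x) x - 2 * c + c <= _); last first.
  have := sqn_ge0 (Lam_mx *m x); rewrite -/c; lra.
rewrite -e1 /c /sqn -e2 -(ExZ b i1) -(ExZ 2 i2) -ExB; [|exact: integrZ|exact: integrZ].
have i3 := integrB (integrZ b i1) (integrZ 2 i2).
rewrite -[X in _ <= _ + X](Ex_cst Q) -ExD //; last exact: integr_cst.
rewrite e2; apply: Ex_le => [||z]; [exact: integr_sqn_centered| |exact: le].
by apply: integrD => //; exact: integr_cst.
Qed.

Section BlockStep.
Context (k : nat) (B : {set 'I_N}) (y : O -> 'cV[R]_D) (g : O -> R).
Hypotheses (Bk : #|B| = k) (k0 : (0 < k)%N).
Hypothesis my : forall t a, t \in B ->
  measurable_fun setT (fun w : g_sigma_algebraType (others Z S t) => y w a ord0).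
Hypothesis mg : forall t, t \in B ->
  measurable_fun setT (g : g_sigma_algebraType (others Z S t) -> R).
Hypotheses (y1 : forall w, sqn (y w) <= 1) (g01 : forall w, 0 <= g w <= 1).

Let y_le1 w a : `|y w a ord0| <= 1.
Proof.
rewrite -(@ler_pXn2r _ 2) ?nnegrE // expr1n real_normK ?num_real //.
apply: le_trans (y1 w); rewrite sqnE (bigD1 a) //= lerDl.
by apply: sumr_ge0 => j _; exact: sqr_ge0.
Qed.

Let g_le1 w : `|g w| <= 1.
Proof. by case/andP: (g01 w) => g0 g1; rewrite ger0_norm. Qed.

Let xi t w : 'cV[R]_D := centered (Z t w) *m y w.

Let xiE t w a : xi t w a ord0 = \sum_c centered (Z t w) a c * y w c ord0.
Proof. by rewrite mxE. Qed.

Let xi_bdd t w a : `|xi t w a ord0| <= D%:R * (b + 1).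
Proof.
rewrite xiE; apply: le_trans (ler_norm_sum _ _ _) _.
have -> : D%:R * (b + 1) = \sum_(c < D) (b + 1).
  by rewrite sumr_const card_ord mulr_natl.
apply: ler_sum => c _; rewrite normrM -[leRHS]mulr1.
by apply: ler_pM => //; exact: centered_bdd.
Qed.

Let measurable_others_y t a : t \in B -> measurable_fun setT (fun w => y w a ord0).
Proof. by move=> tB; apply: (measurable_others hZS) (my a tB). Qed.

Let bdd_others t (eta : O -> R) C : t \in B ->
  measurable_fun setT (eta : g_sigma_algebraType (others Z S t) -> R) ->
  (forall w, `|eta w| <= C) -> integr P eta.
Proof.
by move=> tB m h; apply: integr_bdd h; exact: (measurable_others hZS) m.
Qed.

(** Entry by entry, the centered matrix at point t has mean 0 and is independent of the weight, of y
    and of point t'. *)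
Let cross t t' : t \in B -> t' \in B -> t != t' ->
  integr P (fun w => g w * dotv (xi t w) (xi t' w)) /\
  Ex P (fun w => g w * dotv (xi t w) (xi t' w)) = 0.
Proof.
move=> tB t'B tt'.
have e w : g w * dotv (xi t w) (xi t' w) = \sum_a \sum_c
    centered (Z t w) a c * (g w * y w c ord0 * xi t' w a ord0).
  rewrite /dotv mulr_sumr; apply: eq_bigr => a _; rewrite xiE mulr_suml mulr_sumr.
  by apply: eq_bigr => c _; ring.
have ind a c := @sampling_indep _ _ _ _ _ _ _ _ _ _ hZS t (fun z => centered z a c)
  (fun w => g w * y w c ord0 * xi t' w a ord0) (integr_centered a c).
have meta a c : measurable_fun setT
   (fun w : g_sigma_algebraType (others Z S t) => g w * y w c ord0 * xi t' w a ord0).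
  apply: measurable_funM; first by apply: measurable_funM; [exact: mg|exact: my].
  under eq_fun do rewrite xiE; apply: measurable_sum => c'.
  apply: measurable_funM; last exact: my.
  have t't : t' != t by rewrite eq_sym.
  have mZ : measurable_fun setT (Z t' : g_sigma_algebraType (others Z S t) -> T).
    exact: others_Z.
  exact: measurableT_comp (measurable_centered a c') mZ.
have ieta a c : integr P (fun w => g w * y w c ord0 * xi t' w a ord0).
  apply: (@bdd_others t _ (D%:R * (b + 1))) => // w.
  rewrite normrM -[leRHS]mul1r; apply: ler_pM => //.
  by rewrite normrM -[leRHS]mulr1; apply: ler_pM.
split.
  apply: (eq_integr (fun w => esym (e w))); apply: integr_sum => a _.
  by apply: integr_sum => c _; case: (ind a c (meta a c) (ieta a c)).
rewrite (eq_Ex _ e) Ex_sum => [|a _]; last first.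
  by apply: integr_sum => c _; case: (ind a c (meta a c) (ieta a c)).
rewrite big1 // => a _; rewrite Ex_sum => [|c _]; last first.
  by case: (ind a c (meta a c) (ieta a c)).
rewrite big1 // => c _; case: (ind a c (meta a c) (ieta a c)) => _ ->.
by rewrite Ex_centered mul0r.
Qed.

Let integr_gLam : (exists t, t \in B) -> integr P (fun w => g w * dotv (Lam_mx *m y w) (y w)).
Proof.
move=> [t tB]; apply: (@integr_bdd _ _ _ _ _ (\sum_(a < D) 1)).
  apply: measurable_funM; first exact: (measurable_others hZS) (mg tB).
  under eq_fun do rewrite dotv_Lam; apply: measurable_sum => a.
  apply: measurable_funM; last exact: (measurable_others_y a tB).
  by apply: measurable_funM; [exact: measurable_cst|exact: (measurable_others_y a tB)].
move=> w; rewrite normrM -[leRHS]mul1r; apply: ler_pM => //.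
rewrite dotv_Lam; apply: le_trans (ler_norm_sum _ _ _) _; apply: ler_sum => a _.
have /andP[L0 L1] := Lam01 a.
rewrite !normrM -[leRHS]mulr1; apply: ler_pM; rewrite ?mulr_ge0 //.
by rewrite -[leRHS]mulr1; apply: ler_pM; rewrite // ger0_norm.
Qed.

(** The square is expanded into entries so that each summand is a function of [Z t] times a
    statistic of the rest. Once the former is replaced by its mean, the sum is reassembled with
    [y w] as a fixed vector, to which [Ex_sqn_centered] applies. *)
Let diag t : t \in B ->
  integr P (fun w => g w * sqn (xi t w)) /\
  Ex P (fun w => g w * sqn (xi t w)) <= b * Ex P (fun w => g w * dotv (Lam_mx *m y w) (y w)).
Proof.
move=> tB.
pose h c c' z := \sum_a centered z a c * centered z a c'.
have ih c c' : integr Q (h c c').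
  apply: integr_sum => a _; apply: (@integr_bdd _ _ _ _ _ ((b + 1) * (b + 1))).
    by apply: measurable_funM; exact: measurable_centered.
  by move=> z; rewrite normrM; apply: ler_pM => //; exact: centered_bdd.
have sqE z (x : 'cV[R]_D) : sqn (centered z *m x) =
    \sum_c \sum_c' h c c' z * (x c ord0 * x c' ord0).
  rewrite sqnE; under eq_bigr do rewrite mxE expr2 mulr_suml.
  rewrite exchange_big; apply: eq_bigr => c _ /=.
  under eq_bigr do rewrite mulr_sumr.
  rewrite exchange_big; apply: eq_bigr => c' _ /=.
  by rewrite /h mulr_suml; apply: eq_bigr => a _; ring.
have e w : g w * sqn (xi t w) = \sum_c \sum_c'
    h c c' (Z t w) * (g w * y w c ord0 * y w c' ord0).
  rewrite sqE mulr_sumr; apply: eq_bigr => c _; rewrite mulr_sumr.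
  by apply: eq_bigr => c' _; ring.
have meta c c' : measurable_fun setT
   (fun w : g_sigma_algebraType (others Z S t) => g w * y w c ord0 * y w c' ord0).
  apply: measurable_funM; last exact: my.
  by apply: measurable_funM; [exact: mg|exact: my].
have ieta c c' : integr P (fun w => g w * y w c ord0 * y w c' ord0).
  apply: (@bdd_others t _ 1) => // w.
  rewrite normrM -[leRHS]mul1r; apply: ler_pM => //.
  by rewrite normrM -[leRHS]mulr1; apply: ler_pM.
have ind c c' := sampling_indep hZS (ih c c') (meta c c') (ieta c c').
split.
  apply: (eq_integr (fun w => esym (e w))); apply: integr_sum => c _.
  by apply: integr_sum => c' _; case: (ind c c').
rewrite (eq_Ex _ e) Ex_sum => [|c _]; last by apply: integr_sum => c' _; case: (ind c c').
under eq_bigr => c _.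
  rewrite Ex_sum => [|c' _]; last by case: (ind c c').
  under eq_bigr => c' _ do rewrite (ind c c').2 -ExZ //.
  rewrite -Ex_sum => [|c' _]; last exact: integrZ.
  over.
rewrite -Ex_sum => [|c _]; last by apply: integr_sum => c' _; exact: integrZ.
have igL : integr P (fun w => g w * dotv (Lam_mx *m y w) (y w)).
  by apply: integr_gLam; exists t.
rewrite -ExZ //; apply: Ex_le => [||w].
- by apply: integr_sum => c _; apply: integr_sum => c' _; exact: integrZ.
- exact: integrZ.
have := Ex_sqn_centered (y w); rewrite (eq_Ex _ (fun z => sqE z (y w))).
have iy c c' : integr Q (fun z => h c c' z * (y w c ord0 * y w c' ord0)).
  by apply: (eq_integr (fun z => mulrC _ _)); exact: integrZ.
rewrite Ex_sum => [|c _]; last by apply: integr_sum => c' _.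
have /andP[g0 _] := g01 w => /(ler_wpM2l g0).
rewrite [X in _ <= X -> _]mulrCA; apply: le_trans; rewrite le_eqVlt; apply/orP; left.
apply/eqP; rewrite mulr_sumr; apply: eq_bigr => c _.
rewrite Ex_sum // mulr_sumr; apply: eq_bigr => c' _.
have -> : Ex Q (fun z => h c c' z * (y w c ord0 * y w c' ord0)) =
    (y w c ord0 * y w c' ord0) * Ex Q (h c c').
  by rewrite -ExZ //; apply: eq_Ex => z; rewrite mulrC.
by ring.
Qed.

(** Of the k^2 products only the k diagonal ones survive, whence b / k. The weight g will be the
    indicator of one value of S: the blocks are cut from the random subsample, and fixing its value
    makes them deterministic. *)
Lemma block_step : (0 < k)%N ->
  integr P (fun w => g w * sqn ((block_form k B (Z^~ w) - 1%:M) *m y w)) /\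
  Ex P (fun w => g w * sqn ((block_form k B (Z^~ w) - 1%:M) *m y w)) <=
  b / k%:R * Ex P (fun w => g w * dotv (Lam_mx *m y w) (y w)).
Proof.
move=> _.
have e w : g w * sqn ((block_form k B (Z^~ w) - 1%:M) *m y w) =
    k%:R ^- 2 * \sum_(t in B) \sum_(t' in B) g w * dotv (xi t w) (xi t' w).
  rewrite block_form_sub1 // -scalemxAl /sqn dotvZl dotvZr mulmx_suml -exprVn expr2.
  have lin (F : 'I_N -> 'cV[R]_D) z : dotv (\sum_(t in B) F t) z = \sum_(t in B) dotv (F t) z.
    elim/big_ind2 : _ => [|x1 x2 z1 z2 <- <-|//]; last by rewrite dotvDl.
    by rewrite /dotv big1 // => i _; rewrite mxE mul0r.
  suff <- : g w * dotv (\sum_(t in B) xi t w) (\sum_(t in B) xi t w) =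
      \sum_(t in B) \sum_(t' in B) g w * dotv (xi t w) (xi t' w).
    by rewrite /xi; ring.
  rewrite lin mulr_sumr; apply: eq_bigr => t _.
  by rewrite dotvC lin mulr_sumr; apply: eq_bigr => t' _; rewrite dotvC.
have int t t' : t \in B -> t' \in B -> integr P (fun w => g w * dotv (xi t w) (xi t' w)).
  move=> tB t'B; have [<-|tt'] := eqVneq t t'; first by case: (diag tB).
  by case: (cross tB t'B tt').
have int2 : integr P (fun w => \sum_(t in B) \sum_(t' in B) g w * dotv (xi t w) (xi t' w)).
  by apply: integr_sum => t tB; apply: integr_sum => t' t'B; exact: int.
split; first by apply: (eq_integr (fun w => esym (e w))); exact: integrZ.
rewrite (eq_Ex _ e) ExZ // Ex_sum => [|t tB]; last by apply: integr_sum => t' t'B; exact: int.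
have kR : 0 < k%:R :> R by rewrite ltr0n.
set E := Ex P (fun w => g w * dotv (Lam_mx *m y w) (y w)).
apply: le_trans (_ : k%:R ^- 2 * \sum_(t in B) (b * E) <= _).
  rewrite ler_wpM2l ?invr_ge0 ?exprn_ge0 ?ler0n //; apply: ler_sum => t tB.
  rewrite Ex_sum => [|t' t'B]; last exact: int.
  rewrite (bigD1 t) //= big1 ?addr0 => [|t' /andP[t'B t't]]; last first.
    by case: (cross tB t'B _) => //; rewrite eq_sym.
  by case: (diag tB).
rewrite sumr_const Bk -[_ *+ k]mulr_natl le_eqVlt; apply/orP; left; apply/eqP.
by field; rewrite gt_eqF.
Qed.

End BlockStep.
End LowerTail.

Section BlockProducts.
Context (R : realType) dO dT (O : measurableType dO) (T : measurableType dT).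
Context (P : probability O R) (Q : probability T R).
Context (N : nat) (Z : 'I_N -> O -> T) (S : O -> {set 'I_N}).
Hypothesis hZS : sampling P Q Z S.
Context (D : nat) (v : T -> 'cV[R]_D) (Lam : 'I_D -> R) (b : R).
Hypotheses (mv : measurable_mx v) (vb : forall z, sqn (v z) <= b).
Hypothesis Lam01 : forall a, 0 <= Lam a <= 1.
Hypothesis vLam : forall a c,
  Ex Q (fun z => v z a ord0 * v z c ord0) = (a == c)%:R * Lam a.

Definition block_prod k (bs : seq {set 'I_N}) (zs : 'I_N -> T) : 'M[R]_D :=
  cayley_prod [seq block_form v Lam k B zs | B <- bs].

Lemma measurable_sum_cond d' (X : measurableType d') (I : Type) (s : seq I)
    (p : pred I) (h : I -> X -> R) :
  (forall i, p i -> measurable_fun setT (h i)) ->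
  measurable_fun setT (fun x => \sum_(i <- s | p i) h i x).
Proof.
move=> mh; under eq_fun do rewrite big_mkcond.
apply: measurable_sum => i; case pi: (p i); first exact: mh.
exact: measurable_cst.
Qed.

Lemma measurable_block_prod d' (X : measurableType d') k bs (zs : 'I_N -> X -> T) :
  (forall t, has (fun B : {set 'I_N} => t \in B) bs -> measurable_fun setT (zs t)) ->
  measurable_mx (fun w => block_prod k bs (zs^~ w)).
Proof.
elim: bs => [|B bs IH] mz; first exact: measurable_cstmx.
have mB : measurable_mx (fun w => block_form v Lam k B (zs^~ w)).
  move=> i j; have -> : (fun w => block_form v Lam k B (zs^~ w) i j) = (fun w =>
      (1%:M - Lam_mx Lam) i j + k%:R^-1 * \sum_(t in B) (v (zs t w) *m (v (zs t w))^T) i j).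
    by apply/funext => w; rewrite /block_form mxE; congr (_ + _); rewrite mxE summxE.
  apply: measurable_funD; first exact: measurable_cst.
  apply: measurable_funM; first exact: measurable_cst.
  apply: measurable_sum_cond => t tB; under eq_fun do rewrite vvT.
  have mt : measurable_fun setT (zs t) by apply: mz; rewrite /= tB.
  by apply: measurable_funM; apply: (measurableT_comp (mv _ _) mt).
apply: measurable_mulmx; last by apply: IH => t h; apply: mz; rewrite /= h orbT.
apply: measurable_mulmx; last by apply: measurable_addmx => //; exact: measurable_cstmx.
apply: measurable_invmx.
  by move=> w; apply: psd_add1_unit => z; exact: block_form_psd.
by apply: measurable_addmx => //; exact: measurable_cstmx.
Qed.

Lemma block_prod_contract k bs zs (y : 'cV[R]_D) : sqn (block_prod k bs zs *m y) <= sqn y.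
Proof.
by apply: cayley_prod_contract => _ /mapP[B _ ->] z; exact: block_form_psd.
Qed.

Lemma sqn_delta (i : 'I_D) : sqn (delta_mx i ord0 : 'cV[R]_D) = 1.
Proof.
rewrite sqnE (bigD1 i) //= mxE !eqxx expr1n big1 ?addr0 // => j /negbTE ji.
by rewrite mxE ji expr0n.
Qed.

Lemma measurable_sqn d' (X : measurableType d') n (y : X -> 'cV[R]_n) :
  measurable_mx y -> measurable_fun setT (fun w => sqn (y w)).
Proof.
move=> my; under eq_fun do rewrite sqnE.
by apply: measurable_sum => i; apply: measurable_funX; exact: my.
Qed.

(** Peeling off the outermost block costs a factor b / k, since the rest of the product depends on
    the other blocks only. Every step but the innermost bounds <Lam y, y> by |y|^2; the innermost
    acts on a basis vector and keeps <Lam e_i, e_i> = Lam_i. *)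
Lemma block_prod_col (s : {set 'I_N}) k (bs : seq {set 'I_N}) i : (0 < k)%N -> (0 < size bs)%N ->
  all (fun B : {set 'I_N} => #|B| == k) bs ->
  pairwise (fun A B : {set 'I_N} => disjoint (mem A) (mem B)) bs ->
  Ex P (fun w => indS R S s w * sqn (col i (block_prod k bs (Z^~ w)))) <=
    (b / k%:R) ^+ size bs * Lam i * Ex P (indS R S s).
Proof.
move=> k0.
have b0 : 0 <= b by exact: le_trans (sqn_ge0 (v point)) (vb point).
have bk0 : 0 <= b / k%:R by rewrite divr_ge0.
have g01 w : 0 <= indS R S s w <= 1 by rewrite /indS; case: eqP; rewrite lexx ler01.
have mg : measurable_fun setT (indS R S s).
  rewrite (_ : indS R S s = \1_(S @^-1` [set s])).
    by apply: measurable_indic; exact: (sampling_S hZS).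
  apply/funext => w; rewrite /indS indicE; congr (nat_of_bool _)%:R.
  by apply/idP/idP => [/eqP h|]; [rewrite inE|rewrite inE => /eqP].
elim: bs => [//|B bs IH] _ /= /andP[/eqP Bk allk'] /andP[disj pw].
pose y w : 'cV[R]_D := col i (block_prod k bs (Z^~ w)).
have yE w : y w = block_prod k bs (Z^~ w) *m delta_mx i ord0 by rewrite /y colE.
have y1 w : sqn (y w) <= 1.
  by rewrite yE; apply: le_trans (block_prod_contract _ _ _ _) _; rewrite sqn_delta.
have my t a : t \in B ->
  measurable_fun setT (fun w : g_sigma_algebraType (others Z S t) => y w a ord0).
  move=> tB; under eq_fun do rewrite mxE.
  apply: (@measurable_block_prod _ (g_sigma_algebraType (others Z S t)) k bs
    (fun t' w => Z t' w)) => t' /hasP[B' B'bs t'B'].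
  apply: others_Z; apply: contraTneq t'B' => ->.
  have /allP/(_ _ B'bs) := disj; rewrite disjoint_subset => /fintype.subsetP/(_ _ tB).
  by rewrite inE.
have mg' t : t \in B ->
    measurable_fun setT (indS R S s : g_sigma_algebraType (others Z S t) -> R).
  by move=> _; exact: others_indS.
have [i1 le1] := block_step hZS mv vb Lam01 vLam Bk k0 my mg' y1 g01 k0.
have mB : measurable_mx y.
  move=> a c; rewrite ord1; under eq_fun do rewrite mxE.
  by apply: measurable_block_prod => t _; exact: (sampling_Z hZS).
have mcol : measurable_mx (fun w => col i (block_prod k (B :: bs) (Z^~ w))).
  move=> a c; rewrite ord1; under eq_fun do rewrite mxE.
  by apply: measurable_block_prod => t _; exact: (sampling_Z hZS).
have bdd (f : O -> 'cV[R]_D) : measurable_mx f -> (forall w, sqn (f w) <= 1) ->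
    integr P (fun w => indS R S s w * sqn (f w)).
  move=> mf f1; apply: (@integr_bdd _ _ _ _ _ 1).
    by apply: measurable_funM => //; exact: measurable_sqn.
  move=> w; have /andP[g0 g1] := g01 w.
  rewrite ger0_norm ?mulr_ge0 ?sqn_ge0 // -[leRHS]mulr1.
  by apply: ler_pM => //; exact: sqn_ge0.
apply: (@le_trans _ _ (b / k%:R * Ex P (fun w => indS R S s w *
    dotv (Lam_mx Lam *m y w) (y w)))).
  apply: le_trans le1; apply: Ex_le => // [|w].
    apply: bdd => // w; rewrite colE.
    by apply: le_trans (block_prod_contract _ _ _ _) _; rewrite sqn_delta.
  have /andP[g0 _] := g01 w; rewrite ler_wpM2l //.
  rewrite (_ : col i _ = cayley (block_form v Lam k B (Z^~ w)) *m y w).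
    by apply: cayley_le => z; exact: block_form_psd.
  by rewrite yE colE mulmxA.
have [bs0|bs_pos] := posnP (size bs).
  have -> : bs = [::] by apply: size0nil.
  rewrite expr1 -[leRHS]mulrA ler_wpM2l // le_eqVlt; apply/orP; left; apply/eqP.
  rewrite -ExZ; last by apply: integr_bdd mg _ => w;
    have /andP[g0 g1] := g01 w; rewrite ger0_norm //; exact: g1.
  apply: eq_Ex => w; rewrite [RHS]mulrC; congr (_ * _).
  rewrite yE (size0nil bs0) mul1mx dotv_Lam (bigD1 i) //= big1 => [|a /negbTE ai].
    by rewrite mxE !eqxx !mulr1 addr0.
  by rewrite mxE ai /= !mulr0.
rewrite exprS -!(mulrA (b / k%:R)) ler_wpM2l //.
apply: le_trans (IH bs_pos allk' pw).
apply: Ex_le => [||w].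
- apply: (@integr_bdd _ _ _ _ _ 1).
    apply: measurable_funM => //; under eq_fun do rewrite dotv_Lam.
    apply: measurable_sum => a; apply: measurable_funM => //.
    by apply: measurable_funM => //; exact: measurable_cst.
  move=> w; have /andP[g0 g1] := g01 w.
  have L0 : 0 <= dotv (Lam_mx Lam *m y w) (y w).
    rewrite dotv_Lam; apply: sumr_ge0 => a _; rewrite -mulrA -expr2 mulr_ge0 ?sqr_ge0 //.
    by case/andP: (Lam01 a).
  rewrite ger0_norm ?mulr_ge0 // -[leRHS]mulr1; apply: ler_pM => //.
  apply: le_trans (y1 w); rewrite dotv_Lam sqnE; apply: ler_sum => a _.
  rewrite -mulrA -expr2 -[leRHS]mul1r ler_wpM2r ?sqr_ge0 //.
  by case/andP: (Lam01 a).
- exact: bdd.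
have /andP[g0 _] := g01 w; rewrite ler_wpM2l // dotv_Lam sqnE; apply: ler_sum => a _.
rewrite -mulrA -expr2 -[leRHS]mul1r ler_wpM2r ?sqr_ge0 //.
by case/andP: (Lam01 a).
Qed.

Lemma disjoint_blocks k q (s : {set 'I_N}) : (q * k <= #|s|)%N ->
  exists bs : seq {set 'I_N}, [/\ size bs = q, all (fun B : {set 'I_N} => #|B| == k) bs,
    pairwise (fun A B : {set 'I_N} => disjoint (mem A) (mem B)) bs
    & all (fun B : {set 'I_N} => B \subset s) bs].
Proof.
elim: q s => [|q IH] s; first by exists [::].
rewrite mulSn => qk.
pose B := [set x in take k (enum s)].
have Bs : B \subset s.
  by apply/fintype.subsetP => x; rewrite inE => /mem_take; rewrite mem_enum.
have Bk : #|B| = k.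
  rewrite cardsE (card_uniqP _) ?take_uniq ?enum_uniq // size_take -cardE.
  by case: ltngtP qk => // h; rewrite leqNgt (leq_trans h) ?leq_addr.
have [|bs [sz ak pw sub]] := IH (s :\: B).
  by rewrite cardsD (finset.setIidPr Bs) Bk leq_subRL // (leq_trans _ qk) ?leq_addr.
exists (B :: bs); split=> /=; rewrite ?sz ?Bk ?eqxx ?Bs //=.
  rewrite pw andbT; apply/allP => B' /(allP sub)/fintype.subsetP B's.
  rewrite disjoint_sym disjoint_subset; apply/fintype.subsetP => x /B's.
  by rewrite !inE => /andP[].
by apply/allP => B' /(allP sub) /fintype.subset_trans; apply; exact: finset.subsetDl.
Qed.

Lemma measurable_boolR d' (X : measurableType d') (f : X -> bool) :
  measurable_fun setT f -> measurable_fun setT (fun x => (f x)%:R : R).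
Proof.
move=> mf; rewrite (_ : (fun x => _) = fun x => if f x then 1 else 0 : R).
  by apply: measurable_fun_ifT => //; exact: measurable_cst.
by apply/funext => x; case: (f x).
Qed.

Definition bad_blocks k (bs : seq {set 'I_N}) (zs : 'I_N -> T) : R :=
  ((4^-1 < frob (block_prod k bs zs))%R : bool)%:R.

Lemma measurable_bad_blocks d' (X : measurableType d') k bs (zs : 'I_N -> X -> T) :
  (forall t, has (fun B : {set 'I_N} => t \in B) bs -> measurable_fun setT (zs t)) ->
  measurable_fun setT (fun w => bad_blocks k bs (zs^~ w)).
Proof.
move=> mz; apply: measurable_boolR; apply: measurable_fun_ltr; first exact: measurable_cst.
apply: measurable_sum => i; apply: measurable_sqn => a c; rewrite ord1.
under eq_fun do rewrite mxE; exact: measurable_block_prod.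
Qed.

Lemma measurable_indS s : measurable_fun setT (indS R S s).
Proof.
rewrite (_ : indS R S s = \1_(S @^-1` [set s])).
  by apply: measurable_indic; exact: (sampling_S hZS).
apply/funext => w; rewrite /indS indicE; congr (nat_of_bool _)%:R.
by apply/idP/idP => [/eqP h|]; [rewrite inE|rewrite inE => /eqP].
Qed.

Lemma indS_ge0 (s : {set 'I_N}) w : 0 <= indS R S s w.
Proof. by rewrite /indS ler0n. Qed.

Lemma indS_le1 (s : {set 'I_N}) w : indS R S s w <= 1.
Proof. by rewrite /indS; case: eqP. Qed.

(** Markov's inequality at the threshold 1/4 of [cayley_prod_lower]; summing the columns gives the
    trace of Lam. *)
Lemma bad_blocks_le (s : {set 'I_N}) k (bs : seq {set 'I_N}) :
  (0 < k)%N -> (0 < size bs)%N ->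
  all (fun B : {set 'I_N} => #|B| == k) bs ->
  pairwise (fun A B : {set 'I_N} => disjoint (mem A) (mem B)) bs ->
  Ex P (fun w => indS R S s w * bad_blocks k bs (Z^~ w)) <=
    4 * ((b / k%:R) ^+ size bs * \sum_i Lam i) * Ex P (indS R S s).
Proof.
move=> k0 bs0 allk pw.
have icol i : integr P (fun w => indS R S s w * sqn (col i (block_prod k bs (Z^~ w)))).
  apply: (@integr_bdd _ _ _ _ _ 1).
    apply: measurable_funM; first exact: measurable_indS.
    apply: measurable_sqn => a c; rewrite ord1; under eq_fun do rewrite mxE.
    by apply: measurable_block_prod => t _; exact: (sampling_Z hZS).
  move=> w; rewrite ger0_norm ?mulr_ge0 ?sqn_ge0 ?indS_ge0 // -[leRHS]mulr1.
  apply: ler_pM; rewrite ?sqn_ge0 ?indS_ge0 ?indS_le1 //.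
  by rewrite colE; apply: le_trans (block_prod_contract _ _ _ _) _; rewrite sqn_delta.
apply: (@le_trans _ _ (Ex P (fun w => 4 * \sum_i
    indS R S s w * sqn (col i (block_prod k bs (Z^~ w)))))).
  apply: Ex_le => [||w].
  - apply: (@integr_bdd _ _ _ _ _ 1).
      apply: measurable_funM; first exact: measurable_indS.
      by apply: measurable_bad_blocks => t _; exact: (sampling_Z hZS).
    move=> w; rewrite ger0_norm ?mulr_ge0 ?indS_ge0 ?ler0n // -[leRHS]mulr1.
    by apply: ler_pM; rewrite ?indS_ge0 ?indS_le1 ?ler0n // lern1 leq_b1.
  - by apply: integrZ; apply: integr_sum => i _; exact: icol.
  rewrite -mulr_sumr -/(frob _) mulrCA ler_wpM2l ?indS_ge0 //.
  rewrite /bad_blocks; case: ltP => h /=; first by lra.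
  by rewrite mulr_ge0 //; apply: sumr_ge0 => i _; exact: sqn_ge0.
rewrite ExZ; last by apply: integr_sum => i _; exact: icol.
rewrite -mulrA ler_wpM2l // Ex_sum => [|i _]; last exact: icol.
rewrite mulr_sumr mulr_suml; apply: ler_sum => i _.
exact: block_prod_col.
Qed.

End BlockProducts.

(** * The local learning problem *)

Section LocalModel.
Context (R : realType) d (X : measurableType d).
Context (Q : probability (X * measurableTypeR R)%type R).
Context (H : ip_space (X -> R^o)) (k : X -> X -> R) (e : nat -> X -> R^o).
Local Notation vec := (vectors H).
Local Notation "\< u , v \>" := (dot H u v) (at level 0, u, v at level 99).

(** Squared norm in L^2 of the input distribution, written through the law Q of input and label
    because the noise lives there. *)
Definition nu2 (g : X -> R) : R := Ex Q (fun z => g z.1 ^+ 2).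

Definition mu i : R := nu2 (e i).

(** [lm_cov] states in weak form that the frame diagonalizes the covariance operator. It holds at
    zero vectors of the frame too, where both sides vanish. *)
Record local_model (kap : R) : Prop := LocalModel {
  lm_ip : is_inner_product H ;
  lm_complete : is_complete H ;
  lm_frame : frame H e ;
  lm_kvec : forall x, vec (k x) ;
  lm_repr : forall g x, vec g -> g x = \<g, k x\> ;
  lm_kbd : forall x, k x x <= kap ;
  lm_kmeas : measurable_fun setT (fun p : X * X => k p.1 p.2) ;
  lm_meas : forall g, vec g -> measurable_fun setT (g : X -> R) ;
  lm_cov : forall i g, vec g -> Ex Q (fun z => e i z.1 * g z.1) = mu i * \<e i, g\> }.

Context (kap : R).
Hypothesis lm : local_model kap.

Let ipH := lm_ip lm.
Let cH := lm_complete lm.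
Let fr := lm_frame lm.
Let kvec := lm_kvec lm.
Let evec i : vec (e i) := frame_vec fr i.
Hint Resolve kvec evec : core.

Lemma kE x y : k x y = \<k x, k y\>.
Proof. by rewrite -(lm_repr lm y (kvec x)). Qed.

Lemma kxx_ge0 x : 0 <= k x x.
Proof. by rewrite kE; exact: dot_ge0. Qed.

Lemma kap_ge0 : 0 <= kap.
Proof. exact: le_trans (kxx_ge0 point) (lm_kbd lm point). Qed.

Lemma sqr_eval_le g x : vec g -> g x ^+ 2 <= kap * \<g, g\>.
Proof.
move=> hg; rewrite (lm_repr lm) //; apply: le_trans (dot_cs ipH hg (kvec x)) _.
by rewrite mulrC ler_wpM2r ?(dot_ge0 ipH) // -kE (lm_kbd lm).
Qed.

Lemma measurable_vec g : vec g ->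
  measurable_fun setT (fun z : X * measurableTypeR R => g z.1 : R).
Proof.
by move=> hg; exact: measurableT_comp (lm_meas lm hg) measurable_fst.
Qed.

Lemma integr_vecM g g' : vec g -> vec g' -> integr Q (fun z => g z.1 * g' z.1).
Proof.
move=> hg hg'; apply: (@integr_bdd _ _ _ _ _ (kap * \<g, g\> + kap * \<g', g'\>)).
  by apply: measurable_funM; exact: measurable_vec.
move=> z; have := sqr_eval_le z.1 hg; have := sqr_eval_le z.1 hg'.
rewrite normrM -(real_normK (num_real (g z.1))) -(real_normK (num_real (g' z.1))).
have := normr_ge0 (g z.1); have := normr_ge0 (g' z.1).
by move: `|g z.1| `|g' z.1| => p q; nra.
Qed.

Lemma integr_vec2 g : vec g -> integr Q (fun z => g z.1 ^+ 2).
Proof. by move=> hg; apply: eq_integr (integr_vecM hg hg) => z; rewrite expr2. Qed.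

Lemma nu2_ge0 g : 0 <= nu2 g.
Proof. by apply: Ex_ge0 => z; exact: sqr_ge0. Qed.

Lemma mu_ge0 i : 0 <= mu i. Proof. exact: nu2_ge0. Qed.

Lemma nu2_le g : vec g -> nu2 g <= kap * \<g, g\>.
Proof.
move=> hg; rewrite -(Ex_cst Q (kap * _)); apply: Ex_le => [||z].
- exact: integr_vec2.
- exact: integr_cst.
- exact: sqr_eval_le.
Qed.

Lemma mu_le i : mu i <= kap.
Proof.
apply: le_trans (nu2_le (evec i)) _; case: fr => _ _ /(_ i)[->|->] _.
  by rewrite (dot0l ipH) ?mulr0 ?kap_ge0 //; exact: vec0.
by rewrite mulr1.
Qed.

Lemma nu2D g g' : vec g -> vec g' ->
  nu2 (g + g') = nu2 g + 2 * Ex Q (fun z => g z.1 * g' z.1) + nu2 g'.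
Proof.
move=> hg hg'; have i1 := integr_vec2 hg; have i2 := integr_vec2 hg'.
have i3 := integr_vecM hg hg'; have i4 := integrZ 2 i3.
rewrite /nu2 -ExZ // -ExD // -ExD //; last exact: integrD.
by apply: eq_Ex => z; rewrite fctE; ring.
Qed.

Lemma nu2D_le g g' : vec g -> vec g' -> nu2 (g + g') <= 2 * nu2 g + 2 * nu2 g'.
Proof.
move=> hg hg'; have i1 := integr_vec2 hg; have i2 := integr_vec2 hg'.
rewrite /nu2 -!ExZ // -ExD; [|exact: integrZ|exact: integrZ].
apply: Ex_le => [||z].
- by apply: integr_vec2; exact: vecD.
- by apply: integrD; exact: integrZ.
- by rewrite fctE; have := sqr_ge0 (g z.1 - g' z.1); nra.
Qed.

(** Squared norm of the part of the kernel section at x beyond the first D coordinates, see [tauE].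
    All truncation errors are expressed through it. *)
Definition tau D x : R := k x x - \sum_(i < D) e i x ^+ 2.

Definition coef (g : X -> R^o) i : R := \<g, e i\>.

Definition tail D (g : X -> R^o) : X -> R^o := g - synth e (coef g) D.

Lemma vec_synthM a n : vec (synth e a n).
Proof. exact: vec_synth. Qed.
Hint Resolve vec_synthM : core.

Lemma vec_tail D g : vec g -> vec (tail D g).
Proof. by move=> hg; apply: vecB. Qed.

Lemma synthE a n x : synth e a n x = \sum_(i < n) a i * e i x.
Proof.
rewrite /synth; elim: n => [|n IH]; first by rewrite !big_ord0.
by rewrite !big_ord_recr /= -IH fctE.
Qed.

Lemma tail_decomp D g : g = synth e (coef g) D + tail D g.
Proof. by rewrite /tail addrC subrK. Qed.

Lemma dot_tail D g : vec g ->
  \<tail D g, tail D g\> = \<g, g\> - \sum_(i < D) coef g i ^+ 2.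
Proof. by move=> hg; rewrite /tail (bessel_eq ipH fr) // big_mkord. Qed.

Lemma dot_tail_le D g : vec g -> \<tail D g, tail D g\> <= \<g, g\>.
Proof.
move=> hg; rewrite dot_tail // gerBl; apply: sumr_ge0 => i _; exact: sqr_ge0.
Qed.

Lemma coef_tail D g i : vec g -> (i < D)%N -> coef (tail D g) i = 0.
Proof.
move=> hg iD; rewrite /coef /tail dotBl // (dot_synth_frame ipH fr) iD.
by rewrite (frame_idem ipH fr) // subrr.
Qed.

Lemma tauE D x : tau D x = \<tail D (k x), tail D (k x)\>.
Proof.
rewrite dot_tail // -kE /tau; congr (_ - _); apply: eq_bigr => i _.
by rewrite (lm_repr lm) // /coef dotC.
Qed.

Lemma tau_ge0 D x : 0 <= tau D x.
Proof. by rewrite tauE; apply: dot_ge0 => //; exact: vec_tail. Qed.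

Lemma tau_le D x : tau D x <= kap.
Proof. by rewrite tauE; apply: le_trans (dot_tail_le _ _) _; rewrite // -kE (lm_kbd lm). Qed.

Lemma sum_e2_le D x : \sum_(i < D) e i x ^+ 2 <= kap.
Proof. by apply: le_trans (lm_kbd lm x); rewrite -subr_ge0; exact: tau_ge0. Qed.

Lemma measurable_kdiag : measurable_fun setT (fun x => k x x).
Proof.
have m : measurable_fun setT (fun x : X => (x, x)) by apply: measurable_fun_pair.
exact: measurableT_comp (lm_kmeas lm) m.
Qed.

Lemma measurable_tau D : measurable_fun setT (tau D).
Proof.
apply: measurable_funB; first exact: measurable_kdiag.
by apply: measurable_sum => i; apply: measurable_funX; exact: (lm_meas lm).
Qed.

Lemma integr_tau D : integr Q (fun z => tau D z.1).
Proof.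
apply: (@integr_bdd _ _ _ _ _ kap) => [|z].
  exact: measurableT_comp (measurable_tau D) measurable_fst.
by rewrite ger0_norm ?tau_ge0 // tau_le.
Qed.

(** The tail of g pairs only with the tail of the kernel section, so [tau] replaces [k x x] in the
    reproducing bound. *)
Lemma sqr_tail_le D g x : vec g -> tail D g x ^+ 2 <= tau D x * \<tail D g, tail D g\>.
Proof.
move=> hg; have ht := vec_tail D hg; have hk := vec_tail D (kvec x).
rewrite tauE mulrC; apply: le_trans (dot_cs ipH ht hk).
rewrite (lm_repr lm) // {2}/tail dotBr // (dotC ipH ht (vec_synthM _ _)).
rewrite (dot_synthl ipH fr) // big1 ?subr0 // => i _.
by rewrite -[\<tail D g, e i\>]/(coef _ i) coef_tail ?mulr0.
Qed.

Lemma Ex_e_tail D g i : vec g -> (i < D)%N -> Ex Q (fun z => e i z.1 * tail D g z.1) = 0.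
Proof.
move=> hg iD; rewrite (lm_cov lm); last exact: vec_tail.
rewrite dotC //; last exact: vec_tail.
by rewrite -[\<_, e i\>]/(coef _ i) coef_tail ?mulr0.
Qed.

Lemma nu2_synth a n :
  nu2 (synth e a n) = \sum_(i < n) mu i * a i ^+ 2 * \<e i, e i\>.
Proof.
have i1 i j : integr Q (fun z => a i * a j * (e i z.1 * e j z.1)).
  by apply: integrZ; exact: integr_vecM.
have E z : synth e a n z ^+ 2 = \sum_(i < n) \sum_(j < n) a i * a j * (e i z * e j z).
  rewrite synthE expr2 mulr_suml; apply: eq_bigr => i _; rewrite mulr_sumr.
  by apply: eq_bigr => j _; ring.
rewrite /nu2 (eq_Ex _ (fun z => E z.1)) Ex_sum => [|i _]; last exact: integr_sum.
apply: eq_bigr => i _; rewrite Ex_sum // (bigD1 i) //= big1 => [|j ji].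
  rewrite ExZ; last exact: integr_vecM.
  by rewrite (lm_cov lm) // addr0; ring.
rewrite ExZ; last exact: integr_vecM.
rewrite (lm_cov lm) // (frame_orth fr) ?mulr0 // eq_sym.
by apply: contra ji => /eqP ji; apply/eqP/val_inj.
Qed.

Lemma nu2_decomp D g : vec g ->
  nu2 g = \sum_(i < D) mu i * coef g i ^+ 2 + nu2 (tail D g).
Proof.
move=> hg; have ht := vec_tail D hg.
rewrite {1}(tail_decomp D g) nu2D // nu2_synth.
have -> : Ex Q (fun z => synth e (coef g) D z.1 * tail D g z.1) = 0.
  rewrite (eq_Ex _ (g := fun z => \sum_(i < D) coef g i * (e i z.1 * tail D g z.1))).
    rewrite Ex_sum => [|i _]; last by apply: integrZ; exact: integr_vecM.
    rewrite big1 // => i _; rewrite ExZ ?Ex_e_tail ?mulr0 //.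
    exact: integr_vecM.
  by move=> z; rewrite synthE mulr_suml; apply: eq_bigr => i _; rewrite mulrA.
rewrite mulr0 addr0; congr (_ + _); apply: eq_bigr => i _.
by rewrite -mulrA; congr (_ * _); rewrite expr2 -mulrA (frame_idem ipH fr).
Qed.

Lemma nu2_tail_le D g : vec g ->
  nu2 (tail D g) <= \<tail D g, tail D g\> * Ex Q (fun z => tau D z.1).
Proof.
move=> hg; rewrite -ExZ; last exact: integr_tau.
apply: Ex_le => [||z].
- by apply: integr_vec2; exact: vec_tail.
- by apply: integrZ; exact: integr_tau.
- by rewrite mulrC; exact: sqr_tail_le.
Qed.

Lemma sum_mu_coef_le D g : vec g -> \sum_(i < D) mu i * coef g i ^+ 2 <= nu2 g.
Proof. by move=> hg; rewrite (nu2_decomp D hg) lerDl nu2_ge0. Qed.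

Lemma sum_coef_le D g : vec g -> \sum_(i < D) coef g i ^+ 2 <= \<g, g\>.
Proof.
move=> hg; rewrite -(big_mkord xpredT (fun i => coef g i ^+ 2)).
exact: bessel.
Qed.

Definition lnorm lam g : R := nu2 g + lam * \<g, g\>.

Lemma lnorm_ge0 lam g : 0 <= lam -> vec g -> 0 <= lnorm lam g.
Proof. by move=> l0 hg; rewrite addr_ge0 ?nu2_ge0 ?mulr_ge0 ?(dot_ge0 ipH). Qed.

Section Source.
Context (f h : X -> R^o) (s rad lam : R).
Hypotheses (fv : vec f) (hv : vec h) (s0 : 0 < s) (s1 : s <= 2^-1) (lam0 : 0 < lam).
Hypothesis hrad : \<h, h\> <= rad ^+ 2.
Hypothesis fh : forall i, coef f i = mu i `^ s * coef h i.

(** Increase m^(2s) to (m + lam)^(2s - 1) (m + lam); the exponent 2s - 1 is nonpositive because s <=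
    1/2, so m + lam may be lowered to lam in that factor. *)
Lemma powR_interp (m : R) : 0 <= m -> (m `^ s) ^+ 2 <= lam `^ (2 * s - 1) * (m + lam).
Proof.
move=> m0; have ml : 0 < m + lam by rewrite ltr_wpDl.
have -> : (m `^ s) ^+ 2 = m `^ (2 * s) by rewrite -powR_mulrn ?powR_ge0 // -powRrM mulrC.
apply: le_trans (_ : (m + lam) `^ (2 * s) <= _).
  by apply: ge0_ler_powR; rewrite ?nnegrE ?mulr_ge0 ?(ltW s0) ?(ltW ml) ?lerDl ?(ltW lam0).
have -> : (m + lam) `^ (2 * s) = (m + lam) `^ (2 * s - 1) * (m + lam).
  by rewrite -{3}(powRr1 (ltW ml)) -powRD ?subrK // (gt_eqF ml) implybT.
rewrite ler_wpM2r ?(ltW ml) //.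
have -> : 2 * s - 1 = - (1 - 2 * s) by ring.
rewrite !powRN lef_pV2 ?posrE ?powR_gt0 //.
apply: ge0_ler_powR; rewrite ?nnegrE ?(ltW ml) ?(ltW lam0) ?lerDr //.
by have := s1; lra.
Qed.

Lemma source_dot u : vec u -> \<f, u\> ^+ 2 <= rad ^+ 2 * lam `^ (2 * s - 1) * lnorm lam u.
Proof.
move=> hu; have c := parseval2 ipH cH fr fv hu.
have c2 := @cvgM _ _ _ eventually_filter _ _ _ _ c c.
have bd n : (\sum_(0 <= i < n) \<f, e i\> * \<u, e i\>) *
    (\sum_(0 <= i < n) \<f, e i\> * \<u, e i\>) <=
    rad ^+ 2 * lam `^ (2 * s - 1) * lnorm lam u.
  rewrite big_mkord -expr2.
  have -> : \sum_(i < n) \<f, e i\> * \<u, e i\> =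
      \sum_(i < n) coef h i * (mu i `^ s * coef u i).
    by apply: eq_bigr => i _; rewrite -[\<f, _\>]/(coef f i) fh /coef; ring.
  apply: le_trans (sum_cauchy_schwarz _ _ _ _) _.
  rewrite -mulrA; apply: ler_pM.
  - by apply: sumr_ge0 => i _; exact: sqr_ge0.
  - by apply: sumr_ge0 => i _; exact: sqr_ge0.
  - exact: le_trans (sum_coef_le n hv) hrad.
  apply: le_trans (_ : \sum_(i < n) lam `^ (2 * s - 1) *
      ((mu i + lam) * coef u i ^+ 2) <= _).
    apply: ler_sum => i _; rewrite exprMn mulrA ler_wpM2r ?sqr_ge0 //.
    by apply: powR_interp; exact: mu_ge0.
  rewrite -mulr_sumr ler_wpM2l ?powR_ge0 // /lnorm.
  under eq_bigr do rewrite mulrDl.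
  rewrite big_split /= -mulr_sumr; apply: lerD; first exact: sum_mu_coef_le.
  by rewrite ler_wpM2l ?(ltW lam0) //; exact: sum_coef_le.
rewrite expr2 -(cvg_lim _ c2) //; apply: limr_le; first by apply/cvg_ex; eexists; exact: c2.
exact: nearW.
Qed.

(** From mu_i <= kap, 1 <= kap and 2s <= 1 follows mu_i^(2s) <= kap, a bound free of the exponent,
    which may vary from part to part. *)
Lemma source_norm : 1 <= kap -> \<f, f\> <= rad ^+ 2 * kap.
Proof.
move=> k1; have c := parseval ipH cH fr fv.
have bd n : \sum_(0 <= i < n) \<f, e i\> ^+ 2 <= rad ^+ 2 * kap.
  rewrite big_mkord; apply: le_trans (_ : \sum_(i < n) kap * coef h i ^+ 2 <= _).
    apply: ler_sum => i _; rewrite -[\<f, _\>]/(coef f i) fh exprMn ler_wpM2r ?sqr_ge0 //.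
    have -> : (mu i `^ s) ^+ 2 = mu i `^ (2 * s).
      by rewrite -powR_mulrn ?powR_ge0 // -powRrM mulrC.
    apply: (@le_trans _ _ (kap `^ (2 * s))).
      by apply: ge0_ler_powR; rewrite ?nnegrE ?mulr_ge0 ?mu_ge0 ?kap_ge0 ?mu_le ?(ltW s0).
    rewrite -{2}(powRr1 kap_ge0); apply: ler_powR => //.
    by have := s1; lra.
  rewrite -mulr_sumr mulrC ler_wpM2r ?kap_ge0 //.
  exact: le_trans (sum_coef_le n hv) hrad.
rewrite -(cvg_lim _ c) //; apply: limr_le; first by apply/cvg_ex; eexists; exact: c.
exact: nearW.
Qed.

End Source.
End LocalModel.

(** * Deterministic estimates: lower bound, ridge regression, normal equations *)

Section LocalEstimates.
Context (R : realType) d (X : measurableType d).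
Context (Q : probability (X * measurableTypeR R)%type R).
Context (H : ip_space (X -> R^o)) (k : X -> X -> R) (e : nat -> X -> R^o).
Context (kap : R).
Hypothesis lm : local_model Q H k e kap.
Local Notation vec := (vectors H).
Local Notation "\< u , v \>" := (dot H u v) (at level 0, u, v at level 99).
Local Notation mu := (mu Q e).
Local Notation nu2 := (nu2 Q).
Local Notation lnorm := (lnorm Q H).
Local Notation coef := (coef H e).
Local Notation tau := (tau k e).
Local Notation tail := (tail H e).
Let ipH := lm_ip lm.
Let fr := lm_frame lm.
Let kvec := lm_kvec lm.
Let evec i : vec (e i) := frame_vec fr i.
Hint Resolve kvec evec : core.

Lemma sqrB_le (p q a : R) : q ^+ 2 <= a -> (p - q) ^+ 2 <= 2 * p ^+ 2 + 2 * a.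
Proof. by move=> h; have := sqr_ge0 (p + q); rewrite sqrrB sqrrD; lra. Qed.

Section LowerForm.
Context (D : nat) (lam : R).
Hypothesis lam0 : 0 < lam.

(** Truncated kernel section in the coordinates that make the regularized norm Euclidean; its second
    moment is diagonal and its squared length is at most kap / lam. *)
Definition feature (z : X * measurableTypeR R) : 'cV[R]_D :=
  \col_i (e i z.1 / Num.sqrt (mu i + lam)).

Definition feature_cov (i : 'I_D) : R := mu i / (mu i + lam).

Lemma mu_lam_gt0 i : 0 < mu i + lam.
Proof. by rewrite ltr_wpDl // mu_ge0. Qed.

Lemma measurable_feature : measurable_mx feature.
Proof.
move=> i j; under eq_fun do rewrite mxE.
by apply: measurable_funM; [exact: (measurable_vec lm)|exact: measurable_cst].
Qed.

Lemma sqn_feature z : sqn (feature z) <= kap / lam.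
Proof.
rewrite sqnE; apply: le_trans (_ : \sum_(i < D) e i z.1 ^+ 2 / lam <= _).
  apply: ler_sum => i _; rewrite mxE exprMn exprVn sqr_sqrtr ?(ltW (mu_lam_gt0 i)) //.
  by rewrite ler_wpM2l ?sqr_ge0 // lef_pV2 ?posrE ?mu_lam_gt0 // lerDr mu_ge0.
by rewrite -mulr_suml ler_wpM2r ?invr_ge0 ?(ltW lam0) // (sum_e2_le lm).
Qed.

Lemma feature_cov01 a : 0 <= feature_cov a <= 1.
Proof.
rewrite divr_ge0 ?mu_ge0 ?(ltW (mu_lam_gt0 a)) //=.
by rewrite ler_pdivrMr ?mu_lam_gt0 // mul1r lerDl ltW.
Qed.

Lemma mu_idem i : mu i * \<e i, e i\> = mu i.
Proof.
case: fr => _ _ /(_ i)[e0|->] _; last by rewrite mulr1.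
have -> : mu i = 0; last by rewrite mul0r.
rewrite /mu /nu2 -[RHS](Ex0 Q); apply: eq_Ex => z.
by rewrite e0 /= expr0n.
Qed.

Lemma Ex_feature a c :
  Ex Q (fun z => feature z a ord0 * feature z c ord0) = (a == c)%:R * feature_cov a.
Proof.
have E z : feature z a ord0 * feature z c ord0 =
    (Num.sqrt (mu a + lam))^-1 * (Num.sqrt (mu c + lam))^-1 * (e a z.1 * e c z.1).
  by rewrite !mxE; ring.
rewrite (eq_Ex _ E) ExZ; last exact: (integr_vecM lm).
rewrite (lm_cov lm) //; have [<-|ac] := eqVneq a c.
  rewrite mu_idem mul1r -invfM -expr2 sqr_sqrtr ?(ltW (mu_lam_gt0 a)) //.
  by rewrite /feature_cov mulrC.
by rewrite (frame_orth fr) ?mulr0 ?mul0r.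
Qed.

Lemma dotv_feature z (g : X -> R^o) :
  dotv (feature z) (\col_i (Num.sqrt (mu i + lam) * coef g i)) =
  synth e (coef g) D z.1.
Proof.
rewrite (synthE e); apply: eq_bigr => i _; rewrite !mxE.
have : Num.sqrt (mu i + lam) != 0 by rewrite gt_eqF // sqrtr_gt0 mu_lam_gt0.
by move=> h; field.
Qed.

(** The factor 64 q^2 comes from [cayley_prod_lower], 4 q from passing from one block to the whole
    set and undoing the truncation at its points, 2 from the tail of g in both norms; the 3 is
    slack. *)
Definition lower_const (q : nat) : R := 64 * q%:R ^+ 2 * (4 * q%:R + 3) + 2.

(** Some block sees the truncation of g, and a block is a fixed fraction of s. The tail is at most
    lam times its squared norm, in square at each point of s and in mean, so the penalty absorbs
    it. *)
Lemma lower_form N (zs : 'I_N -> X * measurableTypeR R) (s : {set 'I_N}) (n : nat)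
    (bs : seq {set 'I_N}) :
  (0 < n)%N -> (0 < size bs)%N -> (#|s| <= 2 * size bs * n)%N ->
  all (fun B : {set 'I_N} => B \subset s) bs ->
  frob (block_prod feature feature_cov n bs zs) <= 4^-1 ->
  (forall t, t \in s -> tau D (zs t).1 <= lam) ->
  Ex Q (fun z => tau D z.1) <= lam ->
  forall g, vec g -> lnorm lam g <= lower_const (size bs) *
    (#|s|%:R^-1 * \sum_(t in s) g (zs t).1 ^+ 2 + lam * \<g, g\>).
Proof.
move=> n0 q0 sn subs small taus Etau g hg.
set q : R := (size bs)%:R; have q1 : 1 <= q by rewrite ler1n.
(* The squared length of u is the regularized norm of the truncation of g, and pairing u with a
   feature evaluates that truncation. *)
pose u : 'cV[R]_D := \col_i (Num.sqrt (mu i + lam) * coef g i).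
have u2 i : u i ord0 ^+ 2 = (mu i + lam) * coef g i ^+ 2.
  by rewrite mxE exprMn sqr_sqrtr // (ltW (mu_lam_gt0 i)).
have sz : (0 < size [seq block_form feature feature_cov n B zs | B <- bs])%N.
  by rewrite size_map.
have psd P : P \in [seq block_form feature feature_cov n B zs | B <- bs] ->
    P^T = P /\ forall z : 'cV_D, 0 <= dotv (P *m z) z.
  move=> /mapP[B _ ->]; split; first exact: block_form_sym.
  by move=> z; apply: block_form_psd; exact: feature_cov01.
have [_ /mapP[B Bbs ->]] := @cayley_prod_lower _ _ _ u sz psd small.
rewrite size_map dotv_block_form -/q.
set A := \sum_a _ * _; set C := \sum_(t in B) _ => le0.
have AE : A = lam * \sum_(i < D) coef g i ^+ 2.
  rewrite mulr_sumr; apply: eq_bigr => i _; rewrite u2 mulrA; congr (_ * _).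
  by rewrite /feature_cov; have := mu_lam_gt0 i => h; field; rewrite gt_eqF.
have uE : sqn u = \sum_(i < D) mu i * coef g i ^+ 2 + lam * \sum_(i < D) coef g i ^+ 2.
  rewrite sqnE mulr_sumr -big_split; apply: eq_bigr => i _ /=.
  by rewrite u2 mulrDl.
set G := \<g, g\>; have G0 : 0 <= G := dot_ge0 ipH hg.
set T := \<tail D g, tail D g\>.
have TE : T = G - \sum_(i < D) coef g i ^+ 2 by exact: (dot_tail lm).
have T0 : 0 <= T by apply: (dot_ge0 ipH); exact: (vec_tail lm).
set W := \sum_(t in s) g (zs t).1 ^+ 2.
have W0 : 0 <= W by apply: sumr_ge0 => t _; exact: sqr_ge0.
have /(allP subs)/fintype.subsetP Bs := Bbs.
have CW : C <= 2 * W + 2 * (#|s|%:R * (lam * T)).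
  apply: le_trans (_ : \sum_(t in s) (2 * g (zs t).1 ^+ 2 + 2 * (lam * T)) <= _).
    apply: le_trans (_ : \sum_(t in B) (2 * g (zs t).1 ^+ 2 + 2 * (lam * T)) <= _).
      apply: ler_sum => t tB; rewrite dotv_feature.
      have -> : synth e (coef g) D (zs t).1 = g (zs t).1 - tail D g (zs t).1.
        by rewrite {2}(tail_decomp H e D g) fctE addrK.
      apply: sqrB_le; apply: le_trans (sqr_tail_le lm D (zs t).1 hg) _.
      by rewrite -/T; exact: ler_wpM2r T0 _ _ (taus t (Bs t tB)).
    rewrite [leRHS](bigID (mem B)) /= -[leLHS]addr0.
    have -> : \sum_(i in s | i \in B) (2 * g (zs i).1 ^+ 2 + 2 * (lam * T)) =
        \sum_(t in B) (2 * g (zs t).1 ^+ 2 + 2 * (lam * T)).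
      apply: eq_bigl => t; have [tB|] := boolP (t \in B); last by rewrite andbF.
      by rewrite andbT; exact: Bs.
    rewrite lerD2l; apply: sumr_ge0 => t _.
    apply: addr_ge0; apply: mulr_ge0 => //; first exact: sqr_ge0.
    exact: mulr_ge0 (ltW lam0) T0.
  rewrite big_split /=; apply: lerD; first by rewrite /W mulr_sumr; exact: lexx.
  by rewrite sumr_const -[leLHS]mulr_natl mulrCA; exact: lexx.
have nR : 0 < n%:R :> R by rewrite ltr0n.
set V := #|s|%:R^-1 * W.
have V0 : 0 <= V by rewrite mulr_ge0 // invr_ge0 ler0n.
have WV : W = #|s|%:R * V.
  rewrite /V mulrA; have [s0|s0] := eqVneq #|s| 0%N; last first.
    by rewrite mulfV ?mul1r // pnatr_eq0.
  rewrite s0 !mul0r /W big1 // => t ts.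
  by move/eqP : s0; rewrite cards_eq0 => /eqP s0; rewrite s0 inE in ts.
have lT0 : 0 <= lam * T by rewrite mulr_ge0 // ltW.
have sn' : #|s|%:R / n%:R <= 2 * q.
  by rewrite ler_pdivrMr // /q -!natrM ler_nat.
have Cn : n%:R^-1 * C <= 2 * q * (2 * V + 2 * (lam * T)).
  apply: le_trans (_ : #|s|%:R / n%:R * (2 * V + 2 * (lam * T)) <= _).
    rewrite -mulrA mulrCA ler_wpM2l ?invr_ge0 ?ler0n //.
    by apply: le_trans CW _; rewrite WV; lra.
  rewrite ler_wpM2r //; apply: addr_ge0; exact: mulr_ge0.
have Su : sqn u <= 64 * q ^+ 2 * (A + n%:R^-1 * C).
  by rewrite mulrC -ler_pdivrMr // mulr_gt0 ?exprn_gt0 // (lt_le_trans ltr01).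
have Stail : nu2 (tail D g) <= lam * T.
  apply: le_trans (nu2_tail_le lm D hg) _; rewrite -/T [leRHS]mulrC.
  exact: ler_wpM2l T0 _ _ Etau.
rewrite /lnorm (nu2_decomp lm D hg) -/G.
set B1 := \sum_(i < D) _ in uE *.
set B2 := \sum_(i < D) _ in uE AE TE.
have B20 : 0 <= B2 by apply: sumr_ge0 => i _; exact: sqr_ge0.
have lB20 : 0 <= lam * B2 by rewrite mulr_ge0 // ltW.
have lG : lam * G = lam * B2 + lam * T by rewrite -mulrDr TE addrC subrK.
have q0' : 0 <= q by lra.
have step : A + n%:R^-1 * C <= 4 * q * (V + lam * G).
  by rewrite AE lG; nra.
have step2 : sqn u <= 64 * q ^+ 2 * (4 * q) * (V + lam * G).
  apply: le_trans Su _; rewrite -[leRHS]mulrA ler_wpM2l // mulr_ge0 ?sqr_ge0 //.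
have VG0 : 0 <= V + lam * G by rewrite lG; lra.
have : 0 <= 64 * q ^+ 2 * 3 * (V + lam * G) by rewrite !mulr_ge0 ?sqr_ge0.
by rewrite /lower_const -/q; lra.
Qed.

End LowerForm.

Section Comb.

Definition comb n (pts : 'I_n -> X) (a : 'cV[R]_n) : X -> R^o :=
  \sum_j a j ord0 *: (k (pts j) : X -> R^o).

Lemma vec_comb n (pts : 'I_n -> X) a : vec (comb pts a).
Proof. by apply: (vec_sum ipH) => j _; exact: (vecZ ipH). Qed.

Lemma combE n (pts : 'I_n -> X) a x : comb pts a x = \sum_j a j ord0 * k (pts j) x.
Proof. by rewrite /comb fct_sumE; apply: eq_bigr. Qed.

Lemma dot_comb n (pts : 'I_n -> X) a g : vec g ->
  \<comb pts a, g\> = \sum_j a j ord0 * g (pts j).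
Proof.
move=> hg; rewrite (dot_suml ipH) // => [|j _]; last exact: (vecZ ipH).
by apply: eq_bigr => j _; rewrite (dotZl ipH) // (dotC ipH) // -(lm_repr lm).
Qed.

Lemma combB n (pts : 'I_n -> X) a b : comb pts a - comb pts b = comb pts (a - b).
Proof.
by rewrite /comb -sumrB; apply: eq_bigr => j _; rewrite !mxE scalerBl.
Qed.

Definition gram n (pts : 'I_n -> X) : 'M[R]_n := \matrix_(i, j) k (pts i) (pts j).

Lemma ksym x y : k x y = k y x.
Proof. by rewrite !(kE lm) (dotC ipH). Qed.

Lemma gram_sym n (pts : 'I_n -> X) : (gram pts)^T = gram pts.
Proof. by apply/matrixP => i j; rewrite !mxE ksym. Qed.

Lemma gram_mul n (pts : 'I_n -> X) a i : (gram pts *m a) i ord0 = comb pts a (pts i).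
Proof. by rewrite mxE combE; apply: eq_bigr => j _; rewrite mxE mulrC ksym. Qed.

Lemma dotv_gram n (pts : 'I_n -> X) a b :
  dotv (gram pts *m a) b = \<comb pts a, comb pts b\>.
Proof.
rewrite (dotC ipH) ?(dot_comb) //; try exact: vec_comb.
by apply: eq_bigr => j _; rewrite gram_mul mulrC.
Qed.

Lemma gram_psd n (pts : 'I_n -> X) a : 0 <= dotv (gram pts *m a) a.
Proof. by rewrite dotv_gram (dot_ge0 ipH) //; exact: vec_comb. Qed.

End Comb.

Section RidgeRegression.
Context (n : nat) (pts : 'I_n -> X) (f : X -> R^o) (lam : R).
Hypotheses (n0 : (0 < n)%N) (lam0 : 0 < lam) (fv : vec f).

(* Kernel ridge regression of the noise-free values of f at the points pts. *)
Definition krr_coef : 'cV[R]_n :=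
  let c := (n%:R * lam)^-1 in
  invmx (1%:M + c *: gram pts) *m (c *: \col_i f (pts i)).

Definition krr : X -> R^o := comb pts krr_coef.

Lemma krr_unit : 1%:M + (n%:R * lam)^-1 *: gram pts \in unitmx.
Proof.
apply: psd_add1_unit => z; rewrite -scalemxAl dotvZl mulr_ge0 ?gram_psd //.
by rewrite invr_ge0 mulr_ge0 // ltW.
Qed.

Lemma krr_residual i : n%:R * lam * krr_coef i ord0 = f (pts i) - krr (pts i).
Proof.
set c := (n%:R * lam)^-1.
have nl0 : n%:R * lam != 0 by rewrite mulf_neq0 ?gt_eqF // ltr0n.
have : (1%:M + c *: gram pts) *m krr_coef = c *: \col_i f (pts i).
  by rewrite /krr_coef mulmxA mulmxV ?krr_unit // mul1mx.
rewrite mulmxDl mul1mx -scalemxAl => /matrixP/(_ i ord0).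
rewrite mxE [X in _ + X]mxE gram_mul [RHS]mxE [X in _ = _ * X]mxE -/krr => h.
have -> : krr_coef i ord0 = c * f (pts i) - c * krr (pts i) by rewrite -h addrK.
by rewrite -mulrBr mulrA /c mulfV // mul1r.
Qed.

Definition resid : X -> R^o := f - krr.

Lemma vec_resid : vec resid.
Proof. by apply: (vecB ipH) => //; exact: vec_comb. Qed.

Lemma residE i : resid (pts i) = n%:R * lam * krr_coef i ord0.
Proof. by rewrite krr_residual. Qed.

Lemma krr_normal g : vec g ->
  n%:R^-1 * \sum_i resid (pts i) * g (pts i) = lam * \<krr, g\>.
Proof.
move=> hg; rewrite dot_comb // !mulr_sumr; apply: eq_bigr => i _.
have nn : n%:R != 0 :> R by rewrite gt_eqF // ltr0n.
by rewrite residE; field.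
Qed.

(** The normal equations are tested against the residual itself. *)
Lemma krr_energy : n%:R^-1 * \sum_i resid (pts i) ^+ 2 + lam * \<resid, resid\> =
  lam * \<f, resid\>.
Proof.
have rv := vec_resid; have := krr_normal rv.
under eq_bigr do rewrite -expr2.
move=> ->; rewrite -mulrDr {2}/resid (dotBl ipH) //; last exact: vec_comb.
by rewrite addrC subrK.
Qed.

(** The energy E bounds itself: E^2 <= K |resid|_lam^2 <= K C E, and a positive E can be divided
    out. *)
Lemma krr_bound (C K : R) : 0 <= C -> 0 <= K ->
  (forall g, vec g -> lnorm lam g <= C *
     (n%:R^-1 * \sum_i g (pts i) ^+ 2 + lam * \<g, g\>)) ->
  (forall g, vec g -> (lam * \<f, g\>) ^+ 2 <= K * lnorm lam g) ->
  n%:R^-1 * \sum_i resid (pts i) ^+ 2 + lam * \<resid, resid\> <= C * K.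
Proof.
move=> C0 K0 low dual; have rv := vec_resid.
have := dual _ rv; have := low _ rv; rewrite krr_energy.
set E := lam * _ => h1 h2.
have [E0|E0] := leP E 0; first by apply: le_trans E0 _; exact: mulr_ge0.
rewrite -(ler_pM2r E0) -expr2; apply: le_trans h2 _.
by apply: le_trans (ler_wpM2l K0 h1) _; rewrite mulrA (mulrC K).
Qed.

End RidgeRegression.

Section NystroemEstimator.
Context (N : nat) (z : 'I_N -> X * R) (S : {set 'I_N}) (lam : R).
Hypotheses (lam0 : 0 < lam) (N0 : (0 < N)%N).

Definition subpts (i : 'I_#|S|) : X := (z (enum_val i)).1.

(** Stating the equations on functions of the span hides the choice of coefficients, which need not
    be unique when the Gram matrix is singular. *)
Lemma nystroem_normal : exists2 a : 'cV[R]_#|S|, nystroem k z S lam = comb subpts a &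
  forall b, \sum_t comb subpts a (z t).1 * comb subpts b (z t).1 +
    N%:R * lam * \<comb subpts a, comb subpts b\> =
    \sum_t (z t).2 * comb subpts b (z t).1.
Proof.
pose A := \matrix_(i < N, j < #|S|) k (z i).1 (subpts j).
pose y := \col_(i < N) (z i).2.
pose B := gram subpts.
pose a := moore_penrose (A^T *m A + (N%:R * lam) *: B) *m A^T *m y.
exists a; first by apply/funext => x; rewrite combE.
move=> b; have Ab (c : 'cV[R]_#|S|) t : (A *m c) t ord0 = comb subpts c (z t).1.
  by rewrite mxE combE; apply: eq_bigr => j _; rewrite mxE mulrC ksym.
have Nl0 : 0 <= N%:R * lam by rewrite mulr_ge0 // ltW.
have := moore_penrose_normal A y Nl0 (gram_sym subpts) (gram_psd subpts).
rewrite /= -/B -/a => /(congr1 (fun v => dotv v b)).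
rewrite mulmxDl -scalemxAl dotvDl dotvZl dotv_gram -mulmxA !(dotv_trmx A^T) trmxK.
have -> : dotv (A *m a) (A *m b) =
    \sum_t comb subpts a (z t).1 * comb subpts b (z t).1.
  by apply: eq_bigr => t _; rewrite !Ab.
have -> : dotv y (A *m b) = \sum_t (z t).2 * comb subpts b (z t).1.
  by apply: eq_bigr => t _; rewrite Ab mxE.
by [].
Qed.

End NystroemEstimator.
End LocalEstimates.

(** * Deterministic error bounds for the estimator *)

Section ErrorBound.
Context (R : realType) d (X : measurableType d).
Context (Q : probability (X * measurableTypeR R)%type R).
Context (H : ip_space (X -> R^o)) (k : X -> X -> R) (e : nat -> X -> R^o).
Context (kap : R).
Hypothesis lm : local_model Q H k e kap.
Local Notation vec := (vectors H).
Local Notation "\< u , v \>" := (dot H u v) (at level 0, u, v at level 99).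
Local Notation nu2 := (nu2 Q).
Local Notation lnorm := (lnorm Q H).
Local Notation coef := (coef H e).
Let ipH := lm_ip lm.
Let kvec := lm_kvec lm.
Hint Resolve kvec : core.

Lemma amgm_sqr (x a b t : R) : 0 <= a -> 0 <= b -> 0 < t ->
  x ^+ 2 <= a * b -> x <= a * t + b / (4 * t).
Proof.
move=> a0 b0 t0 h; rewrite leNgt; apply/negP => lt.
have s0 : 0 <= a * t + b / (4 * t) by rewrite addr_ge0 ?divr_ge0 ?mulr_ge0 ?(ltW t0).
have : (a * t + b / (4 * t)) ^+ 2 < x ^+ 2 by rewrite ltr_pXn2r ?nnegrE // (le_trans s0) ?ltW.
have : (a * t + b / (4 * t)) ^+ 2 = a * b + (a * t - b / (4 * t)) ^+ 2.
  by field; rewrite gt_eqF.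
by have := sqr_ge0 (a * t - b / (4 * t)); lra.
Qed.

(** The p_i are the empirical cross term, the penalty cross term, the bias and the noise in the
    energy identity. Of the energy itself they give back 1/2 and 1/4 from the first two and 1/16
    each from the last two, by [amgm_sqr] at t = 4 C; the total stays below 1 and is absorbed. *)
Lemma error_algebra (C K Y eN lee n2 uN luu p1 p2 p3 p4 : R) :
  1 <= C -> 0 <= K -> 0 <= Y -> 0 <= eN -> 0 <= lee -> 0 <= n2 -> 0 <= uN ->
  n2 <= C * (eN + lee) -> eN + lee = p1 + p2 + p3 + p4 ->
  p1 <= 2^-1 * uN + 2^-1 * eN -> p2 <= luu + 4^-1 * lee ->
  p3 ^+ 2 <= K * n2 -> p4 ^+ 2 <= Y * n2 -> luu <= C * K ->
  n2 <= C * (2 * uN + 16 * C * (K + Y)).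
Proof.
move=> C1 K0 Y0 eN0 lee0 n20 uN0 low en h1 h2 h3 h4 h5.
have C0 : 0 < 4 * C by lra.
have := amgm_sqr K0 n20 C0 h3; have := amgm_sqr Y0 n20 C0 h4.
have -> : n2 / (4 * (4 * C)) = 16^-1 * (n2 / C) by field; lra.
have : n2 / C <= eN + lee by rewrite ler_pdivrMr 1?mulrC //; lra.
move: (n2 / C) => q hq h6 h7.
apply: le_trans low _; rewrite ler_wpM2l; [by []|by lra|].
have CK0 : 0 <= C * K by rewrite mulr_ge0 //; lra.
have CY0 : 0 <= C * Y by rewrite mulr_ge0 //; lra.
by lra.
Qed.

Context (f : X -> R^o).
Hypothesis fv : vec f.
Context (N : nat) (z : 'I_N -> X * R) (S : {set 'I_N}) (lam : R).
Hypotheses (lam0 : 0 < lam) (N0 : (0 < N)%N).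

Definition emp (g g' : X -> R) : R := N%:R^-1 * \sum_t g (z t).1 * g' (z t).1.
Definition noise (g : X -> R) : R :=
  N%:R^-1 * \sum_t ((z t).2 - f (z t).1) * g (z t).1.

Lemma nystroem_vec : vec (nystroem k z S lam).
Proof. by have [a -> _] := nystroem_normal lm z S lam0; exact: (vec_comb lm). Qed.

Lemma emp_ge0 g : 0 <= emp g g.
Proof.
rewrite mulr_ge0 ?invr_ge0 //; apply: sumr_ge0 => t _.
by rewrite -expr2 sqr_ge0.
Qed.

Lemma emp_amgm g g' : emp g g' <= 2^-1 * emp g g + 2^-1 * emp g' g'.
Proof.
rewrite /emp !(mulrCA 2^-1) -mulrDr ler_wpM2l ?invr_ge0 // !mulr_sumr -big_split /=.
apply: ler_sum => t _; have := sqr_ge0 ((g (z t).1 : R) - g' (z t).1).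
by rewrite sqrrB; move: (g (z t).1) (g' (z t).1) => p q; rewrite !expr2; lra.
Qed.

(** Testing the normal equations against the estimator itself. No condition on the sample enters, so
    the bound is available on the exceptional event. *)
Lemma crude_bound : 
  nu2 (nystroem k z S lam - f) <=
  2 * kap / lam * (N%:R^-1 * \sum_t (z t).2 ^+ 2) + 2 * kap * \<f, f\>.
Proof.
have [a fE normal] := nystroem_normal lm z S lam0.
have va := vec_comb lm (subpts z (S:=S)) a; rewrite fE.
have hf := vecN ipH fv.
apply: le_trans (nu2D_le lm va hf) _.
have -> : nu2 (- f) = nu2 f.
  by apply: eq_Ex => x; rewrite fctE sqrrN.
have kap0 := kap_ge0 lm.
apply: lerD; last by rewrite -mulrA ler_wpM2l //; exact: (nu2_le lm).
rewrite -!mulrA ler_wpM2l //; apply: le_trans (nu2_le lm va) _.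
rewrite ler_wpM2l // -(ler_pM2l lam0) mulrA mulfV ?gt_eqF // mul1r.
have NR : 0 < N%:R :> R by rewrite ltr0n.
rewrite -(ler_pM2l NR) !mulrA mulfV ?gt_eqF // mul1r.
have := normal a; set g := comb _ _ _; set G := \<g, g\> => h.
have : \sum_t (z t).2 * g (z t).1 <= \sum_t (z t).2 ^+ 2 + \sum_t g (z t).1 * g (z t).1.
  rewrite -big_split; apply: ler_sum => t _ /=.
  move: (z t).2 (g (z t).1 : R) => p q; rewrite -expr2.
  by have := sqr_ge0 (p - q); have := sqr_ge0 p; have := sqr_ge0 q; rewrite sqrrB; lra.
by rewrite -h addrC lerD2r.
Qed.

Context (C K Y : R).
Hypotheses (C1 : 1 <= C) (K0 : 0 <= K) (Y0 : 0 <= Y) (S0 : (0 < #|S|)%N).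
Hypothesis lowS : forall g, vec g -> lnorm lam g <=
  C * (#|S|%:R^-1 * \sum_(t in S) g (z t).1 ^+ 2 + lam * \<g, g\>).
Hypothesis lowN : forall g, vec g -> lnorm lam g <= C * (emp g g + lam * \<g, g\>).
Hypothesis dual : forall g, vec g -> (lam * \<f, g\>) ^+ 2 <= K * lnorm lam g.
Hypothesis noiseY : forall g, vec g -> noise g ^+ 2 <= Y * lnorm lam g.

Let u : X -> R^o := resid k (subpts z (S:=S)) f lam.

Lemma resid_bound :
  #|S|%:R^-1 * \sum_(t in S) u (z t).1 ^+ 2 + lam * \<u, u\> <= C * K.
Proof.
rewrite (big_enum_val (fun t => u (z t).1 ^+ 2)) /=.
apply: (krr_bound lm) => //; first exact: le_trans ler01 C1.
move=> g hg; have := lowS hg.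
by rewrite (big_enum_val (fun t => g (z t).1 ^+ 2)).
Qed.

Lemma resid_lnorm : lnorm lam u <= C * (C * K).
Proof.
have vu : vec u by exact: (vec_resid lm).
apply: le_trans (lowS vu) _; rewrite ler_wpM2l ?(le_trans ler01 C1) //.
exact: resid_bound.
Qed.

Lemma error_bound : nu2 (nystroem k z S lam - f) <= 34 * C ^+ 2 * (emp u u + K + Y).
Proof.
have [a fE normal] := nystroem_normal lm z S lam0; rewrite fE.
set pts := subpts z (S:=S) in normal *.
pose b := krr_coef k pts f lam.
have uE : u = f - comb k pts b by [].
have vu : vec u by exact: (vec_resid lm).
pose g := comb k pts (a - b).
have vg : vec g by exact: (vec_comb lm).
have va := vec_comb lm pts a; have vb := vec_comb lm pts b.
have gE : comb k pts a = g + comb k pts b by rewrite /g -combB subrK.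
have eE : comb k pts a - f = g - u by rewrite uE gE opprB addrA.
have NR : 0 < N%:R :> R by rewrite ltr0n.
(* These are the normal equations tested against g, with the estimator written as g + (f - u) and
   each label as the value of f plus noise. *)
have key : emp g g + lam * \<g, g\> = emp u g + lam * \<u, g\> + - (lam * \<f, g\>) + noise g.
  have := normal (a - b); rewrite -/g.
  have -> : \<comb k pts a, g\> = \<g, g\> + \<comb k pts b, g\> by rewrite gE (dotDl ipH).
  have -> : \<u, g\> = \<f, g\> - \<comb k pts b, g\> by rewrite uE (dotBl ipH).
  have -> : \sum_t comb k pts a (z t).1 * g (z t).1 = N%:R * (emp g g - emp u g) +
      \sum_t f (z t).1 * g (z t).1.
    rewrite /emp -mulrBr mulrA mulfV ?gt_eqF // mul1r -sumrB -big_split.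
    apply: eq_bigr => t _ /=; rewrite uE gE !fctE.
    by move: (f _ : R) (g _ : R) (comb _ _ _ _ : R) => p q r; ring.
  have -> : \sum_t (z t).2 * g (z t).1 = N%:R * noise g + \sum_t f (z t).1 * g (z t).1.
    rewrite /noise mulrA mulfV ?gt_eqF // mul1r -big_split.
    apply: eq_bigr => t _ /=.
    by move: (f _ : R) (g _ : R) => p q; ring.
  move: (\sum_t f (z t).1 * g (z t).1 : R) => F.
  move: (emp g g) (emp u g) (noise g) \<g, g\> \<f, g\> \<comb k pts b, g\> => p1 p2 p3 p4 p5 p6.
  move=> h; have {}h : N%:R * (p1 - p2 + lam * (p4 + p6)) = N%:R * p3 by lra.
  have := mulfI (lt0r_neq0 NR) h; lra.
have G0 : 0 <= lam * \<g, g\> by rewrite mulr_ge0 ?(ltW lam0) ?(dot_ge0 ipH).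
have p2 : lam * \<u, g\> <= lam * \<u, u\> + 4^-1 * (lam * \<g, g\>).
  rewrite mulrCA -mulrDr ler_wpM2l ?(ltW lam0) //.
  have hg2 := vecZ ipH 2^-1 vg.
  have := dot_ge0 ipH (vecB ipH vu hg2); rewrite (dot_sub_sqr ipH) //.
  by rewrite (dotZr ipH) // (dotZl ipH) // (dotZr ipH) //; lra.
have rb := resid_bound.
have S20 : 0 <= #|S|%:R^-1 * \sum_(t in S) u (z t).1 ^+ 2.
  by rewrite mulr_ge0 ?invr_ge0 //; apply: sumr_ge0 => t _; exact: sqr_ge0.
have luu : lam * \<u, u\> <= C * K by lra.
have l0 : 0 <= lnorm lam g by apply: (lnorm_ge0 lm) => //; exact: ltW.
have p3 : (- (lam * \<f, g\>)) ^+ 2 <= K * lnorm lam g by rewrite sqrrN; exact: dual.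
have bg := error_algebra C1 K0 Y0 (emp_ge0 g) G0 l0 (emp_ge0 u) (lowN vg) key
  (emp_amgm u g) p2 p3 (noiseY vg) luu.
have n2g : nu2 g <= lnorm lam g by rewrite lerDl.
have n2u : nu2 u <= C * (C * K).
  apply: le_trans resid_lnorm; rewrite lerDl mulr_ge0 ?(ltW lam0) //.
  exact: (dot_ge0 ipH).
have hu := vecN ipH vu.
rewrite eE; apply: le_trans (nu2D_le lm vg hu) _.
have -> : nu2 (- u) = nu2 u by apply: eq_Ex => x; rewrite fctE sqrrN.
have u0 := emp_ge0 u; move: (emp u u) u0 bg => U U0 bg.
(* These 32 and the 2 from twice [nu2 u] make up the constant 34. *)
have bound1 : 2 * nu2 g <= 4 * (C ^+ 2 * U) + 32 * (C ^+ 2 * (K + Y)).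
  have C0 : 0 <= C := le_trans ler01 C1.
  have CU : C * U <= C ^+ 2 * U by rewrite ler_wpM2r // expr2 ler_peMl.
  apply: le_trans (ler_wpM2l _ (le_trans n2g bg)) _ => //.
  by rewrite expr2 in CU *; lra.
have CU0 : 0 <= C ^+ 2 * U by rewrite mulr_ge0 ?sqr_ge0.
have CY0 : 0 <= C ^+ 2 * Y by rewrite mulr_ge0 ?sqr_ge0.
move: n2u bound1; rewrite !expr2 in CU0 CY0 *; move: (nu2 g) (nu2 u) => p q.
by lra.
Qed.

End ErrorBound.

(** * Measurability of the comparison function and the dual norm of the noise *)

Section LocalRisk.
Context (R : realType) d (X : measurableType d).
Local Notation T := (X * measurableTypeR R)%type.
Context (Q : probability T R).
Context (H : ip_space (X -> R^o)) (k : X -> X -> R) (e : nat -> X -> R^o).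
Context (kap : R).
Hypothesis lm : local_model Q H k e kap.
Local Notation vec := (vectors H).
Local Notation "\< u , v \>" := (dot H u v) (at level 0, u, v at level 99).
Local Notation mu := (mu Q e).
Local Notation nu2 := (nu2 Q).
Local Notation lnorm := (lnorm Q H).
Local Notation coef := (coef H e).
Local Notation tau := (tau k e).
Local Notation tail := (tail H e).
Let ipH := lm_ip lm.
Let fr := lm_frame lm.
Let kvec := lm_kvec lm.
Let evec i : vec (e i) := frame_vec fr i.
Hint Resolve kvec evec : core.

Context dO (O : measurableType dO) (P : probability O R).
Context (N : nat) (Z : 'I_N -> O -> T) (S : O -> {set 'I_N}).
Hypothesis hZS : sampling P Q Z S.
Context (f : X -> R^o) (lam : R).
Hypotheses (fv : vec f) (lam0 : 0 < lam).

Definition subsample (s : {set 'I_N}) (zs : 'I_N -> T) (i : 'I_#|s|) : X :=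
  (zs (enum_val i)).1.

(** The measurable space W is arbitrary and only the points of s are constrained: W will be the
    sample space with the sigma-algebra of [others t] for t outside s. *)
Lemma measurable_krr_coef d' (W : measurableType d') (s : {set 'I_N})
    (zs : 'I_N -> W -> T) :
  (forall t, t \in s -> measurable_fun setT (zs t)) ->
  measurable_mx (fun w => krr_coef k (subsample (s := s) (zs^~ w)) f lam).
Proof.
move=> mz; have mx (i : 'I_#|s|) : measurable_fun setT (fun w => (zs (enum_val i) w).1).
  by apply: measurableT_comp measurable_fst _; apply: mz; exact: enum_valP.
case: (posnP #|s|) => [s0|s0]; first by move=> i; have := ltn_ord i; rewrite {2}s0.
apply: measurable_mulmx.
  apply: measurable_invmx => [w|]; first exact: (krr_unit lm).
  apply: measurable_addmx; first exact: measurable_cstmx.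
  move=> i j.
  have -> : (fun w => ((#|s|%:R * lam)^-1 *: gram k (subsample (s := s) (zs^~ w))) i j) =
      (fun w => (#|s|%:R * lam)^-1 * k (zs (enum_val i) w).1 (zs (enum_val j) w).1).
    by apply/funext => w; rewrite !mxE.
  apply: measurable_funM; first exact: measurable_cst.
  have mp : measurable_fun setT
    (fun w => ((zs (enum_val i) w).1, (zs (enum_val j) w).1)).
    exact: measurable_fun_pair.
  exact: measurableT_comp (lm_kmeas lm) mp.
move=> i j.
have -> : (fun w => ((#|s|%:R * lam)^-1 *: \col_i f (subsample (s := s) (zs^~ w) i)) i j) =
    (fun w => (#|s|%:R * lam)^-1 * f (zs (enum_val i) w).1).
  by apply/funext => w; rewrite !mxE.
apply: measurable_funM; first exact: measurable_cst.
exact: measurableT_comp (lm_meas lm fv) (mx i).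
Qed.

Definition sresid (s : {set 'I_N}) (zs : 'I_N -> T) : X -> R^o :=
  resid k (subsample (s := s) zs) f lam.

Lemma vec_sresid s zs : vec (sresid s zs).
Proof. exact: (vec_resid lm). Qed.

Lemma measurable_coef_sresid d' (W : measurableType d') (s : {set 'I_N})
    (zs : 'I_N -> W -> T) a :
  (forall t, t \in s -> measurable_fun setT (zs t)) ->
  measurable_fun setT (fun w => coef (sresid s (zs^~ w)) a).
Proof.
move=> mz.
have -> : (fun w => coef (sresid s (zs^~ w)) a) = (fun w => coef f a -
    \sum_j krr_coef k (subsample (s := s) (zs^~ w)) f lam j ord0 *
      e a (zs (enum_val j) w).1).
  apply/funext => w; rewrite /coef /sresid /resid (dotBl ipH) //; last exact: (vec_comb lm).
  by rewrite (dot_comb lm).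
apply: measurable_funB; first exact: measurable_cst.
apply: measurable_sum => j; apply: measurable_funM.
  exact: (measurable_krr_coef mz).
have mj : measurable_fun setT (fun w => (zs (enum_val j) w).1).
  by apply: measurableT_comp measurable_fst _; apply: mz; exact: enum_valP.
exact: measurableT_comp (lm_meas lm (evec a)) mj.
Qed.

Section Noise.
Context (sig2 : R).
Let eps (z : T) : R := z.2 - f z.1.
Hypothesis noise_mean : forall g, vec g ->
  integr Q (fun z => eps z * g z.1) /\ Ex Q (fun z => eps z * g z.1) = 0.
Hypothesis sig2_ge0 : 0 <= sig2.
Hypothesis noise_var : forall phi : X -> R, measurable_fun setT phi ->
  (exists B, forall x, 0 <= phi x <= B) ->
  integr Q (fun z => eps z ^+ 2 * phi z.1) /\
  Ex Q (fun z => eps z ^+ 2 * phi z.1) <= sig2 * Ex Q (fun z => phi z.1).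

(** Bound for the squared dual norm of the noise functional. The coordinates beyond D are treated by
    Cauchy-Schwarz over the sample points, without using cancellation, which is affordable since
    [tau] is tiny in mean. *)
Definition noise_energy D (zs : 'I_N -> T) : R :=
  2 * (\sum_(i < D) noise f zs (e i) ^+ 2 / (mu i + lam) +
       (N%:R * lam)^-1 * \sum_t eps (zs t) ^+ 2 * tau D (zs t).1).

Lemma noise_energy_ge0 D zs : 0 <= noise_energy D zs.
Proof.
rewrite mulr_ge0 // addr_ge0 //.
  by apply: sumr_ge0 => i _; rewrite divr_ge0 ?sqr_ge0 // addr_ge0 ?mu_ge0 ?ltW.
rewrite mulr_ge0 ?invr_ge0 ?mulr_ge0 ?(ltW lam0) //; apply: sumr_ge0 => t _.
by rewrite mulr_ge0 ?sqr_ge0 ?(tau_ge0 lm).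
Qed.

Lemma noise_energyP D (zs : 'I_N -> T) g : (0 < N)%N -> vec g ->
  noise f zs g ^+ 2 <= noise_energy D zs * lnorm lam g.
Proof.
move=> N0 hg; have NR : 0 < N%:R :> R by rewrite ltr0n.
pose p1 : R := \sum_(i < D) coef g i * noise f zs (e i).
pose p2 : R := noise f zs (tail D g).
have split : noise f zs g = p1 + p2.
  have -> : p1 = N%:R^-1 * \sum_t \sum_(i < D) eps (zs t) * (coef g i * e i (zs t).1).
    rewrite exchange_big /p1 mulr_sumr; apply: eq_bigr => i _.
    rewrite /noise mulrCA; congr (_ * _); rewrite mulr_sumr; apply: eq_bigr => t _.
    by rewrite mulrCA.
  rewrite /p2 /noise -mulrDr; congr (_ * _); rewrite -big_split.
  apply: eq_bigr => t _ /=; rewrite {1}(tail_decomp H e D g) fctE mulrDr; congr (_ + _).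
  by rewrite synthE mulr_sumr.
have l0 : 0 <= lnorm lam g by apply: (lnorm_ge0 lm) => //; exact: ltW.
have ml i : 0 < mu i + lam by rewrite ltr_wpDl ?mu_ge0.
have h1 : p1 ^+ 2 <= (\sum_(i < D) noise f zs (e i) ^+ 2 / (mu i + lam)) * lnorm lam g.
  have -> : p1 = \sum_(i < D) (noise f zs (e i) / Num.sqrt (mu i + lam)) *
      (Num.sqrt (mu i + lam) * coef g i).
    apply: eq_bigr => i _.
    have : Num.sqrt (mu i + lam) != 0 by rewrite gt_eqF // sqrtr_gt0.
    by move=> ne0; field.
  apply: le_trans (sum_cauchy_schwarz _ _ _ _) _.
  have -> : \sum_(i < D) (noise f zs (e i) / Num.sqrt (mu i + lam)) ^+ 2 =
      \sum_(i < D) noise f zs (e i) ^+ 2 / (mu i + lam).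
    by apply: eq_bigr => i _; rewrite exprMn exprVn sqr_sqrtr ?(ltW (ml i)).
  rewrite ler_wpM2l //.
    by apply: sumr_ge0 => i _; rewrite divr_ge0 ?sqr_ge0 ?(ltW (ml i)).
  rewrite /lnorm; under eq_bigr do rewrite exprMn sqr_sqrtr ?(ltW (ml _)) // mulrDl.
  rewrite big_split /= -mulr_sumr; apply: lerD; first exact: (sum_mu_coef_le lm).
  by rewrite ler_wpM2l ?(ltW lam0) //; exact: (sum_coef_le lm).
have h2 : p2 ^+ 2 <= ((N%:R * lam)^-1 * \sum_t eps (zs t) ^+ 2 * tau D (zs t).1) * lnorm lam g.
  have T0 : 0 <= \<tail D g, tail D g\> by apply: (dot_ge0 ipH); exact: (vec_tail lm).
  have lT : lam * \<tail D g, tail D g\> <= lnorm lam g.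
    rewrite /lnorm -[leLHS]add0r; apply: lerD; first exact: nu2_ge0.
    by rewrite ler_wpM2l ?(ltW lam0) //; exact: (dot_tail_le lm).
  apply: le_trans (_ : (N%:R * lam)^-1 * (\sum_t eps (zs t) ^+ 2 * tau D (zs t).1) *
      (lam * \<tail D g, tail D g\>) <= _); last first.
    rewrite ler_wpM2l // mulr_ge0 ?invr_ge0 ?mulr_ge0 ?(ltW lam0) //.
    by apply: sumr_ge0 => t _; rewrite mulr_ge0 ?sqr_ge0 ?(tau_ge0 lm).
  rewrite /p2 /noise exprMn.
  apply: le_trans (_ : N%:R^-1 ^+ 2 * ((\sum_(t < N) 1 ^+ 2) *
     \sum_(t < N) (eps (zs t) * tail D g (zs t).1) ^+ 2) <= _).
    rewrite ler_wpM2l ?sqr_ge0 //.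
    have -> : \sum_t ((zs t).2 - f (zs t).1) * tail D g (zs t).1 =
        \sum_(t < N) 1 * (eps (zs t) * tail D g (zs t).1).
      by apply: eq_bigr => t _; rewrite mul1r.
    exact: sum_cauchy_schwarz.
  rewrite sumr_const card_ord expr1n.
  have -> : N%:R^-1 ^+ 2 * (1 *+ N * \sum_(t < N) (eps (zs t) * tail D g (zs t).1) ^+ 2) =
      N%:R^-1 * \sum_(t < N) (eps (zs t) * tail D g (zs t).1) ^+ 2.
    move: (\sum_(t < N) _) => W; rewrite -[1 *+ N]/(N%:R : R).
    by field; rewrite gt_eqF.
  have -> : (N%:R * lam)^-1 * (\sum_t eps (zs t) ^+ 2 * tau D (zs t).1) *
      (lam * \<tail D g, tail D g\>) = N%:R^-1 *
      \sum_t eps (zs t) ^+ 2 * (tau D (zs t).1 * \<tail D g, tail D g\>).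
    under [in RHS]eq_bigr do rewrite mulrA.
    rewrite -mulr_suml; move: (\sum_t _) \<_, _\> => W1 W2.
    by field; rewrite !gt_eqF.
  rewrite ler_wpM2l ?invr_ge0 //; apply: ler_sum => t _.
  by rewrite exprMn ler_wpM2l ?sqr_ge0 //; exact: (sqr_tail_le lm).
rewrite split /noise_energy -mulrA mulrDl.
have := sqr_ge0 (p1 - p2); rewrite sqrrB sqrrD; lra.
Qed.

Let integr_eps2 : integr Q (fun z => eps z ^+ 2).
Proof.
have [||i _] := @noise_var (fun=> 1); first exact: measurable_cst.
  by exists 1 => x; rewrite ler01 lexx.
by apply: eq_integr i => z; rewrite mulr1.
Qed.

Lemma Ex_noise2 i : (0 < N)%N ->
  integr P (fun w => noise f (Z^~ w) (e i) ^+ 2) /\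
  Ex P (fun w => noise f (Z^~ w) (e i) ^+ 2) <= sig2 * mu i / N%:R.
Proof.
move=> N0; have NR : 0 < N%:R :> R by rewrite ltr0n.
pose h (z : T) : R := eps z * e i z.1.
have [ih h0] := noise_mean (evec i).
have mh := integr_meas ih.
have [ih2 h2] : integr Q (fun z => h z ^+ 2) /\ Ex Q (fun z => h z ^+ 2) <= sig2 * mu i.
  have [||j1 j2] := @noise_var (fun x => e i x ^+ 2).
  - by apply: measurable_funX; exact: (lm_meas lm).
  - exists (kap * \<e i, e i\>) => x; rewrite sqr_ge0 /=.
    exact: (sqr_eval_le lm).
  have E z : eps z ^+ 2 * (e i z.1 ^+ 2) = h z ^+ 2 by rewrite exprMn.
  by split; [exact: eq_integr E j1|rewrite -(eq_Ex _ E)].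
have cross t t' : t != t' -> integr P (fun w => h (Z t w) * h (Z t' w)) /\
    Ex P (fun w => h (Z t w) * h (Z t' w)) = 0.
  move=> tt'.
  have mt' : measurable_fun setT (fun w : g_sigma_algebraType (others Z S t) => h (Z t' w)).
    have mZ : measurable_fun setT (Z t' : g_sigma_algebraType (others Z S t) -> T).
      by apply: others_Z; rewrite eq_sym.
    exact: measurableT_comp mh mZ.
  have [j1 j2] := sampling_indep hZS ih mt' (integr_sample hZS t' ih).
  by split=> //; rewrite j2 h0 mul0r.
have diag t : integr P (fun w => h (Z t w) * h (Z t w)) /\
    Ex P (fun w => h (Z t w) * h (Z t w)) <= sig2 * mu i.
  have E w : h (Z t w) ^+ 2 = h (Z t w) * h (Z t w) by rewrite expr2.
  have j := integr_sample hZS t ih2.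
  split; first exact: eq_integr E j.
  by rewrite -(eq_Ex _ E); apply: le_trans h2; rewrite -(Ex_sample hZS t ih2).
have int t t' : integr P (fun w => h (Z t w) * h (Z t' w)).
  by have [<-|/cross[]//] := eqVneq t t'; case: (diag t).
have E w : N%:R ^- 2 * \sum_t \sum_t' h (Z t w) * h (Z t' w) = noise f (Z^~ w) (e i) ^+ 2.
  rewrite /noise exprMn exprVn; congr (_ * _).
  by rewrite expr2 mulr_suml; apply: eq_bigr => t _; rewrite mulr_sumr.
have int2 : integr P (fun w => \sum_t \sum_t' h (Z t w) * h (Z t' w)).
  by apply: integr_sum => t _; apply: integr_sum => t' _.
split; first by apply: eq_integr E _; exact: integrZ.
rewrite -(eq_Ex _ E) ExZ // Ex_sum => [|t _]; last exact: integr_sum.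
apply: le_trans (_ : N%:R ^- 2 * \sum_(t < N) (sig2 * mu i) <= _).
  rewrite ler_wpM2l ?invr_ge0 ?exprn_ge0 ?(ltW NR) //; apply: ler_sum => t _.
  rewrite Ex_sum // (bigD1 t) //= big1 ?addr0 => [|t' tt']; first by case: (diag t).
  by case: (cross t t') => //; rewrite eq_sym.
rewrite sumr_const card_ord -[_ *+ N]mulr_natl le_eqVlt; apply/orP; left; apply/eqP.
by field; rewrite gt_eqF.
Qed.

Lemma Ex_noise_energy D (delta : R) : (0 < N)%N ->
  Ex Q (fun z => tau D z.1) <= delta ->
  integr P (fun w => noise_energy D (Z^~ w)) /\
  Ex P (fun w => noise_energy D (Z^~ w)) <=
    2 * sig2 * (N%:R^-1 * \sum_(i < D) mu i / (mu i + lam) + delta / lam).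
Proof.
move=> N0 Edelta; have NR : 0 < N%:R :> R by rewrite ltr0n.
have ml i : 0 < mu i + lam by rewrite ltr_wpDl ?mu_ge0.
have [||j1 j2] := @noise_var (tau D).
- exact: (measurable_tau lm).
- by exists kap => x; rewrite (tau_ge0 lm) (tau_le lm).
have i1 i : integr P (fun w => (mu i + lam)^-1 * noise f (Z^~ w) (e i) ^+ 2).
  by apply: integrZ; case: (Ex_noise2 i N0).
have i2 : integr P (fun w => \sum_t eps (Z t w) ^+ 2 * tau D (Z t w).1).
  by apply: integr_sum => t _; exact: (integr_sample hZS t j1).
have i1s : integr P (fun w => \sum_(i < D) (mu i + lam)^-1 * noise f (Z^~ w) (e i) ^+ 2).
  by apply: integr_sum => i _.
have i12 := integrD i1s (integrZ (N%:R * lam)^-1 i2).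
have E w : 2 * (\sum_(i < D) (mu i + lam)^-1 * noise f (Z^~ w) (e i) ^+ 2 +
   (N%:R * lam)^-1 * \sum_t eps (Z t w) ^+ 2 * tau D (Z t w).1) = noise_energy D (Z^~ w).
  rewrite /noise_energy; congr (_ * (_ + _)).
  by apply: eq_bigr => i _; rewrite mulrC.
split; first by apply: eq_integr E _; exact: integrZ.
rewrite -(eq_Ex _ E) ExZ // ExD //; last exact: integrZ.
rewrite -mulrA ler_wpM2l // mulrDr; apply: lerD.
    rewrite Ex_sum // mulr_sumr mulr_sumr; apply: ler_sum => i _.
    have [k1 k2] := Ex_noise2 i N0.
    rewrite ExZ //; apply: le_trans (ler_wpM2l _ k2) _; first by rewrite invr_ge0 ltW.
    by rewrite le_eqVlt; apply/orP; left; apply/eqP; field; rewrite !gt_eqF.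
  rewrite ExZ // Ex_sum => [|t _]; last exact: (integr_sample hZS t j1).
  apply: le_trans (_ : (N%:R * lam)^-1 * \sum_(t < N) (sig2 * delta) <= _).
    rewrite ler_wpM2l ?invr_ge0 ?mulr_ge0 ?(ltW lam0) //; apply: ler_sum => t _.
    rewrite (Ex_sample hZS t j1); apply: le_trans j2 _.
    by rewrite ler_wpM2l.
  rewrite sumr_const card_ord -[_ *+ N]mulr_natl le_eqVlt; apply/orP; left; apply/eqP.
  by field; rewrite !gt_eqF.
Qed.

End Noise.
End LocalRisk.

(** * Expected local error *)

Section LocalBound.
Context (R : realType) d (X : measurableType d).
Local Notation T := (X * measurableTypeR R)%type.
Context (Q : probability T R).
Context (H : ip_space (X -> R^o)) (k : X -> X -> R) (e : nat -> X -> R^o).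
Context (kap : R).
Hypothesis lm : local_model Q H k e kap.
Local Notation vec := (vectors H).
Local Notation "\< u , v \>" := (dot H u v) (at level 0, u, v at level 99).
Local Notation mu := (mu Q e).
Local Notation nu2 := (nu2 Q).
Local Notation lnorm := (lnorm Q H).
Local Notation coef := (coef H e).
Local Notation tau := (tau k e).
Local Notation tail := (tail H e).
Let ipH := lm_ip lm.
Let fr := lm_frame lm.
Let kvec := lm_kvec lm.
Let evec i : vec (e i) := frame_vec fr i.
Hint Resolve kvec evec : core.

Context dO (O : measurableType dO) (P : probability O R).
Context (N : nat) (Z : 'I_N -> O -> T) (S : O -> {set 'I_N}).
Hypothesis hZS : sampling P Q Z S.
Context (f : X -> R^o) (lam : R).
Hypotheses (fv : vec f) (lam0 : 0 < lam).
Context (D q l : nat).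
Hypotheses (q0 : (0 < q)%N) (ql : (q <= l)%N) (lN : (l <= N)%N).
Local Notation C := (lower_const R q).
Local Notation sresid := (sresid k f lam).
Context (blk : {set 'I_N} -> seq {set 'I_N}).
Hypothesis hblk : forall s, [/\ size (blk s) = q,
  all (fun B : {set 'I_N} => #|B| == #|s| %/ q)%N (blk s),
  pairwise (fun A B : {set 'I_N} => disjoint (mem A) (mem B)) (blk s)
  & all (fun B : {set 'I_N} => B \subset s) (blk s)].
Local Notation bad_on s := (bad_blocks (feature Q e D lam)
  (feature_cov Q e lam (D := D)) (#|s| %/ q) (blk s)).
Context (delta K F : R).
Hypotheses (Edelta : Ex Q (fun z => tau D z.1) <= delta) (delta_lam : delta <= lam).
Hypotheses (K0 : 0 <= K) (fF : \<f, f\> <= F).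
Hypothesis dual : forall g, vec g -> (lam * \<f, g\>) ^+ 2 <= K * lnorm lam g.

Lemma lower_const_ge1 : 1 <= C.
Proof.
rewrite /lower_const; have : 0 <= 64 * q%:R ^+ 2 * (4 * q%:R + 3) :> R by [].
by lra.
Qed.

Lemma block_size_le m : (q <= m)%N -> (m <= 2 * q * (m %/ q))%N.
Proof.
move=> qm; rewrite {1}(divn_eq m q) -mulnA mul2n -addnn mulnC leq_add2l.
apply: (@leq_trans q); first by rewrite ltnW // ltn_mod.
by rewrite leq_pmulr // divn_gt0.
Qed.

Lemma lower_on (s : {set 'I_N}) (zs : 'I_N -> T) : (q <= #|s|)%N -> bad_on s zs = 0 ->
  (forall t, t \in s -> tau D (zs t).1 <= lam) ->
  forall g, vec g -> lnorm lam g <=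
    C * (#|s|%:R^-1 * \sum_(t in s) g (zs t).1 ^+ 2 + lam * \<g, g\>).
Proof.
move=> qs b0 tl g hg; have [sz allk pw sub] := hblk s.
rewrite -sz; apply: (lower_form lm lam0 (n := (#|s| %/ q)%N) (D := D)); rewrite ?sz //.
- by rewrite divn_gt0.
- exact: block_size_le.
- move: b0; rewrite /bad_blocks; case: ltP => // _ /eqP.
  by rewrite oner_eq0.
- exact: le_trans Edelta delta_lam.
Qed.

(** The event on which the residual is controlled. It consults the points of s only, so that cutting
    off by it preserves independence from the points outside s. *)
Definition good (s : {set 'I_N}) (zs : 'I_N -> T) : R :=
  (#|s| == l)%:R * (1 - bad_on s zs) *
  \prod_(i < #|s|) ((tau D (subsample zs i) <= lam)%R : bool)%:R.

Lemma bad_blocks01 (s : {set 'I_N}) (zs : 'I_N -> T) : bad_on s zs = 0 \/ bad_on s zs = 1.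
Proof. by rewrite /bad_blocks; case: ltP; [right|left]. Qed.

Lemma goodP (s : {set 'I_N}) (zs : 'I_N -> T) : good s zs = 0 \/
  [/\ good s zs = 1, #|s| = l, bad_on s zs = 0
    & forall t, t \in s -> tau D (zs t).1 <= lam].
Proof.
rewrite /good; case: eqP => [sl|_]; last by left; rewrite !mul0r.
have [->|->] := bad_blocks01 s zs; last by left; rewrite subrr mulr0 mul0r.
rewrite subr0 !mul1r.
case: (boolP [forall i : 'I_#|s|, tau D (subsample zs i) <= lam]) => [/forallP h|].
  right; split=> //.
    by rewrite big1 // => i _; rewrite h.
  by move=> t ts; have := h (enum_rank_in ts t); rewrite /subsample enum_rankK_in.
by rewrite negb_forall => /existsP[i /negbTE h]; left; rewrite (bigD1 i) //= h mul0r.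
Qed.

Lemma good_ge0 s zs : 0 <= good s zs.
Proof. by case: (goodP s zs) => [->|[-> _ _ _]]. Qed.

Lemma good_sresid s zs : good s zs != 0 ->
  [/\ #|s|%:R^-1 * \sum_(t in s) sresid s zs (zs t).1 ^+ 2 +
      lam * \<sresid s zs, sresid s zs\> <= C * K &
      lnorm lam (sresid s zs) <= C * (C * K)].
Proof.
case: (goodP s zs) => [->|[-> sl b0 tl] _]; first by rewrite eqxx.
have qs : (q <= #|s|)%N by rewrite sl.
have low := lower_on qs b0 tl.
have s0 : (0 < #|s|)%N := leq_trans q0 qs.
split; first exact: (resid_bound lm fv lam0 lower_const_ge1 K0 s0 low dual).
exact: (resid_lnorm lm fv lam0 lower_const_ge1 K0 s0 low dual).
Qed.

Lemma measurable_good d' (W : measurableType d') (s : {set 'I_N}) (zs : 'I_N -> W -> T) :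
  (forall t, t \in s -> measurable_fun setT (zs t)) ->
  measurable_fun setT (fun w => good s (zs^~ w)).
Proof.
move=> mz; apply: measurable_funM.
  apply: measurable_funM; first exact: measurable_cst.
  apply: measurable_funB; first exact: measurable_cst.
  apply: measurable_bad_blocks.
  - exact: (measurable_feature lm).
  - exact: (feature_cov01 Q e lam0).
  - move=> t /hasP[B Bs tB]; apply: mz; have [_ _ _ /allP/(_ _ Bs)] := hblk s.
    by move/fintype.subsetP; exact.
apply: measurable_prod => i _; apply: measurable_boolR.
apply: measurable_fun_ler; last exact: measurable_cst.
apply: measurableT_comp (measurable_tau lm D) _.
by apply: measurableT_comp measurable_fst _; apply: mz; exact: enum_valP.
Qed.

(** Products of two residual coordinates, cut off to be bounded and independent of each point
    outside s, as [sampling_indep] requires. *)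
Definition pair_weight (s : {set 'I_N}) a c w : R :=
  indS R S s w * (good s (Z^~ w) *
    (coef (sresid s (Z^~ w)) a * coef (sresid s (Z^~ w)) c)).

Lemma CK_ge0 : 0 <= C * K.
Proof. by rewrite mulr_ge0 // (le_trans ler01) // lower_const_ge1. Qed.

Lemma sresid_norm s zs : good s zs != 0 ->
  \<sresid s zs, sresid s zs\> <= C * K / lam.
Proof.
move=> /good_sresid[h _]; rewrite ler_pdivlMr // mulrC; apply: le_trans h.
rewrite lerDr mulr_ge0 ?invr_ge0 //; apply: sumr_ge0 => t _; exact: sqr_ge0.
Qed.

Lemma pair_weight_bd s a c w : (a < D)%N -> (c < D)%N ->
  `|pair_weight s a c w| <= C * K / lam.
Proof.
move=> aD cD; have CK0 : 0 <= C * K / lam by rewrite divr_ge0 ?CK_ge0 ?ltW.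
rewrite /pair_weight 2!normrM (ger0_norm (indS_ge0 _ _ _ _)) (ger0_norm (good_ge0 _ _)) normrM.
have [->|gn] := eqVneq (good s (Z^~ w)) 0; first by rewrite mul0r mulr0.
have g1 : good s (Z^~ w) = 1.
  by case: (goodP s (Z^~ w)) gn => [->|[-> _ _ _]]; rewrite ?eqxx.
rewrite g1 mul1r -[leRHS]mul1r; apply: ler_pM; rewrite ?indS_ge0 ?indS_le1 ?mulr_ge0 //.
apply: le_trans (sresid_norm gn).
have vu := vec_sresid lm lam fv s (Z^~ w).
have single b : (b < D)%N -> coef (sresid s (Z^~ w)) b ^+ 2 <= \<sresid s (Z^~ w), sresid s (Z^~ w)\>.
  move=> bD; apply: le_trans (sum_coef_le lm D vu).
  by rewrite (bigD1 (Ordinal bD)) //= lerDl sumr_ge0 // => i _; exact: sqr_ge0.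
have := single _ aD; have := single _ cD.
rewrite -(real_normK (num_real (coef _ a))) -(real_normK (num_real (coef _ c))).
move: `|coef _ a| `|coef _ c| \<_, _\> => x y z h1 h2.
by have := sqr_ge0 (x - y); rewrite sqrrB; lra.
Qed.

Lemma measurable_pair_weight t (s : {set 'I_N}) a c : t \notin s ->
  measurable_fun setT (pair_weight s a c : g_sigma_algebraType (others Z S t) -> R).
Proof.
move=> ts; have mz t' : t' \in s ->
    measurable_fun setT (Z t' : g_sigma_algebraType (others Z S t) -> T).
  by move=> t's; apply: others_Z; apply: contraNneq ts => <-.
apply: measurable_funM; first exact: others_indS.
apply: measurable_funM; first exact: (measurable_good (W := g_sigma_algebraType (others Z S t))).
by apply: measurable_funM;
  exact: (measurable_coef_sresid lm fv lam0 (W := g_sigma_algebraType (others Z S t))).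
Qed.

(* The residual depends on the points of the subsample s only, so that its square
   at a point t outside s is a sum of products of independent factors. *)
Definition outside (s : {set 'I_N}) (t : 'I_N) w : R :=
  \sum_(a < D) \sum_(c < D) (e a (Z t w).1 * e c (Z t w).1) * pair_weight s a c w.

Lemma outsideE (s : {set 'I_N}) t w : outside s t w =
  indS R S s w * (good s (Z^~ w) * synth e (coef (sresid s (Z^~ w))) D (Z t w).1 ^+ 2).
Proof.
rewrite (synthE e) expr2 mulr_suml !mulr_sumr; apply: eq_bigr => a _.
rewrite !mulr_sumr; apply: eq_bigr => c _; rewrite /pair_weight.
move: (indS _ _ _ _) (good _ _) (coef _ _) (coef _ _) => p1 p2 p3 p4.
by move: (e a _ : R) (e c _ : R) => p5 p6; ring.
Qed.

Lemma integr_indS (s : {set 'I_N}) : integr P (indS R S s).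
Proof.
apply: (@integr_bdd _ _ _ _ _ 1) => [|w]; first exact: (measurable_indS hZS).
by rewrite ger0_norm ?indS_ge0 ?indS_le1.
Qed.

(** At the fresh point, e_a e_c is replaced by its mean, which vanishes for a != c and is mu_a for a
    = c. The double sum collapses to the L^2 norm of the truncated residual, bounded where [good] is
    nonzero. *)
Lemma Ex_outside (s : {set 'I_N}) t : t \notin s ->
  integr P (outside s t) /\ Ex P (outside s t) <= C * (C * K) * Ex P (indS R S s).
Proof.
move=> ts.
have ipw (a c : 'I_D) : integr P (pair_weight s a c).
  apply: (integr_bdd _ (C := C * K / lam)).
    by apply: (measurable_others hZS (t := t)); exact: measurable_pair_weight.
  by move=> w; exact: pair_weight_bd.
have h (a c : 'I_D) := sampling_indep hZS (integr_vecM lm (evec a) (evec c))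
  (measurable_pair_weight a c ts) (ipw a c).
have ia (a : 'I_D) : integr P (fun w => \sum_(c < D)
    (e a (Z t w).1 * e c (Z t w).1) * pair_weight s a c w).
  by apply: integr_sum => c _; case: (h a c).
split; first by apply: integr_sum => a _.
rewrite Ex_sum => [|a _]; last exact: ia.
have Ea (a : 'I_D) : Ex P (fun w => \sum_(c < D)
    (e a (Z t w).1 * e c (Z t w).1) * pair_weight s a c w) =
    Ex P (fun w => mu a * pair_weight s a a w).
  rewrite Ex_sum => [|c _]; last by case: (h a c).
  rewrite (bigD1 a) //= big1 ?addr0 => [|c ca].
    have [_ ->] := h a a; rewrite (lm_cov lm) // (mu_idem lm).
    by rewrite ExZ.
  have [_ ->] := h a c; rewrite (lm_cov lm) //.
  by rewrite (frame_orth fr) ?mulr0 ?mul0r //; rewrite eq_sym.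
rewrite (eq_bigr _ (fun a _ => Ea a)) -Ex_sum => [|a _]; last exact: integrZ.
rewrite -ExZ; last exact: integr_indS.
apply: Ex_le => [||w].
- by apply: integr_sum => a _; exact: integrZ.
- by apply: integrZ; exact: integr_indS.
have -> : \sum_(a < D) mu a * pair_weight s a a w = indS R S s w * (good s (Z^~ w) *
    \sum_(a < D) mu a * coef (sresid s (Z^~ w)) a ^+ 2).
  by rewrite !mulr_sumr; apply: eq_bigr => a _; rewrite /pair_weight; ring.
rewrite mulrC ler_wpM2r ?indS_ge0 //.
have [->|gn] := eqVneq (good s (Z^~ w)) 0.
  by rewrite mul0r mulr_ge0 ?CK_ge0 // (le_trans ler01) // lower_const_ge1.
have -> : good s (Z^~ w) = 1.
  by case: (goodP s (Z^~ w)) gn => [->|[-> _ _ _]]; rewrite ?eqxx.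
rewrite mul1r; have [_ h2] := good_sresid gn; apply: le_trans h2.
have vu := vec_sresid lm lam fv s (Z^~ w).
apply: le_trans (sum_mu_coef_le lm D vu) _.
by rewrite /lnorm lerDl mulr_ge0 ?(ltW lam0) // (dot_ge0 ipH).
Qed.

Lemma sum_indS w : \sum_s indS R S s w = 1.
Proof.
rewrite (bigD1 (S w)) //= /indS eqxx big1 ?addr0 // => s.
by rewrite eq_sym => /negbTE ->.
Qed.

Lemma sum_Ex_indS : \sum_s Ex P (indS R S s) = 1.
Proof.
rewrite -Ex_sum => [|s _]; last exact: integr_indS.
by rewrite -[RHS](Ex_cst P); apply: eq_Ex => w; exact: sum_indS.
Qed.

(** [C * K] pays for the points of the subsample, [outside] for the truncated residual at the
    others, and [tau] for its tail there. The sum runs over all possible subsamples; [indS] inside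
    [outside] selects the actual one. *)
Definition resid_energy w : R := C * K + N%:R^-1 *
  (2 * \sum_(s : {set 'I_N}) \sum_(t | t \notin s) outside s t w +
   2 * (C * K / lam) * \sum_t tau D (Z t w).1).

Let N0 : (0 < N)%N := leq_trans q0 (leq_trans ql lN).
Let NR : 0 < N%:R :> R. Proof. by rewrite ltr0n. Qed.

Lemma outside_ge0 (s : {set 'I_N}) t w : 0 <= outside s t w.
Proof.
rewrite outsideE; apply: mulr_ge0; first exact: indS_ge0.
by apply: mulr_ge0; [exact: good_ge0|exact: sqr_ge0].
Qed.

Lemma resid_energy_ge0 w : 0 <= resid_energy w.
Proof.
rewrite addr_ge0 ?CK_ge0 // mulr_ge0 ?invr_ge0 // addr_ge0 //.
  rewrite mulr_ge0 //; apply: sumr_ge0 => s _; apply: sumr_ge0 => t _.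
  exact: outside_ge0.
rewrite mulr_ge0 //; first by rewrite mulr_ge0 // divr_ge0 ?CK_ge0 ?ltW.
by apply: sumr_ge0 => t _; exact: (tau_ge0 lm).
Qed.

Lemma resid_energyP w : good (S w) (Z^~ w) != 0 ->
  emp (Z^~ w) (sresid (S w) (Z^~ w)) (sresid (S w) (Z^~ w)) <= resid_energy w.
Proof.
set s := S w; set u := sresid s _ => gn.
have [h1 _] := good_sresid gn; have h2 := sresid_norm gn.
have vu : vec u := vec_sresid lm lam fv s (Z^~ w).
have [sl g1] : #|s| = l /\ good s (Z^~ w) = 1.
  by case: (goodP s (Z^~ w)) gn => [->|[-> -> _ _]]; rewrite ?eqxx.
have sN : (#|s|%:R : R) <= N%:R by rewrite ler_nat sl.
have sR : 0 < #|s|%:R :> R by rewrite ltr0n sl; exact: leq_trans q0 ql.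
rewrite /emp (bigID (fun t => t \in s)) /= mulrDr; apply: lerD.
  apply: le_trans h1; rewrite -/u -[leLHS]addr0; apply: lerD; last first.
    by rewrite mulr_ge0 ?(ltW lam0) ?(dot_ge0 ipH).
  under eq_bigr do rewrite -expr2.
  rewrite ler_wpM2r ?lef_pV2 ?posrE //.
  by apply: sumr_ge0 => t _; exact: sqr_ge0.
rewrite ler_wpM2l ?invr_ge0 //.
apply: (@le_trans _ _ (\sum_(t | t \notin s) (2 * outside s t w +
   2 * (C * K / lam) * tau D (Z t w).1))).
  apply: ler_sum => t ts; rewrite outsideE g1 /indS eqxx !mul1r -expr2.
  rewrite {1}(tail_decomp H e D u) fctE.
  have := sqr_tail_le lm D (Z t w).1 vu.
  have := ler_wpM2l (tau_ge0 lm D (Z t w).1) (le_trans (dot_tail_le lm D vu) h2).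
  move: (tau D _) (C * K / lam) (tail D u _ : R) (synth e _ _ _ : R) \<_, _\> => p1 p2 p3 p4 p5 i1 i2.
  by have := sqr_ge0 (p4 - p3); rewrite sqrrB sqrrD; lra.
rewrite big_split /= -!mulr_sumr; apply: lerD.
  rewrite ler_wpM2l // (bigD1 s) //= lerDl; apply: sumr_ge0 => s' _.
  by apply: sumr_ge0 => t _; exact: outside_ge0.
rewrite ler_wpM2l //; first by rewrite mulr_ge0 // divr_ge0 ?CK_ge0 ?ltW.
rewrite [leRHS](bigID (fun t => t \in s)) /= lerDr; apply: sumr_ge0 => t _.
exact: (tau_ge0 lm).
Qed.

Lemma integr_tauZ t : integr P (fun w => tau D (Z t w).1).
Proof. exact: (integr_sample hZS t (integr_tau lm D)). Qed.

Lemma Ex_sum_tau : Ex P (fun w => \sum_t tau D (Z t w).1) <= N%:R * delta.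
Proof.
rewrite Ex_sum => [|t _]; last exact: integr_tauZ.
apply: (@le_trans _ _ (\sum_(t < N) delta)).
  by apply: ler_sum => t _; rewrite (Ex_sample hZS t (integr_tau lm D)).
by rewrite sumr_const card_ord mulr_natl.
Qed.

Lemma Ex_resid_energy : integr P resid_energy /\
  Ex P resid_energy <= 3 * (C * K) + 2 * (C * (C * K)).
Proof.
have i1 : integr P (fun w => 2 * \sum_(s : {set 'I_N}) \sum_(t | t \notin s) outside s t w).
  apply: integrZ; apply: integr_sum => s _; apply: integr_sum => t ts.
  by case: (Ex_outside ts).
have i2 : integr P (fun w => \sum_t tau D (Z t w).1).
  by apply: integr_sum => t _; exact: integr_tauZ.
have i2' := integrZ (2 * (C * K / lam)) i2.
have i3 := integrZ N%:R^-1 (integrD i1 i2').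
split; first by apply: integrD i3; exact: integr_cst.
rewrite ExD //; last exact: integr_cst.
rewrite Ex_cst ExZ; last exact: integrD.
rewrite ExD // (ExZ _ i2).
have b1 : Ex P (fun w => 2 * \sum_(s : {set 'I_N}) \sum_(t | t \notin s) outside s t w) <=
    N%:R * (2 * (C * (C * K))).
  rewrite ExZ; last first.
    apply: integr_sum => s _; apply: integr_sum => t ts; by case: (Ex_outside ts).
  rewrite mulrCA ler_wpM2l // Ex_sum => [|s _]; last first.
    by apply: integr_sum => t ts; case: (Ex_outside ts).
  rewrite -[leRHS]mulr1 -[X in _ <= _ * X]sum_Ex_indS mulr_sumr; apply: ler_sum => s _.
  rewrite Ex_sum => [|t ts]; last by case: (Ex_outside ts).
  apply: (@le_trans _ _ (\sum_(t | t \notin s) C * (C * K) * Ex P (indS R S s))).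
    by apply: ler_sum => t ts; case: (Ex_outside ts).
  rewrite sumr_const -[_ *+ _]mulr_natl -[leRHS]mulrA ler_wpM2r //.
    have C0 : 0 <= C by rewrite (le_trans ler01) // lower_const_ge1.
    by rewrite !mulr_ge0 // Ex_ge0 // => w; exact: indS_ge0.
  by rewrite ler_nat -[X in (_ <= X)%N](card_ord N) max_card.
have b2 : 2 * (C * K / lam) * Ex P (fun w => \sum_t tau D (Z t w).1) <= N%:R * (2 * (C * K)).
  apply: (@le_trans _ _ (2 * (C * K / lam) * (N%:R * lam))).
    rewrite ler_wpM2l //; first by rewrite mulr_ge0 // divr_ge0 ?CK_ge0 ?ltW.
    by apply: (le_trans Ex_sum_tau); rewrite ler_wpM2l.
  rewrite le_eqVlt; apply/orP; left; apply/eqP; field.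
  by rewrite gt_eqF.
have : N%:R^-1 * (Ex P (fun w => 2 * \sum_(s : {set 'I_N}) \sum_(t | t \notin s) outside s t w) +
    2 * (C * K / lam) * Ex P (fun w => \sum_t tau D (Z t w).1)) <=
    2 * (C * (C * K)) + 2 * (C * K).
  by rewrite -(ler_pM2l NR) mulVKf ?gt_eqF //; lra.
by lra.
Qed.

Hypothesis hS : forall s : {set 'I_N}, #|s| != l -> Ex P (indS R S s) = 0.

(** A sum that is at least 1 on the exceptional event, so that the union bound and Markov's
    inequality reduce to linearity. The lower bound may fail on the subsample or on the full sample;
    the last term covers points with [tau] above lam. *)
Definition bad w : R :=
  \sum_(s : {set 'I_N}) ((#|s| != l)%:R * indS R S s w +
          (#|s| == l)%:R * (indS R S s w * bad_on s (Z^~ w))) +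
  \sum_(s : {set 'I_N}) (indS R S s w * bad_on [set: 'I_N]%SET (Z^~ w)) +
  lam^-1 * \sum_t tau D (Z t w).1.

Lemma bad_blocks_ge0 (s : {set 'I_N}) (zs : 'I_N -> T) : 0 <= bad_on s zs.
Proof. by case: (bad_blocks01 s zs) => ->. Qed.

Let bad3 w : [/\ 0 <= \sum_(s : {set 'I_N}) ((#|s| != l)%:R * indS R S s w +
          (#|s| == l)%:R * (indS R S s w * bad_on s (Z^~ w))),
    0 <= \sum_(s : {set 'I_N}) (indS R S s w * bad_on [set: 'I_N]%SET (Z^~ w)) &
    0 <= lam^-1 * \sum_t tau D (Z t w).1].
Proof.
split.
- apply: sumr_ge0 => s _; rewrite addr_ge0 ?mulr_ge0 ?indS_ge0 ?bad_blocks_ge0 //.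
- by apply: sumr_ge0 => s _; rewrite mulr_ge0 ?indS_ge0 ?bad_blocks_ge0.
- rewrite mulr_ge0 ?invr_ge0 ?(ltW lam0) //; apply: sumr_ge0 => t _.
  exact: (tau_ge0 lm).
Qed.

Lemma bad_ge0 w : 0 <= bad w.
Proof. by have [h1 h2 h3] := bad3 w; rewrite !addr_ge0. Qed.

Lemma add3_ge1 (a b c : R) : 0 <= a -> 0 <= b -> 0 <= c ->
  [\/ 1 <= a, 1 <= b | 1 <= c] -> 1 <= a + b + c.
Proof. by move=> a0 b0 c0 [] h; lra. Qed.

Lemma badP w : 1 <= bad w \/ [/\ #|S w| = l, bad_on (S w) (Z^~ w) = 0,
  bad_on [set: 'I_N]%SET (Z^~ w) = 0 & forall t, tau D (Z t w).1 <= lam].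
Proof.
have [h1 h2 h3] := bad3 w; rewrite /bad.
have pos1 (s : {set 'I_N}) : 0 <= (#|s| != l)%:R * indS R S s w +
          (#|s| == l)%:R * (indS R S s w * bad_on s (Z^~ w)).
  by rewrite addr_ge0 ?mulr_ge0 ?indS_ge0 ?bad_blocks_ge0.
have [b1|b1] := leP 1 (\sum_(s : {set 'I_N}) ((#|s| != l)%:R * indS R S s w +
          (#|s| == l)%:R * (indS R S s w * bad_on s (Z^~ w)))); first by left; apply: add3_ge1 => //; constructor 1.
have [b2|b2] := leP 1 (\sum_(s : {set 'I_N}) (indS R S s w * bad_on [set: 'I_N]%SET (Z^~ w))).
  by left; apply: add3_ge1 => //; constructor 2.
have [b3|b3] := leP 1 (lam^-1 * \sum_t tau D (Z t w).1).
  by left; apply: add3_ge1 => //; constructor 3.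
right; move: b1; rewrite (bigD1 (S w)) //= {1 2}/indS eqxx mulr1 mul1r.
set rest := \sum_(_ | _) _ => b1.
have r0 : 0 <= rest by apply: sumr_ge0 => s _; exact: pos1.
have [sl ] : #|S w| = l /\ bad_on (S w) (Z^~ w) < 1.
  move: b1; case: eqP => [sl|_] /=; last first.
    by rewrite ltNge mul0r addr0 lerDl r0.
  by rewrite mul1r add0r; split=> //; apply: le_lt_trans b1; rewrite lerDl.
case: (bad_blocks01 (S w) (Z^~ w)) => ->; rewrite ?ltxx // => _.
move: b2; rewrite -mulr_suml sum_indS mul1r.
case: (bad_blocks01 [set: 'I_N]%SET (Z^~ w)) => ->; rewrite ?ltxx // => _.
split=> // t; move: b3; rewrite mulrC ltr_pdivrMr // mul1r => /ltW; apply: le_trans.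
by rewrite (bigD1 t) //= lerDl; apply: sumr_ge0 => t' _; exact: (tau_ge0 lm).
Qed.

(** The 8 is twice the 4 of [bad_blocks_le], once for the subsample and once for the full sample;
    the last factor kap / lam bounds the trace. *)
Definition bad_prob : R :=
  8 * ((kap / lam / (l %/ q)%:R) ^+ q * (kap / lam)) + N%:R * delta / lam.

Lemma sum_feature_cov : \sum_i feature_cov Q e lam (D := D) i <= kap / lam.
Proof.
apply: (@le_trans _ _ (\sum_(i < D) mu i / lam)).
  apply: ler_sum => i _; rewrite /feature_cov ler_wpM2l ?mu_ge0 //.
  by rewrite lef_pV2 ?posrE ?lerDr ?mu_ge0 // ltr_wpDl ?mu_ge0.
rewrite -mulr_suml ler_wpM2r ?invr_ge0 ?(ltW lam0) //.
rewrite -(Ex_cst Q kap) -Ex_sum => [|i _]; last exact: (integr_vec2 lm).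
apply: Ex_le => [||z]; last exact: (sum_e2_le lm).
  by apply: integr_sum => i _; exact: (integr_vec2 lm).
exact: integr_cst.
Qed.

Lemma integr_bad_on (s s' : {set 'I_N}) : integr P (fun w => indS R S s w * bad_on s' (Z^~ w)).
Proof.
apply: (integr_bdd _ (C := 1)).
  apply: measurable_funM; first exact: (measurable_indS hZS).
  apply: measurable_bad_blocks => [||t _].
  - exact: (measurable_feature lm).
  - exact: (feature_cov01 Q e lam0).
  - exact: (sampling_Z hZS).
move=> w; rewrite ger0_norm ?mulr_ge0 ?indS_ge0 ?bad_blocks_ge0 // -[leRHS]mulr1.
apply: ler_pM; rewrite ?indS_ge0 ?indS_le1 ?bad_blocks_ge0 //.
by case: (bad_blocks01 s' (Z^~ w)) => ->.
Qed.

Lemma Ex_bad_on (s s' : {set 'I_N}) : (l <= #|s'|)%N ->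
  Ex P (fun w => indS R S s w * bad_on s' (Z^~ w)) <=
  4 * ((kap / lam / (l %/ q)%:R) ^+ q * (kap / lam)) * Ex P (indS R S s).
Proof.
move=> ls; have [sz allk pw sub] := hblk s'.
have kl0 : 0 <= kap / lam by rewrite divr_ge0 ?(kap_ge0 lm) ?ltW.
have lq0 : (0 < l %/ q)%N by rewrite divn_gt0.
have sq0 : (0 < #|s'| %/ q)%N by rewrite divn_gt0 // (leq_trans ql).
have mf : measurable_mx (feature Q e D lam) by exact: (measurable_feature lm).
have := bad_blocks_le hZS mf (sqn_feature lm D lam0)
  (@feature_cov01 _ _ _ Q e D _ lam0) (@Ex_feature _ _ _ _ _ _ _ _ lm D _ lam0) s sq0 _ allk pw.
rewrite sz => /(_ q0) /le_trans; apply.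
rewrite ler_wpM2r ?Ex_ge0 //.
rewrite ler_wpM2l //; apply: ler_pM.
- by rewrite exprn_ge0 // divr_ge0.
- by apply: sumr_ge0 => i _; case/andP: (feature_cov01 Q e lam0 i).
- apply: lerXn2r; [by rewrite nnegrE divr_ge0|by rewrite nnegrE divr_ge0|].
  rewrite ler_wpM2l // lef_pV2 ?posrE ?ltr0n // ler_nat.
  exact: leq_div2r.
- exact: sum_feature_cov.
Qed.

Lemma Ex_bad : integr P bad /\ Ex P bad <= bad_prob.
Proof.
have i1 (s : {set 'I_N}) : integr P (fun w => (#|s| != l)%:R * indS R S s w).
  by apply: integrZ; exact: integr_indS.
have i2 (s : {set 'I_N}) : integr P (fun w => (#|s| == l)%:R * (indS R S s w * bad_on s (Z^~ w))).
  by apply: integrZ; exact: integr_bad_on.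
have i12 : integr P (fun w => \sum_(s : {set 'I_N}) ((#|s| != l)%:R * indS R S s w +
          (#|s| == l)%:R * (indS R S s w * bad_on s (Z^~ w)))).
  by apply: integr_sum => s _; exact: integrD.
have i3 : integr P (fun w => \sum_(s : {set 'I_N}) (indS R S s w * bad_on [set: 'I_N]%SET (Z^~ w))).
  by apply: integr_sum => s _; exact: integr_bad_on.
have i4 : integr P (fun w => \sum_t tau D (Z t w).1).
  by apply: integr_sum => t _; exact: integr_tauZ.
have i4' := integrZ lam^-1 i4.
split; first by apply: integrD i4'; exact: integrD.
rewrite ExD //; last exact: integrD.
rewrite ExD // ExZ //.
set B := 4 * ((kap / lam / (l %/ q)%:R) ^+ q * (kap / lam)).
have kl0 : 0 <= kap / lam by rewrite divr_ge0 ?(kap_ge0 lm) ?ltW.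
have B0 : 0 <= B by rewrite /B mulr_ge0 // mulr_ge0 // exprn_ge0 // divr_ge0.
have b1 : Ex P (fun w => \sum_(s : {set 'I_N}) ((#|s| != l)%:R * indS R S s w +
          (#|s| == l)%:R * (indS R S s w * bad_on s (Z^~ w)))) <= B.
  rewrite Ex_sum => [|s _]; last exact: integrD.
  rewrite -[leRHS]mulr1 -[X in _ <= _ * X]sum_Ex_indS mulr_sumr; apply: ler_sum => s _.
  rewrite ExD // ExZ; last exact: integr_indS.
  rewrite ExZ; last exact: integr_bad_on.
  case: eqP => [sl|/eqP nl] /=.
    by rewrite mul0r add0r mul1r; apply: Ex_bad_on; rewrite sl.
  rewrite mul1r mul0r addr0 hS // mulr_ge0 //.
have b2 : Ex P (fun w => \sum_(s : {set 'I_N}) (indS R S s w * bad_on [set: 'I_N]%SET (Z^~ w))) <= B.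
  rewrite Ex_sum => [|s _]; last exact: integr_bad_on.
  rewrite -[leRHS]mulr1 -[X in _ <= _ * X]sum_Ex_indS mulr_sumr; apply: ler_sum => s _.
  by apply: Ex_bad_on; rewrite cardsT card_ord.
have b3 : lam^-1 * Ex P (fun w => \sum_t tau D (Z t w).1) <= N%:R * delta / lam.
  by rewrite mulrC ler_wpM2r ?invr_ge0 ?(ltW lam0) //; exact: Ex_sum_tau.
by rewrite /bad_prob -/B; move: b1 b2; rewrite /B; lra.
Qed.

Context (sig2 s4 theta : R).
Let eps (z : T) : R := z.2 - f z.1.
Hypothesis noise_mean : forall g, vec g ->
  integr Q (fun z => eps z * g z.1) /\ Ex Q (fun z => eps z * g z.1) = 0.
Hypothesis sig2_ge0 : 0 <= sig2.
Hypothesis noise_var : forall phi : X -> R, measurable_fun setT phi ->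
  (exists B, forall x, 0 <= phi x <= B) ->
  integr Q (fun z => eps z ^+ 2 * phi z.1) /\
  Ex Q (fun z => eps z ^+ 2 * phi z.1) <= sig2 * Ex Q (fun z => phi z.1).
Hypothesis noise4 : integr Q (fun z => eps z ^+ 4) /\ Ex Q (fun z => eps z ^+ 4) <= s4.
Hypothesis theta0 : 0 < theta.

Local Notation err w := (nu2 (nystroem k (Z^~ w) (S w) lam - f)).

(* On the bad event the labels only bound the estimator; theta trades their fourth
   moment against the probability of that event. *)
Definition crude w : R :=
  2 * kap / lam * (2 * (theta * bad w +
     theta^-1 * (N%:R^-1 * \sum_t eps (Z t w) ^+ 4)) + 2 * kap * F * bad w) +
  2 * kap * F * bad w.

(** Both regimes are added instead of distinguished. The sum is integrable, and the error is only
    ever compared with it pointwise. *)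
Definition err_bound w : R :=
  34 * C ^+ 2 * (resid_energy w + K + noise_energy Q k e f lam D (Z^~ w)) + crude w.

Let F0 : 0 <= F. Proof. by apply: le_trans fF; exact: (dot_ge0 ipH). Qed.

Lemma crude_ge0 w : 0 <= crude w.
Proof.
have k0 := kap_ge0 lm; have b0 := bad_ge0 w.
have kF0 : 0 <= 2 * kap * F * bad w by rewrite mulr_ge0 // mulr_ge0 // mulr_ge0.
have e4 : 0 <= \sum_t eps (Z t w) ^+ 4.
  by apply: sumr_ge0 => t _; rewrite (exprM _ 2 2) sqr_ge0.
rewrite addr_ge0 // mulr_ge0 //; first by rewrite divr_ge0 ?mulr_ge0 // ltW.
rewrite addr_ge0 // mulr_ge0 // addr_ge0 //; first by rewrite mulr_ge0 // ltW.
by rewrite mulr_ge0 ?invr_ge0 ?mulr_ge0 ?invr_ge0 // ltW.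
Qed.

Lemma crude_le w : 1 <= bad w -> err w <= crude w.
Proof.
move=> b1; apply: le_trans (crude_bound lm fv (Z^~ w) (S w) lam0 N0) _.
have k0 := kap_ge0 lm.
have kF : 2 * kap * \<f, f\> <= 2 * kap * F * bad w.
  rewrite -[leLHS]mulr1; apply: ler_pM => //; rewrite ?mulr_ge0 ?(dot_ge0 ipH) //.
  by rewrite ler_wpM2l // mulr_ge0.
apply: lerD => //; rewrite ler_wpM2l ?divr_ge0 ?mulr_ge0 ?(ltW lam0) //.
rewrite -(ler_pM2l NR) mulVKf ?gt_eqF //.
apply: (@le_trans _ _ (\sum_(t < N) (2 * (theta * bad w +
    theta^-1 * eps (Z t w) ^+ 4) + 2 * kap * F * bad w))).
  apply: ler_sum => t _; have := sqr_eval_le lm (Z t w).1 fv.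
  have : kap * \<f, f\> <= kap * F * bad w.
    by move: kF; rewrite -!mulrA ler_pM2l.
  have : eps (Z t w) ^+ 2 <= theta * bad w + theta^-1 * eps (Z t w) ^+ 4.
    apply: (@le_trans _ _ (theta + theta^-1 * eps (Z t w) ^+ 4)); last first.
      by rewrite lerD2r ler_peMr // ltW.
    move: (eps _ ^+ 2) (eps (Z t w) ^+ 4) (exprM (eps (Z t w)) 2 2) => p p4 ->.
    rewrite -(ler_pM2l theta0) mulrDr mulVKf ?gt_eqF //.
    by have := sqr_ge0 (theta - p); have := sqr_ge0 theta; have := sqr_ge0 p; rewrite sqrrB expr2; lra.
  have -> : (Z t w).2 = eps (Z t w) + f (Z t w).1 :> R by rewrite /eps subrK.
  have -> : 2 * kap * F * bad w = 2 * (kap * F * bad w) by rewrite !mulrA.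
  move: (kap * \<f, f\>) (kap * F * bad w) (eps _) (f _ : R) (theta * bad w + _) => c2 c' a b c h1 h2 h3.
  by have := sqr_ge0 (a - b); rewrite sqrrB sqrrD; lra.
rewrite le_eqVlt; apply/orP; left; apply/eqP.
set c := 2 * kap * F * bad w; set b := theta * bad w.
have N1 : N%:R != 0 :> R by rewrite gt_eqF.
transitivity (N%:R * (2 * b + c) + 2 * (theta^-1 * \sum_t eps (Z t w) ^+ 4)).
  rewrite !mulr_sumr; transitivity (\sum_(t < N) ((2 * b + c) +
      2 * (theta^-1 * eps (Z t w) ^+ 4))); first by apply: eq_bigr => t _; ring.
  rewrite big_split /= sumr_const card_ord -[_ *+ N]mulr_natl; congr (_ + _).
clearbody b c; move: (\sum_t _) => E4; have t1 : theta != 0 by rewrite gt_eqF.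
by field; rewrite N1 t1.
Qed.

Lemma err_le w : err w <= err_bound w.
Proof.
have C0 : 0 <= 34 * C ^+ 2 by rewrite mulr_ge0 ?sqr_ge0.
have Y0 : 0 <= noise_energy Q k e f lam D (Z^~ w) by exact: (noise_energy_ge0 lm).
have U0 := resid_energy_ge0 w.
have main0 : 0 <= 34 * C ^+ 2 * (resid_energy w + K + noise_energy Q k e f lam D (Z^~ w)).
  by apply: mulr_ge0 => //; apply: addr_ge0 => //; exact: addr_ge0.
case: (badP w) => [/crude_le h|[sl b1 b2 tl]].
  by apply: le_trans h _; rewrite /err_bound lerDr.
apply: (@le_trans _ _ (34 * C ^+ 2 * (emp (Z^~ w) (sresid (S w) (Z^~ w))
    (sresid (S w) (Z^~ w)) + K + noise_energy Q k e f lam D (Z^~ w)))).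
  have qs : (q <= #|S w|)%N by rewrite sl.
  apply: (error_bound lm fv lam0 N0 lower_const_ge1 K0 Y0 (leq_trans q0 qs)) => //.
  - by apply: lower_on => // t _; exact: tl.
  - move=> g hg; have := @lower_on [set: 'I_N]%SET (Z^~ w) _ b2 _ g hg.
    rewrite cardsT card_ord => /(_ (leq_trans ql lN) (fun t _ => tl t)).
    rewrite /emp; congr (_ <= _ * (_ * _ + _)).
    by apply: eq_big => [t|t _]; rewrite ?inE ?expr2.
  - by move=> g hg; apply: (noise_energyP lm).
rewrite /err_bound -[leLHS]addr0; apply: lerD; last exact: crude_ge0.
rewrite ler_wpM2l // !lerD2r; apply: resid_energyP.
case: (goodP (S w) (Z^~ w)) => [|[-> _ _ _]]; last exact: oner_neq0.
rewrite /good (introT eqP sl) b1 subr0 !mul1r big1 => [/eqP|i _].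
  by rewrite oner_eq0.
by rewrite /subsample tl.
Qed.

Lemma local_bound :
  [/\ integr P err_bound, forall w, 0 <= err_bound w, forall w, err w <= err_bound w &
   Ex P err_bound <=
     34 * C ^+ 2 * (3 * (C * K) + 2 * (C * (C * K)) + K + 2 * sig2 *
       (N%:R^-1 * \sum_(i < D) mu i / (mu i + lam) + delta / lam)) +
     (2 * kap / lam * (2 * (theta * bad_prob + theta^-1 * s4) + 2 * kap * F * bad_prob) +
      2 * kap * F * bad_prob)].
Proof.
have C0 : 0 <= 34 * C ^+ 2 by rewrite mulr_ge0 ?sqr_ge0.
have k0 := kap_ge0 lm.
have [iU EU] := Ex_resid_energy; have [ib Eb] := Ex_bad.
have [iY EY] := Ex_noise_energy lm hZS lam0 noise_mean sig2_ge0 noise_var N0 Edelta.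
have i4 t : integr P (fun w => eps (Z t w) ^+ 4) by exact: (integr_sample hZS t noise4.1).
have i4s : integr P (fun w => \sum_t eps (Z t w) ^+ 4) by apply: integr_sum.
have i4N := integrZ N%:R^-1 i4s; have i4N' := integrZ theta^-1 i4N.
have E4 : Ex P (fun w => N%:R^-1 * \sum_t eps (Z t w) ^+ 4) <= s4.
  rewrite ExZ // -(ler_pM2l NR) mulVKf ?gt_eqF // Ex_sum //.
  apply: (@le_trans _ _ (\sum_(t < N) s4)).
    by apply: ler_sum => t _; rewrite (Ex_sample hZS t noise4.1) noise4.2.
  by rewrite sumr_const card_ord mulr_natl.
have ib1 := integrZ theta ib; have ib2 := integrZ (2 * kap * F) ib.
have i5 := integrZ 2 (integrD ib1 i4N').
have i6 := integrD i5 ib2; have i7 := integrZ (2 * kap / lam) i6.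
have i8 := integrD i7 ib2.
have i9 := integrD (integrD iU (integr_cst P K)) iY.
have i10 := integrZ (34 * C ^+ 2) i9.
have i11 : integr P err_bound := integrD i10 i8.
split=> //.
  move=> w; apply: addr_ge0; last exact: crude_ge0.
  apply: mulr_ge0 => //; apply: addr_ge0; last exact: (noise_energy_ge0 lm).
  by apply: addr_ge0 => //; exact: resid_energy_ge0.
  exact: err_le.
have -> : Ex P err_bound = Ex P (fun w => 34 * C ^+ 2 *
    (resid_energy w + K + noise_energy Q k e f lam D (Z^~ w))) + Ex P crude := ExD i10 i8.
apply: lerD.
  rewrite (ExZ _ i9) ler_wpM2l // (ExD (integrD iU (integr_cst P K)) iY).
  by rewrite (ExD iU (integr_cst P K)) Ex_cst; apply: lerD => //; apply: lerD.
have -> : Ex P crude = 2 * kap / lam * (2 * (theta * Ex P bad + theta^-1 *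
    Ex P (fun w => N%:R^-1 * \sum_t eps (Z t w) ^+ 4)) + 2 * kap * F * Ex P bad) +
    2 * kap * F * Ex P bad.
  apply: (etrans (ExD i7 ib2)).
  by rewrite (ExZ _ i6) (ExD i5 ib2) (ExZ _ (integrD ib1 i4N')) (ExD ib1 i4N') !(ExZ _ ib) (ExZ _ i4N).
have mono c : 0 <= c -> c * Ex P bad <= c * bad_prob by move=> c0; rewrite ler_wpM2l.
have kF0 : 0 <= 2 * kap * F by rewrite !mulr_ge0.
apply: lerD; last exact: mono.
rewrite ler_wpM2l ?divr_ge0 ?mulr_ge0 ?(ltW lam0) //; apply: lerD; last exact: mono.
rewrite ler_wpM2l //; apply: lerD; first by apply: mono; exact: ltW.
by rewrite ler_wpM2l // invr_ge0 ltW.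
Qed.

End LocalBound.

Lemma ex_blocks N q : exists blk : {set 'I_N} -> seq {set 'I_N}, forall s,
  [/\ size (blk s) = q,
  all (fun B : {set 'I_N} => #|B| == #|s| %/ q)%N (blk s),
  pairwise (fun A B : {set 'I_N} => disjoint (mem A) (mem B)) (blk s)
  & all (fun B : {set 'I_N} => B \subset s) (blk s)].
Proof.
have : forall s : {set 'I_N}, exists bs : seq {set 'I_N}, [/\ size bs = q,
  all (fun B : {set 'I_N} => #|B| == #|s| %/ q)%N bs,
  pairwise (fun A B : {set 'I_N} => disjoint (mem A) (mem B)) bs
  & all (fun B : {set 'I_N} => B \subset s) bs].
  by move=> s; apply: disjoint_blocks; rewrite mulnC leq_trunc_div.
by move=> /choice[blk hblk]; exists blk.
Qed.

(** * Disintegration and excess risk *)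

Section Restriction.
Context (R : realType) d (T : measurableType d).
Context (m : {measure set T -> \bar R}) (D : set T) (mD : measurable D).

Lemma integral_mrestr (F : T -> \bar R) : measurable_fun setT F ->
  (forall t, 0 <= F t)%E ->
  (\int[mrestr m mD]_t F t = \int[m]_(t in D) F t)%E.
Proof.
move=> mF F0.
have mFA A : measurable_fun A F by exact: measurable_funTS.
rewrite -(setUv D) ge0_integral_setU //; last 2 first.
- exact: measurableC.
- exact/disj_setPCl.
rewrite [X in (_ + X)%E](_ : _ = 0%E) ?adde0; last first.
  rewrite null_set_integral //; first exact: measurableC.
  suff : m (~` D `&` D) = 0%E by [].
  by rewrite setICl measure0.
apply: eq_measure_integral => A mA AD.
suff : m (A `&` D) = m A by [].
by rewrite setIidl.
Qed.

Lemma integral_mscale_mrestr (c : {nonneg R}) (F : T -> \bar R) : measurable_fun setT F ->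
  (forall t, 0 <= F t)%E ->
  (\int[mscale c (mrestr m mD)]_t F t = c%:num%:E * \int[m]_(t in D) F t)%E.
Proof.
by move=> mF F0; rewrite ge0_integral_mscale // integral_mrestr.
Qed.

End Restriction.

Section KernelLaw.
Context (R : realType) d d' (X : measurableType d) (Y : measurableType d').
Context (rhoc : R.-pker X ~> Y).

(** A name for the conditional law to which the structure of a probability can be attached. *)
Definition kernel_law (x : X) : set Y -> \bar R := rhoc x.
HB.instance Definition _ x := Measure.on (kernel_law x).
HB.instance Definition _ x :=
  Measure_isProbability.Build _ _ _ (kernel_law x) (prob_kernel x).

Definition section_fun (x : X) (y : Y) : X * Y := (x, y).

Lemma measurable_section_fun x : measurable_fun setT (section_fun x).
Proof. by apply: measurable_fun_pair. Qed.

HB.instance Definition _ x :=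
  isMeasurableFun.Build _ _ _ _ (section_fun x) (measurable_section_fun x).

(** The law of (x, y) with y drawn given x. The [unit] factor is the shape demanded by the
    composition of kernels. *)
Definition graph_kernel (p : unit * X) : {measure set (X * Y) -> \bar R} :=
  distribution (kernel_law p.2) (section_fun p.2).

Lemma measurable_graph_kernel U : measurable U ->
  measurable_fun setT (graph_kernel ^~ U).
Proof.
move=> mU; pose h (x : X) := rhoc x (xsection U x).
have -> : graph_kernel ^~ U = h \o snd.
  apply/funext => -[t x]; rewrite /h /graph_kernel /=; congr (rhoc x _).
  by apply/seteqP; split => y; rewrite /xsection /= inE.
apply: (@measurableT_comp _ _ _ _ _ _ h) => //.
by apply: measurable_fun_xsection_finite_kernel; rewrite inE.
Qed.

HB.instance Definition _ :=
  isKernel.Build _ _ _ _ _ graph_kernel measurable_graph_kernel.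

Lemma graph_kernel_prob p : graph_kernel p setT = 1%E.
Proof. exact: (prob_kernel (s := rhoc) p.2). Qed.

HB.instance Definition _ :=
  Kernel_isProbability.Build _ _ _ _ _ graph_kernel graph_kernel_prob.

End KernelLaw.

Section Disintegration.
Context (R : realType) d (X : measurableType d).
Local Notation Y := (measurableTypeR R).
Local Notation T := (X * Y)%type.
Context (rhoc : R.-pker X ~> Y).

Definition disintegrates (Q : set T -> \bar R) (nu : set X -> \bar R) : Prop :=
  forall F : T -> \bar R, (forall z, 0 <= F z)%E -> measurable_fun setT F ->
    (\int[Q]_z F z = \int[nu]_x \int[rhoc x]_y F (x, y))%E.

Lemma measurable_kint (F : T -> \bar R) : (forall z, 0 <= F z)%E -> measurable_fun setT F ->
  measurable_fun setT (fun x => \int[rhoc x]_y F (x, y))%E.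
Proof. exact: measurable_fun_integral_finite_kernel. Qed.

(** The hypothesis is agreement on measurable rectangles, a pi-system, between rho and the
    composition of the marginal with [graph_kernel]. *)
Lemma disintegrates_conditional (rho : probability T R) :
  is_conditional rho rhoc -> disintegrates rho (marginal rho).
Proof.
move=> cond F F0 mF.
pose fstm : {mfun T >-> X} :=
  HB.pack (fst : T -> X) (isMeasurableFun.Build _ _ _ _ _ (@measurable_fst _ _ X Y)).
pose nu : pprobability X R := distribution rho fstm.
have mnu : measurable_fun setT (fun _ : unit => nu) by exact: measurable_cst.
have key : (\int[kcomp (kprobability mnu) (graph_kernel rhoc) tt]_z F z =
    \int[nu]_x \int[rhoc x]_y F (x, y))%E.
  rewrite integral_kcomp //; apply: eq_integral => x _.
  by rewrite ge0_integral_distribution.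
rewrite -[RHS]key; apply: eq_measure_integral => A mA _.
rewrite measurable_prod_measurableType in mA.
apply: (g_sigma_algebra_measure_unique
  [set A `*` B | A in measurable & B in measurable] _ (fun=> setT)) => //.
- by move=> _ [A1 mA1 [B1 mB1 <-]]; exact: measurableX.
- by move=> _; exists setT => //; exists setT => //; rewrite setXTT.
- by rewrite bigcup_const //; exists 0%N.
- move=> _ _ [X1 mX1 [X2 mX2 <-]] [Y1 mY1 [Y2 mY2 <-]].
  exists (X1 `&` Y1); first exact: measurableI.
  by exists (X2 `&` Y2); [exact: measurableI|rewrite setXI].
- move=> _ [B mB [C mC <-]]; apply: (etrans (cond B C mB mC)).
  rewrite integral_mkcond.
  apply: eq_integral => x _; rewrite patchE.
  suff : (if x \in B then rhoc x C else 0%E) = rhoc x (section_fun x @^-1` (B `*` C)) by [].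
  case: (boolP (x \in B)) => [|/negP]; rewrite inE => xB.
    by congr (rhoc x _); apply/seteqP; split => y //= [].
  rewrite (_ : _ @^-1` _ = set0) ?measure0 //.
  by apply/seteqP; split => y // -[].
- by move=> _; rewrite -ge0_fin_numE // fin_num_measure.
Qed.

Lemma disintegrates_local (rho : probability T R) (L : localization R X)
    (j : 'I_(nloc L)) :
  is_conditional rho rhoc -> partition_assumption rho L ->
  disintegrates (local_law rho j) (local_marginal rho j).
Proof.
move=> /disintegrates_conditional dis [_ mpart w0] F F0 mF.
have mD : measurable (part j `*` [set: Y]) by apply: measurableX => //; exact: mpart.
have c0 : 0 <= (weight rho j)^-1 by rewrite invr_ge0 ltW.
pose fstm : {mfun T >-> X} :=
  HB.pack (fst : T -> X) (isMeasurableFun.Build _ _ _ _ _ (@measurable_fst _ _ X Y)).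
pose nu : probability X R := distribution rho fstm.
have -> : local_law rho j = mscale (NngNum c0) (mrestr rho mD) by [].
have -> : local_marginal rho j = mscale (NngNum c0) (mrestr nu (mpart j)) by [].
have mk := measurable_kint F0 mF.
rewrite !integral_mscale_mrestr //; last by move=> x; exact: integral_ge0.
congr (_ * _)%E; rewrite integral_mkcond [RHS]integral_mkcond dis; last 2 first.
- by move=> z; rewrite patchE; case: ifP.
- by apply/(measurable_restrictT _ _).1 => //; exact: measurable_funTS.
congr (integral _ _ _); apply/funext => x; rewrite [RHS]patchE.
case: (boolP (x \in part j)) => [|/negP]; rewrite inE => xj.
  by apply: eq_integral => y _; rewrite patchE mem_set.
rewrite -[RHS](@integral0 _ _ R (rhoc x) setT); apply: eq_integral => y _.
by rewrite patchE memNset // => -[].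
Qed.

End Disintegration.

Lemma integral_probability_cst (R : realType) d (U : measurableType d)
    (P : probability U R) (c : \bar R) : (\int[P]_x c = c)%E.
Proof.
apply: (etrans (integral_cst P measurableT c)).
by rewrite -[X in (_ * X)%E = _]/(P setT) probability_setT mule1.
Qed.

(** * Conditional moments of the noise and the excess risk *)

Section ConditionalNoise.
Context (R : realType) d (X : measurableType d).
Local Notation Y := (measurableTypeR R).
Local Notation T := (X * Y)%type.
Context (rhoc : R.-pker X ~> Y) (Q : probability T R) (nu : probability X R).
Hypothesis dis : disintegrates rhoc Q nu.
Context (f : X -> R) (B sig2 s4 : R).
Hypotheses (mf : measurable_fun setT f) (fB : forall x, `|f x| <= B).
Hypothesis hf : {ae nu, forall x, regression rhoc x = f x}.
Hypothesis noise2 : {ae nu, forall x,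
  (\int[rhoc x]_y ((`|y - regression rhoc x| ^+ 2)%R)%:E <= sig2%:E)%E}.
Hypothesis noise4 : {ae nu, forall x,
  (\int[rhoc x]_y ((`|y - regression rhoc x| ^+ 4)%R)%:E <= s4%:E)%E}.
Let eps (z : T) : R := z.2 - f z.1.

(** The second moment makes y integrable under the conditional law at x, so that [regression] is a
    genuine mean there. *)
Lemma kernel_mean x (c : R) : regression rhoc x = f x ->
  (\int[rhoc x]_y ((`|y - regression rhoc x| ^+ 2)%R)%:E <= c%:E)%E ->
  integr (kernel_law rhoc x) (fun y : Y => y - f x : R) /\
  Ex (kernel_law rhoc x) (fun y : Y => y - f x : R) = 0.
Proof.
move=> mx; rewrite mx => le2.
have my : measurable_fun setT (fun y : Y => y - f x : R).
  by apply: measurable_funB; [exact: measurable_id|exact: measurable_cst].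
have E2 (y : Y) : `|y - f x| ^+ 2 = (y - f x) ^+ 2 :> R by rewrite real_normK // num_real.
have [i2 _] : integr (kernel_law rhoc x) (fun y : Y => (y - f x) ^+ 2 : R) /\
    Ex (kernel_law rhoc x) (fun y : Y => (y - f x) ^+ 2 : R) <= c.
  apply: integr_bdd_ge0 => [|y|]; [exact: measurable_funX|exact: sqr_ge0|].
  by apply: le_trans le2; under [leRHS]eq_integral do rewrite E2.
have i1 : integr (kernel_law rhoc x) (fun y : Y => y - f x : R).
  apply: integr_le my _ (integrD (integr_cst _ 1) i2) => y.
  rewrite -E2; move: `|_| => t.
  by have := sqr_ge0 (t - 1); have := sqr_ge0 t; rewrite sqrrB !expr2; lra.
split=> //.
have iy : integr (kernel_law rhoc x) (fun y : Y => y : R).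
  by apply: eq_integr (integrD i1 (integr_cst _ (f x))) => y; rewrite subrK.
rewrite (ExB iy (integr_cst _ _)) Ex_cst.
by rewrite -mx /regression subrr.
Qed.

Lemma measurable_eps : measurable_fun setT eps.
Proof.
apply: measurable_funB; first exact: measurable_snd.
exact: measurableT_comp mf measurable_fst.
Qed.

Lemma measurable_fst_comp (psi : X -> R) : measurable_fun setT psi ->
  measurable_fun setT (fun z : T => psi z.1).
Proof. by move=> mpsi; exact: measurableT_comp mpsi measurable_fst. Qed.

Lemma integral_fst (psi : X -> \bar R) : (forall x, 0 <= psi x)%E ->
  measurable_fun setT psi -> (\int[Q]_z psi z.1 = \int[nu]_x psi x)%E.
Proof.
move=> psi0 mpsi; rewrite dis //; last exact: measurableT_comp mpsi measurable_fst.
apply: eq_integral => x _.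
exact: (integral_probability_cst (kernel_law rhoc x) (psi x)).
Qed.

Lemma disint_le (F : T -> R) (psi : X -> R) : (forall z, 0 <= F z) ->
  measurable_fun setT F -> (forall x, 0 <= psi x) -> measurable_fun setT psi ->
  {ae nu, forall x, (\int[rhoc x]_y (F (x, y))%:E <= (psi x)%:E)%E} ->
  (\int[Q]_z (F z)%:E <= \int[Q]_z (psi z.1)%:E)%E.
Proof.
move=> F0 mF psi0 mpsi le.
have mF' : measurable_fun setT (EFin \o F) by exact/measurable_EFinP.
have mpsi' : measurable_fun setT (EFin \o psi) by exact/measurable_EFinP.
have F0' z : (0 <= (EFin \o F) z)%E by rewrite lee_fin.
have psi0' z : (0 <= (EFin \o psi) z)%E by rewrite lee_fin.
rewrite (dis F0' mF') (integral_fst psi0' mpsi').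
apply: ae_ge0_le_integral => //.
- by move=> x _; apply: integral_ge0 => y _; rewrite lee_fin.
- exact: measurable_kint.
- by apply: filterS le => x h _.
Qed.

Let eq_noise k (c : R) x : regression rhoc x = f x ->
  (\int[rhoc x]_y ((`|y - regression rhoc x| ^+ k.*2)%R)%:E <= c%:E)%E ->
  (\int[rhoc x]_y ((eps (x, y) ^+ k.*2)%R)%:E <= c%:E)%E.
Proof.
move=> mx; rewrite mx; apply: le_trans; rewrite le_eqVlt; apply/orP; left; apply/eqP.
apply: eq_integral => y _; rewrite /eps /= -normrX ger0_norm //.
by rewrite -mul2n exprM exprn_ge0 // sqr_ge0.
Qed.

Lemma noise_var (phi : X -> R) : measurable_fun setT phi ->
  (exists C, forall x, 0 <= phi x <= C) -> 0 <= sig2 ->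
  integr Q (fun z => eps z ^+ 2 * phi z.1) /\
  Ex Q (fun z => eps z ^+ 2 * phi z.1) <= sig2 * Ex Q (fun z => phi z.1).
Proof.
move=> mphi [C hC] s0.
have phi0 x : 0 <= phi x by case/andP: (hC x).
have mphi1 := measurable_fst_comp mphi.
have iphi : integr Q (fun z => phi z.1).
  apply: (integr_bdd _ (C := C)) => // z; rewrite ger0_norm //.
  by case/andP: (hC z.1).
rewrite -ExZ //.
apply: integr_bdd_ge0 => [|z|].
- by apply: measurable_funM => //; apply: measurable_funX; exact: measurable_eps.
- by rewrite mulr_ge0 ?sqr_ge0.
rewrite -EFin_Ex; last exact: integrZ.
apply: (disint_le (F := fun z => eps z ^+ 2 * phi z.1) (psi := fun x => sig2 * phi x)).
- by move=> z; rewrite mulr_ge0 ?sqr_ge0.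
- by apply: measurable_funM => //; apply: measurable_funX; exact: measurable_eps.
- by move=> x; rewrite mulr_ge0.
- by apply: measurable_funM.
apply: filterS2 hf noise2 => x /(@eq_noise 1 sig2) h /h{}h /=.
have me : measurable_fun setT (fun y : Y => ((eps (x, y)) ^+ 2)%:E).
  have me1 : measurable_fun setT (fun y : Y => y - f x : R).
    by apply: measurable_funB; [exact: measurable_id|exact: measurable_cst].
  by apply/measurable_EFinP; exact: (measurable_funX 2 me1).
under eq_integral do rewrite mulrC EFinM.
rewrite ge0_integralZl //; last 2 first.
- by move=> y _; rewrite lee_fin sqr_ge0.
- by rewrite lee_fin.
by rewrite mulrC EFinM; apply: lee_wpmul2l; rewrite ?lee_fin.
Qed.

Lemma noise_moment4 : 0 <= s4 ->
  integr Q (fun z => eps z ^+ 4) /\ Ex Q (fun z => eps z ^+ 4) <= s4.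
Proof.
move=> s0; have me4 : measurable_fun setT (fun z => eps z ^+ 4).
  by apply: measurable_funX; exact: measurable_eps.
have e40 z : 0 <= eps z ^+ 4 by rewrite (exprM _ 2 2) sqr_ge0.
apply: integr_bdd_ge0 => //.
rewrite -[leRHS](_ : (\int[Q]_z s4%:E = s4%:E)%E); last exact: integral_probability_cst.
apply: (disint_le (F := fun z => eps z ^+ 4) (psi := fun=> s4)) => //.
by apply: filterS2 hf noise4 => x /(@eq_noise 2 s4).
Qed.

Lemma noise_sqr : integr Q (fun z => eps z ^+ 2).
Proof.
have me2 : measurable_fun setT (fun z => eps z ^+ 2).
  by apply: measurable_funX; exact: measurable_eps.
suff [] : integr Q (fun z => eps z ^+ 2) /\ Ex Q (fun z => eps z ^+ 2) <= `|sig2| by [].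
apply: integr_bdd_ge0 => // [z|]; first exact: sqr_ge0.
rewrite -[leRHS](_ : (\int[Q]_z (`|sig2|)%:E = (`|sig2|)%:E)%E); last exact: integral_probability_cst.
apply: (disint_le (F := fun z => eps z ^+ 2) (psi := fun=> `|sig2|)) => //.
  by move=> z; exact: sqr_ge0.
apply: filterS2 hf noise2 => x /(@eq_noise 1 sig2) k /k; move/le_trans; apply.
by rewrite lee_fin ler_norm.
Qed.

(** Disintegration is stated for nonnegative functions, so the product is split: for almost every x
    its positive and negative parts have equal conditional integrals, hence equal integrals. *)
Lemma noise_mean (g : X -> R) (C : R) : measurable_fun setT g ->
  (forall x, `|g x| <= C) ->
  integr Q (fun z => eps z * g z.1) /\ Ex Q (fun z => eps z * g z.1) = 0.
Proof.
move=> mg gC; pose h z := eps z * g z.1.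
have mh : measurable_fun setT h.
  by apply: measurable_funM; [exact: measurable_eps|exact: measurable_fst_comp].
have mh' : measurable_fun setT (EFin \o h) by exact/measurable_EFinP.
have C0 : 0 <= C by apply: le_trans (gC point).
have ih : integr Q h.
  apply: integr_le mh _ (integrD noise_sqr (integr_cst _ (C ^+ 2))) => z.
  rewrite normrM -(real_normK (num_real (eps z))).
  have := gC z.1; have := normr_ge0 (g z.1); move: `|eps z| `|g z.1| => a b b0 bC.
  have : b ^+ 2 <= C ^+ 2 by rewrite ler_pXn2r ?nnegrE.
  by have := sqr_ge0 (a - b); have := sqr_ge0 a; have := sqr_ge0 b; rewrite sqrrB; lra.
split=> //; apply: EFin_inj; rewrite -EFin_Ex // integralE.
have qfin : (\int[Q]_z (EFin \o h)^\- z)%E \is a fin_num by exact: integrable_neg_fin_num.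
suff -> : (\int[Q]_z (EFin \o h)^\+ z = \int[Q]_z (EFin \o h)^\- z)%E by rewrite subee.
have mpos := measurable_funepos mh'; have mneg := measurable_funeneg mh'.
rewrite !dis //; apply: ge0_ae_eq_integral => //.
- exact: measurable_kint.
- exact: measurable_kint.
- by move=> x _; exact: integral_ge0.
- by move=> x _; exact: integral_ge0.
apply: filterS2 hf noise2 => x mx /(kernel_mean mx)[iy Ey] _.
have iyg : integr (kernel_law rhoc x) (fun y : Y => h (x, y)).
  by apply: eq_integr (integrZ (g x) iy) => y; rewrite mulrC.
have int0 : (\int[kernel_law rhoc x]_y (h (x, y))%:E = 0)%E.
  rewrite EFin_Ex // (@eq_Ex _ _ _ _ _ (fun y : Y => g x * (y - f x))) => [|y]; last exact: mulrC.
  by rewrite ExZ // Ey mulr0.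
move: int0; rewrite [X in X = _ -> _]integralE.
have := integrable_pos_fin_num measurableT iyg.
have := integrable_neg_fin_num measurableT iyg.
rewrite (funepos_comp (EFin \o h) (section_fun x)) (funeneg_comp (EFin \o h) (section_fun x)).
move=> /fineK nE /fineK pE; rewrite -nE -pE -EFinB => -[] /subr0_eq e.
by rewrite e.
Qed.

Lemma measurable_regression : measurable_fun setT (regression rhoc).
Proof.
pose y (z : T) : R := z.2.
have my : measurable_fun setT (EFin \o y) by apply/measurable_EFinP; exact: measurable_snd.
pose I (s : T -> \bar R) x := (\int[rhoc x]_t s (x, t))%E.
have -> : regression rhoc = fine \o (fun x => I (EFin \o y)^\+ x - I (EFin \o y)^\- x)%E.
  apply/funext => x; rewrite /regression /Rintegral integralE /I /=.
  by rewrite (funepos_comp (EFin \o y) (section_fun x)) (funeneg_comp (EFin \o y) (section_fun x)).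
apply: measurableT_comp => //; apply: emeasurable_funB; apply: measurable_kint => //.
- exact: measurable_funepos.
- exact: measurable_funeneg.
Qed.

Lemma risk_regression : risk Q (regression rhoc) = (Ex Q (fun z => eps z ^+ 2))%:E.
Proof.
rewrite -EFin_Ex; last exact: noise_sqr.
have msq (g : X -> R) : measurable_fun setT g ->
    measurable_fun setT (fun z : T => ((g z.1 - z.2) ^+ 2)%:E).
  move=> mg; apply/measurable_EFinP; apply: measurable_funX; apply: measurable_funB.
    exact: measurable_fst_comp.
  exact: measurable_snd.
have sq0 (g : X -> R) (z : T) : (0 <= ((g z.1 - z.2) ^+ 2)%:E)%E by rewrite lee_fin sqr_ge0.
rewrite /risk (dis (sq0 _) (msq _ measurable_regression)).
rewrite (eq_integral (fun z : T => ((f z.1 - z.2) ^+ 2)%:E)) => [|z _]; last first.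
  by rewrite /eps -sqrrN opprB.
rewrite (dis (sq0 _) (msq _ mf)); apply: ge0_ae_eq_integral => //.
- exact: (measurable_kint rhoc (sq0 _) (msq _ measurable_regression)).
- exact: (measurable_kint rhoc (sq0 _) (msq _ mf)).
- by move=> x _; exact: integral_ge0.
- by move=> x _; exact: integral_ge0.
by apply: filterS hf => x /= -> _.
Qed.

Lemma excess_risk (g : X -> R) (C : R) : measurable_fun setT g -> (forall x, `|g x| <= C) ->
  (risk Q g - risk Q (regression rhoc))%E = (Ex Q (fun z => (g z.1 - f z.1) ^+ 2))%:E.
Proof.
move=> mg gC; rewrite risk_regression.
pose h x := g x - f x.
have mh : measurable_fun setT h by exact: measurable_funB.
have hC x : `|h x| <= C + B.
  by apply: le_trans (ler_normB _ _) _; apply: lerD.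
have [i1 E1] := noise_mean mh hC.
have i2 : integr Q (fun z => h z.1 ^+ 2).
  apply: (integr_bdd _ (C := (C + B) ^+ 2)) => [|z].
    by apply: measurable_funX; exact: measurable_fst_comp.
  by rewrite normrX ler_pXn2r ?nnegrE // (le_trans _ (hC z.1)).
have E z : eps z ^+ 2 + ((-2) * (eps z * h z.1) + h z.1 ^+ 2) = (g z.1 - z.2) ^+ 2.
  by rewrite /eps /h; ring.
have i3 := integrZ (-2) i1; have i4 := integrD i3 i2; have i5 := integrD noise_sqr i4.
have -> : risk Q g = (Ex Q (fun z => (g z.1 - z.2) ^+ 2))%:E.
  by rewrite /risk EFin_Ex //; exact: eq_integr E i5.
rewrite -(eq_Ex Q E) ExD //; last exact: noise_sqr.
by rewrite ExD // ExZ // E1 mulr0 add0r -EFinB addrC addKr.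
Qed.

End ConditionalNoise.

(** * The local spaces *)

Section HatSpace.
Context (R : realType) d (X : measurableType d) (L : localization R X).
Context (j : 'I_(nloc L)).
Local Notation Hj := (@lspace _ _ _ L j).
Local Notation K := (@lkernel _ _ _ L j).
Local Notation A := (part j).
Local Notation H := (hat_space j).
Local Notation k := (hat_kernel j).
Local Notation ext := ('valL_(0 : R^o) : (A -> R^o) -> (X -> R^o)).

Lemma ext_in (g : A -> R^o) (u : A) : ext g (val u) = g u.
Proof. by have /(congr1 (fun h => h u)) := valLK (0 : R^o) g. Qed.

Lemma ext_out (g : A -> R^o) x : x \notin A -> ext g x = 0.
Proof.
move=> xA; have e := congr1 (fun h => h (ext g)) (@sigLK X R^o (0 : R^o) A).
have {}e : ext (sigL A (ext g)) = patch (fun=> 0) A (ext g) by [].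
by rewrite valLK in e; rewrite e /patch (negbTE xA).
Qed.

Lemma ext_cases x : (exists u : A, x = val u) \/ x \notin A.
Proof.
by case: (boolP (x \in A)) => xA; [left; exists (SigSub xA)|right].
Qed.

Lemma extDZ (a : R) (g h : A -> R^o) : ext (a *: g + h) = a *: ext g + ext h.
Proof.
apply/funext => x; have -> : (a *: ext g + ext h) x = a * ext g x + ext h x by [].
case: (ext_cases x) => [[u ->]|xA]; first by rewrite !ext_in.
by rewrite !ext_out // mulr0 addr0.
Qed.

Lemma dot_ext (g h : A -> R^o) : dot H (ext g) (ext h) = dot Hj g h.
Proof. by rewrite /= !valLK. Qed.

Hypothesis rk : is_rkhs K Hj.
Hypothesis sep : is_separable Hj.
Let ipj : is_inner_product Hj. Proof. by case: rk => -[]. Qed.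

Lemma vec_ext (g : A -> R^o) : vectors Hj g -> vectors H (ext g).
Proof. by exists g. Qed.

Lemma hat_ip : is_inner_product H.
Proof.
split.
- exists 0; first exact: (vec0 ipj).
  apply/funext => x; case: (ext_cases x) => [[u ->]|xA]; first by rewrite ext_in.
  by rewrite ext_out.
- move=> a _ _ [g vg <-] [h vh <-]; exists (a *: g + h); first exact: (vecDZ ipj).
  exact: extDZ.
- by move=> _ _ [g vg <-] [h vh <-]; rewrite !dot_ext; exact: (dotC ipj).
- move=> a _ _ _ [g vg <-] [h vh <-] [i vi <-].
  by rewrite -extDZ !dot_ext; exact: (dotDZl ipj).
- move=> _ [g vg <-]; rewrite dot_ext; split; first exact: (dot_ge0 ipj).
  move=> g0; rewrite (dot_eq0 ipj vg g0); apply/funext => x.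
  case: (ext_cases x) => [[u ->]|xA]; first by rewrite ext_in.
  by rewrite ext_out.
Qed.

Lemma hat_complete : is_complete H.
Proof.
move=> s vs cau; have [[_ compl] _ _] := rk.
have vs' i : vectors Hj (sigL A (s i)).
  by have [g vg <-] := vs i; rewrite valLK.
have sE i : s i = ext (sigL A (s i)) by have [g vg <-] := vs i; rewrite valLK.
have [u vu c] := compl _ vs' cau.
exists (ext u); first exact: vec_ext.
have -> : (fun i => hnorm H (s i - ext u)) = (fun i => hnorm Hj (sigL A (s i) - u)); last by [].
apply/funext => i; congr Num.sqrt => /=.
have -> : sigL A (s i - ext u) = sigL A (s i) - u; last by [].
by rewrite -[in RHS](valLK (0 : R^o) u).
Qed.

Lemma hat_separable : is_separable H.
Proof.
have [D [cD Dv dD]] := sep; exists [set ext g | g in D]; split.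
- exact: card_le_trans (card_image_le _ _) cD.
- by move=> _ [g Dg <-]; apply: vec_ext; exact: Dv.
- move=> _ e [g vg <-] e0; have [h Dh hgh] := dD _ _ vg e0.
  exists (ext h); first by exists h.
  rewrite /hnorm -[ext h]scale1r -[- (1 *: _)]scaleN1r scalerA mulN1r addrC -extDZ dot_ext.
  by rewrite scaleN1r addrC.
Qed.

Lemma hat_kernel_in (u : A) : k (val u) = ext (K u).
Proof. by rewrite /hat_kernel; exact: (congr1 (fun h => h u) (valLK _ _)). Qed.

Lemma hat_kernel_out x : x \notin A -> k x = (0 : X -> R^o).
Proof.
move=> xA; pose F (u : A) : X -> R^o := ext (K u).
pose E : (A -> X -> R^o) -> X -> X -> R^o := 'valL_(fun=> 0).
have e := congr1 (fun h => h (E F)) (@sigLK X (X -> R^o) (fun=> 0) A).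
have {}e : E (sigL A (E F)) = patch (fun=> (fun=> 0)) A (E F) by [].
rewrite valLK in e; have -> : k x = E F x by [].
by rewrite e /patch (negbTE xA).
Qed.

Lemma hat_kvec x : vectors H (k x).
Proof.
case: (ext_cases x) => [[u ->]|xA]; last first.
  by rewrite hat_kernel_out //; exact: (vec0 hat_ip).
by rewrite hat_kernel_in; apply: vec_ext; case: rk.
Qed.

Lemma hat_repr g x : vectors H g -> g x = dot H g (k x).
Proof.
move=> [h vh <-]; case: (ext_cases x) => [[u ->]|xA].
  by rewrite hat_kernel_in dot_ext ext_in; case: rk => _ _; apply.
rewrite hat_kernel_out // ext_out //; apply/esym; apply: (dot0r hat_ip).
exact: vec_ext.
Qed.

Lemma hat_kernel_bound (c : R) : 0 <= c -> (forall u : A, K u u <= c) -> forall x, k x x <= c.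
Proof.
move=> c0 Kc x; case: (ext_cases x) => [[u ->]|xA]; last by rewrite hat_kernel_out.
by rewrite hat_kernel_in ext_in.
Qed.

Hypothesis mA : measurable A.
Hypothesis mk : measurable_fun (A `*` A) (fun z : X * X => k z.1 z.2 : measurableTypeR R).

Lemma hat_kmeas : measurable_fun setT (fun z : X * X => k z.1 z.2).
Proof.
have mAA : measurable (A `*` A) by exact: measurableX.
have := (measurable_restrictT _ mAA).1 mk; congr measurable_fun.
apply/funext => z; rewrite patchE; case: (boolP (z \in A `*` A)) => // zA.
case: (ext_cases z.1) => [[u zu]|z1]; last by rewrite hat_kernel_out.
rewrite zu hat_kernel_in ext_out //; apply/negP; rewrite inE => z2.
move/negP: zA; apply; rewrite inE; split=> //; rewrite zu; exact: set_valP.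
Qed.

Lemma measurable_hat_kernel x : measurable_fun setT (k x : X -> R).
Proof.
have mx : measurable_fun setT (fun y : X => (x, y)) by apply: measurable_fun_pair.
exact: measurableT_comp hat_kmeas mx.
Qed.

(* A vector is measurable because the closed subspace of measurable vectors
   contains every kernel section. *)
Lemma measurable_hat_vec g : vectors H g -> measurable_fun setT (g : X -> R).
Proof.
move=> vg; pose Sp : set (X -> R^o) := [set h | vectors H h /\ measurable_fun setT (h : X -> R)].
have sp0 : Sp 0 by split; [exact: (vec0 hat_ip)|exact: measurable_cst].
have spD a u v : Sp u -> Sp v -> Sp (a *: u + v).
  move=> [vu mu] [vv mv]; split; first exact: (vecDZ hat_ip).
  by apply: measurable_funD => //; apply: measurable_funM => //; exact: measurable_cst.
have [h [s [vh ss c orth]]] := projection hat_ip hat_complete sp0 spD (fun _ h => h.1) vg.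
have gh : g = h.
  apply/funext => x; have := orth _ (conj (hat_kvec x) (measurable_hat_kernel x)).
  rewrite -(hat_repr x (vecB hat_ip vg vh)) => e.
  by apply/eqP; rewrite -subr_eq0; apply/eqP; exact: e.
rewrite gh; apply: (@measurable_fun_cvg _ _ _ setT (fun i => s i : X -> R)) => [i|x _].
  by case: (ss i).
have := hcvg_dot hat_ip (fun i => (ss i).1) vh (hat_kvec x) c.
have -> : (fun i => dot H (s i) (k x)) = (fun i => s i x).
  by apply/funext => i; rewrite -(hat_repr x (ss i).1).
by rewrite -(hat_repr x vh).
Qed.

End HatSpace.

(** * Effective dimension in an eigenbasis *)

Section EffectiveDimension.
Context (R : realType) (V : lmodType R) (H : ip_space V).
Hypothesis ipH : is_inner_product H.
Hypothesis cH : is_complete H.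
Hypothesis sepH : is_separable H.
Local Notation vec := (vectors H).
Local Notation "\< u , v \>" := (dot H u v) (at level 0, u, v at level 99).
Context (e : nat -> V) (A : V -> V) (mu : nat -> R) (lam : R) (E : set V).
Hypothesis fr : frame H e.
Hypothesis onbE : orthonormal_basis H E.
Hypothesis A_vec : forall u, vec u -> vec (A u).
Hypothesis A_coef : forall u i, vec u -> \<A u, e i\> = mu i * \<u, e i\>.
Hypothesis mu0 : forall i, 0 <= mu i.
Hypothesis lam0 : 0 < lam.
Let evec i : vec (e i) := frame_vec fr i.
Hint Resolve evec : core.
Let c i := mu i / (mu i + lam).
Let res o := op_inv H (fun f => A f + lam *: f) (A o).

Let ml0 i : 0 < mu i + lam. Proof. by rewrite ltr_wpDl. Qed.

Let c0 i : 0 <= c i. Proof. by rewrite divr_ge0 // ltW. Qed.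

(** A solution of the resolvent equation is synthesized from its coordinates; any other choice made
    by [op_inv] has the same coordinates because mu_i + lam > 0. *)
Lemma resolvent_coef o : vec o ->
  vec (res o) /\ forall i, \<res o, e i\> = c i * \<o, e i\>.
Proof.
move=> vo; pose a i := c i * \<o, e i\>.
have [n|f vf [_ fe]] := @synth_cvg _ _ _ ipH cH _ fr a \<o, o\>.
  apply: le_trans (bessel ipH fr n vo); apply: ler_sum => i _.
  have -> : a i ^+ 2 * \<e i, e i\> = c i ^+ 2 * (\<o, e i\> * (\<o, e i\> * \<e i, e i\>)).
    by rewrite /a; ring.
  rewrite (frame_idem ipH fr) // -expr2 -[leRHS]mul1r ler_wpM2r ?sqr_ge0 //.
  have c1 : c i <= 1 by rewrite ler_pdivrMr // mul1r lerDl ltW.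
  by rewrite exprn_ile1.
have fe' i : \<f, e i\> = a i by rewrite fe /a -mulrA (frame_idem ipH fr).
have sol : vec f /\ A f + lam *: f = A o.
  split=> //; apply/eqP; rewrite -subr_eq0; apply/eqP.
  have vl : vec (A f + lam *: f).
    by apply: (vecD ipH); [exact: A_vec|exact: (vecZ ipH)].
  case: fr => _ _ _; apply; first by apply: (vecB ipH) => //; exact: A_vec.
  move=> i; rewrite (dotBl ipH) //; last exact: A_vec.
  rewrite (dotDl ipH) //; [|exact: A_vec|exact: (vecZ ipH)].
  rewrite (dotZl ipH) // !A_coef // fe' /a /c.
  by field; rewrite gt_eqF.
have [vr re] : vec (res o) /\ A (res o) + lam *: res o = A o.
  by rewrite /res /op_inv; exact: (@xgetPex _ (0 : V) [set h | vec h /\ A h + lam *: h = A o] (ex_intro _ f sol)).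
split=> // i; have := congr1 (fun h => \<h, e i\>) re.
rewrite (dotDl ipH) //; [|exact: A_vec|exact: (vecZ ipH)].
rewrite (dotZl ipH) // !A_coef // -mulrDl => h.
by rewrite /c mulrAC -h mulrAC mulfV ?mul1r // gt_eqF.
Qed.

Lemma resolvent_ge D o : vec o -> \sum_(i < D) c i * \<o, e i\> ^+ 2 <= \<res o, o\>.
Proof.
move=> vo; have [vr re] := resolvent_coef vo.
have cv := parseval2 ipH cH fr vr vo.
rewrite -(cvg_lim _ cv) //; apply: limr_ge; first by apply/cvg_ex; exists \<res o, o\>.
exists D => // n /= Dn.
rewrite -(big_mkord xpredT (fun i => c i * \<o, e i\> ^+ 2)) (big_cat_nat (leq0n D) Dn) /=.
rewrite -[leLHS]addr0; apply: lerD.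
  by apply: ler_sum => i _; rewrite re -mulrA -expr2.
by apply: sumr_ge0 => i _; rewrite re -mulrA -expr2 mulr_ge0 // sqr_ge0.
Qed.

(** The trace runs over the unspecified basis [onb H]. Its partial sums dominate finite double sums
    of c_i <b_n, e_i>^2, where Parseval in n recovers the eigenvalue sum. This direction lets an
    upper bound on the effective dimension bound the variance. *)
Lemma effective_dimension_ge D :
  ((\sum_(i < D) mu i / (mu i + lam) * \<e i, e i\>)%:E <= effective_dimension H A lam)%E.
Proof.
pose O := onb H.
have onbO : orthonormal_basis H O by exact: (xgetPex set0 (ex_intro _ E onbE)).
have [b [fo Oo oinj _]] := onb_frame ipH onbO sepH.
have vo n : vec (b n) := frame_vec fo n.
pose S M := \sum_(0 <= n < M) \sum_(i < D) c i * \<b n, e i\> ^+ 2.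
have SE M : S M = \sum_(i < D) c i * \sum_(0 <= n < M) \<e i, b n\> ^+ 2.
  rewrite /S exchange_big; apply: eq_bigr => i _; rewrite mulr_sumr.
  by apply: eq_bigr => n _; rewrite (dotC ipH).
have cS : S @ \oo --> \sum_(i < D) c i * \<e i, e i\>.
  rewrite (_ : S = fun M => \sum_(i < D) c i * \sum_(0 <= n < M) \<e i, b n\> ^+ 2); last first.
    by apply/funext.
  elim: (index_enum 'I_D) => [|i s IH].
    by rewrite big_nil; under eq_fun do rewrite big_nil; exact: cvg_cst.
  rewrite big_cons; under eq_fun do rewrite big_cons.
  apply: (@cvgD _ _ _ _ eventually_filter) IH; apply: (@cvgM _ _ _ eventually_filter).
    exact: cvg_cst.
  exact: (parseval ipH cH fo (evec i)).
have Sle M : ((S M)%:E <= effective_dimension H A lam)%E.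
  pose r := [seq b n | n <- index_iota 0 M & `[< O (b n) >]].
  have ur : uniq r.
    rewrite map_inj_in_uniq ?filter_uniq ?iota_uniq // => n n'.
    by rewrite !mem_filter => /andP[/asboolP h _] _; exact: oinj.
  apply: esum_ge; exists [set` r].
    split; first exact: finite_seq.
    by move=> x /= /mapP[n]; rewrite mem_filter => /andP[/asboolP h _] ->.
  rewrite -fsbig_seq // big_map big_filter sumEFin lee_fin /S big_mkcond.
  rewrite [leRHS]big_mkcond; apply: ler_sum => n _ /=.
  case: asboolP => [On|nO]; first exact: resolvent_ge.
  case: (Oo n) => // ->; rewrite big1 // => i _.
  by rewrite (dot0l ipH) // expr0n mulr0.
move: (effective_dimension H A lam) Sle => [t| |] Sle; last 2 first.
- by rewrite leey.
- by have := Sle 0%N; rewrite leeNy_eq.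
rewrite lee_fin -(cvg_lim _ cS) //; apply: limr_le.
  by apply/cvg_ex; eexists; exact: cS.
by apply: nearW => M; rewrite -lee_fin.
Qed.

End EffectiveDimension.

Section LocalProbability.
Context (R : realType) d (X : measurableType d).
Local Notation T := (X * measurableTypeR R)%type.
Context (rho : probability T R) (L : localization R X) (j : 'I_(nloc L)).
Hypotheses (mA : measurable (part j)) (w0 : 0 < weight rho j).

Let c0 : 0 <= (weight rho j)^-1. Proof. by rewrite invr_ge0 ltW. Qed.

Let mD : measurable (part j `*` [set: measurableTypeR R]).
Proof. exact: measurableX. Qed.

Let rho_part : rho (part j `*` [set: measurableTypeR R]) = (weight rho j)%:E.
Proof.
rewrite /weight fineK.
  by congr (rho _); apply/seteqP; split => -[x y] //= [].
suff : rho (fst @^-1` part j) \is a fin_num by [].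
by rewrite fin_num_measure // -[_ @^-1` _]setTI; exact: measurable_fst.
Qed.

Lemma ex_local_law : exists Q : probability T R, (Q : set T -> \bar R) = local_law rho j.
Proof.
pose m : {measure set T -> \bar R} := mscale (NngNum c0) (mrestr rho mD).
have m1 : m setT = 1%E.
  suff : ((weight rho j)^-1%:E * rho (setT `&` (part j `*` setT)) = 1)%E by [].
  by rewrite setTI rho_part -EFinM mulVf ?gt_eqF.
by exists (HB.pack_for (probability T R) (Measure.sort m) (Measure_isProbability.Build _ _ _ m m1)).
Qed.

Lemma ex_local_marginal (Q : probability T R) : (Q : set T -> \bar R) = local_law rho j ->
  exists nu : probability X R, (nu : set X -> \bar R) = local_marginal rho j /\
  forall psi : X -> R, measurable_fun setT psi -> (exists C, forall x, `|psi x| <= C) ->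
    Ex Q (fun z => psi z.1) = Ex nu psi.
Proof.
move=> QE.
pose fstm : {mfun T >-> X} :=
  HB.pack (fst : T -> X) (isMeasurableFun.Build _ _ _ _ _ (@measurable_fst _ _ X (measurableTypeR R))).
pose nu : probability X R := distribution Q fstm; exists nu; split.
  apply/funext => B; have -> : nu B = Q (fst @^-1` B) by [].
  rewrite QE /local_law /local_marginal; congr (_ * _)%E.
  suff -> : fst @^-1` B `&` (part j `*` setT) = fst @^-1` (B `&` part j) :> set T by [].
  by apply/seteqP; split => -[x y] /=; tauto.
move=> psi mpsi [C psiC].
have ipsi : integr Q (fun z => psi z.1).
  by apply: (integr_bdd _ (C := C)) => //; exact: measurableT_comp mpsi measurable_fst.
have inu : integr nu psi by apply: (integr_bdd _ (C := C)).
apply: EFin_inj; rewrite -!EFin_Ex // integral_distribution //.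
exact/measurable_EFinP.
Qed.

End LocalProbability.

(** * The local model extracted from the source condition *)

Section LocalModelOfRegularity.
Context (R : realType) d (X : measurableType d).
Local Notation T := (X * measurableTypeR R)%type.
Context (rho : probability T R) (L : localization R X) (j : 'I_(nloc L)).
Local Notation H := (hat_space j).
Local Notation k := (hat_kernel j).
Local Notation vec := (vectors H).
Local Notation "\< u , v \>" := (dot H u v) (at level 0, u, v at level 99).
Hypotheses (mA : measurable (part j)) (w0 : 0 < weight rho j).
Hypothesis rk : is_rkhs (@lkernel _ _ _ L j) (lspace j).
Hypothesis sep : is_separable (lspace j).
Hypothesis mk : measurable_fun (part j `*` part j)
  (fun z : X * X => k z.1 z.2 : measurableTypeR R).
Context (kap : R).
Hypotheses (kap0 : 0 <= kap) (Kkap : forall x : part j, lkernel x x <= kap).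
Context (Q : probability T R).
Hypothesis QE : (Q : set T -> \bar R) = local_law rho j.
Let ipH := hat_ip rk.
Let kvec := hat_kvec rk.
Hint Resolve kvec : core.
Let A := local_cov_operator rho j.

Let sqr_bd g x : vec g -> g x ^+ 2 <= kap * \<g, g\>.
Proof.
move=> vg; rewrite (hat_repr rk x vg); apply: le_trans (dot_cs ipH vg (kvec x)) _.
rewrite mulrC ler_wpM2r ?(dot_ge0 ipH) // -(hat_repr rk x (kvec x)).
exact: hat_kernel_bound.
Qed.

Let abs_bd g x : vec g -> `|g x : R| <= Num.sqrt (kap * \<g, g\>).
Proof. by move=> vg; rewrite -sqrtr_sqr ler_wsqrtr // sqr_bd. Qed.

Let mvec g : vec g -> measurable_fun setT (g : X -> R).
Proof. exact: measurable_hat_vec. Qed.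

Let prod_bd g h x : vec g -> vec h ->
  `|(g x : R) * h x| <= Num.sqrt (kap * \<g, g\>) * Num.sqrt (kap * \<h, h\>).
Proof. by move=> vg vh; rewrite normrM; apply: ler_pM => //; exact: abs_bd. Qed.

Let integr_prod g h : vec g -> vec h -> integr Q (fun z => g z.1 * h z.1).
Proof.
move=> vg vh; apply: (integr_bdd _ (C := Num.sqrt (kap * \<g, g\>) * Num.sqrt (kap * \<h, h\>))).
  by apply: measurable_funM; apply: measurableT_comp measurable_fst; exact: mvec.
by move=> z; exact: prod_bd.
Qed.

(** Riesz representation shows that the weak integral exists, so [xget] in [op_expectation] returns
    it rather than its default value. *)
Lemma local_covP (e : nat -> X -> R^o) u : frame H e -> vec u ->
  vec (A u) /\ forall v, vec v -> \<A u, v\> = Ex Q (fun z => u z.1 * v z.1).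
Proof.
move=> fr vu; have [nu [nuE Enu]] := ex_local_marginal QE.
have spec v : vec v ->
    fine (\int[local_marginal rho j]_x (dot H (tensor_square H (k x) u) v)%:E)%E =
    Ex Q (fun z => u z.1 * v z.1).
  move=> vv; rewrite (Enu (fun x => u x * v x)); last 2 first.
  - by apply: measurable_funM; exact: mvec.
  - by eexists => x; exact: prod_bd.
  rewrite /Ex /Rintegral -nuE; congr fine; apply: eq_integral => x _; congr EFin.
  rewrite /tensor_square (dotZl ipH) // -(hat_repr rk x vu).
  by rewrite (dotC ipH) // -(hat_repr rk x vv).
have [||v vv|g vg gE] := riesz ipH (hat_complete rk) fr
    (phi := fun v => Ex Q (fun z => u z.1 * v z.1)) (C := kap * \<u, u\> * kap).
- move=> a v v' vv vv'; rewrite -ExZ; last exact: integr_prod.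
  rewrite -ExD; [|by apply: integrZ; exact: integr_prod|exact: integr_prod].
  apply: eq_Ex => z; have -> : (a *: v + v') z.1 = a * v z.1 + v' z.1 by [].
  by rewrite mulrDr mulrCA.
- by rewrite !mulr_ge0 // (dot_ge0 ipH).
- have P0 : 0 <= kap * \<u, u\> by rewrite mulr_ge0 // (dot_ge0 ipH).
  have P1 : 0 <= kap * \<v, v\> by rewrite mulr_ge0 // (dot_ge0 ipH).
  set a := Num.sqrt (kap * \<u, u\>) * Num.sqrt (kap * \<v, v\>).
  have -> : kap * \<u, u\> * kap * \<v, v\> = a ^+ 2.
    by rewrite exprMn !sqr_sqrtr // mulrA.
  rewrite -[leLHS]real_normK ?num_real // ler_pXn2r ?nnegrE ?mulr_ge0 ?sqrtr_ge0 //.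
  have i := integr_prod vu vv.
  rewrite ler_norml -[a](Ex_cst Q) -mulN1r -ExZ; last exact: integr_cst.
  apply/andP; split.
    apply: Ex_le => // [|z]; first by apply: integrZ; exact: integr_cst.
    by rewrite mulN1r; have := prod_bd z.1 vu vv; rewrite ler_norml => /andP[].
  apply: Ex_le => // [|z]; first exact: integr_cst.
  by have := prod_bd z.1 vu vv; rewrite ler_norml => /andP[].
have [vA AE] := @xgetPex _ (0 : X -> R^o) [set g | vec g /\ forall v, vec v ->
  dot H g v = fine (\int[local_marginal rho j]_x (dot H (tensor_square H (k x) u) v)%:E)%E]
  (ex_intro _ g (conj vg (fun v vv => etrans (gE v vv) (esym (spec v vv))))).
by split=> // v vv; rewrite -spec //; exact: AE.
Qed.

(** Enumerating the eigenbasis contained in [is_power] gives the frame, and its eigenvalues coincide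
    with the L^2 norms [mu]. Source condition, covariance and effective dimension are thus read in
    one basis. *)
Lemma local_model_of_power (s : R) (h f : X -> R^o) : is_power H A s h f -> vec h ->
  exists e : nat -> X -> R^o, [/\ local_model Q H k e kap,
    forall i, coef H e f i = mu Q e i `^ s * coef H e h i &
    forall D lam, 0 < lam ->
      ((\sum_(i < D) mu Q e i / (mu Q e i + lam))%:E <= effective_dimension H A lam)%E].
Proof.
move=> [E [m [onbE Em vf fE]]] vh.
have [e [fr Ee einj _]] := onb_frame ipH onbE (hat_separable sep).
have ve i : vec (e i) := frame_vec fr i.
have dE i : E (e i) -> \<e i, e i\> = 1 by case: onbE => _ h1 _ _; exact: h1.
have covE i g : vec g -> E (e i) -> Ex Q (fun z => e i z.1 * g z.1) = m (e i) * \<e i, g\>.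
  move=> vg Ei; have [_ AE] := local_covP fr (ve i).
  by rewrite -AE //; have [_ ->] := Em _ Ei; rewrite (dotZl ipH).
have muE i : E (e i) -> mu Q e i = m (e i).
  move=> Ei; have := covE i _ (ve i) Ei; rewrite dE // mulr1 => <-.
  by apply: eq_Ex => z; rewrite expr2.
have lm : local_model Q H k e kap.
  split => //.
  - exact: hat_complete.
  - by move=> g x; exact: hat_repr.
  - exact: hat_kernel_bound.
  - exact: hat_kmeas.
  - move=> i g vg; case: (Ee i) => [Ei|e0]; first by rewrite muE // covE.
    rewrite e0 (dot0l ipH) // mulr0 -[RHS](Ex0 Q); apply: eq_Ex => z.
    by rewrite mul0r.
exists e; split => // [i|D lam lam0].
  rewrite /coef; case: (Ee i) => [Ei|->]; first by rewrite muE // fE.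
  by rewrite !(dot0r ipH) // mulr0.
have Acoef u i : vec u -> \<A u, e i\> = mu Q e i * \<u, e i\>.
  move=> vu; have [_ AE] := local_covP fr vu; rewrite AE //.
  rewrite [in RHS](dotC ipH) // -(lm_cov lm i vu); apply: eq_Ex => z.
  by rewrite mulrC.
apply: le_trans (effective_dimension_ge ipH (hat_complete rk) (hat_separable sep) fr onbE
  (fun u vu => (local_covP fr vu).1) Acoef (mu_ge0 Q e) lam0 D).
rewrite lee_fin; apply: ler_sum => i _.
rewrite [in leRHS]mulrAC (mu_idem lm) //.
Qed.

End LocalModelOfRegularity.

Section TauLimit.
Context (R : realType) d (X : measurableType d).
Context (Q : probability (X * measurableTypeR R)%type R).
Context (H : ip_space (X -> R^o)) (k : X -> X -> R) (e : nat -> X -> R^o).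
Context (kap : R).
Hypothesis lm : local_model Q H k e kap.

(** By Parseval for each kernel section [tau] tends to 0 pointwise, and it is dominated by kap.
    There is no rate: D depends on the distribution and must not enter a final constant. *)
Lemma tau_small (delta : R) : 0 < delta ->
  exists D, Ex Q (fun z => tau k e D z.1) <= delta.
Proof.
move=> delta0; have ipH := lm_ip lm.
have tau_cvg x : (fun n => tau k e n x) @ \oo --> (0 : R).
  have c := parseval ipH (lm_complete lm) (lm_frame lm) (lm_kvec lm x).
  have c2 : (fun n => k x x - \sum_(0 <= i < n) dot H (k x) (e i) ^+ 2) @ \oo -->
      k x x - dot H (k x) (k x) by apply: cvgB => //; exact: cvg_cst.
  rewrite -(kE lm) subrr in c2; apply: cvg_trans c2; apply: near_eq_cvg.
  apply: nearW => n; rewrite /tau big_mkord; congr (_ - _).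
  apply: eq_bigr => i _.
  have ki := lm_kvec lm x; have vi := frame_vec (lm_frame lm) i.
  by rewrite (lm_repr lm x vi) (dotC ipH).
have mtau n := measurable_tau lm n.
have mf n : measurable_fun setT (fun z : X * measurableTypeR R => (tau k e n z.1)%:E).
  by apply/measurable_EFinP; exact: measurableT_comp (mtau n) measurable_fst.
have [||||_ _ c] := @dominated_convergence _ _ _ Q setT measurableT
    (fun n z => (tau k e n z.1)%:E) (cst 0%E) (cst kap%:E) mf.
- exact: measurable_cst.
- by apply: aeW => z _; apply/fine_cvgP; split; [exact: nearW|exact: tau_cvg].
- exact: integr_cst.
- apply: aeW => z n _; rewrite /= lee_fin ger0_norm; first exact: (tau_le lm).
  exact: (tau_ge0 lm).
rewrite integral0 in c.
have {}c : (fun n => Ex Q (fun z => tau k e n z.1)) @ \oo --> (0 : R).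
  have /fine_cvgP[_] := c; congr (_ @ _ --> _).
move/cvgrPdist_le : c => /(_ _ delta0)[D _ /(_ D (leqnn D))] /=.
rewrite sub0r normrN => h; exists D; exact: le_trans (ler_norm _) h.
Qed.
End TauLimit.

Section FromSample.
Context (R : realType) d (X : measurableType d).
Local Notation T := (X * measurableTypeR R)%type.
Context (rho : probability T R) (L : localization R X).
Context dO (Omega : measurableType dO) (P : probability Omega R) (N l : nat).
Context (Z : 'I_(nloc L) -> 'I_N -> Omega -> T) (S : 'I_(nloc L) -> Omega -> {set 'I_N}).
Hypothesis hZS : is_sample P rho l Z S.

(** The events of all other parts are set to the whole space in the joint product formula. *)
Lemma sampling_of_is_sample (j : 'I_(nloc L)) (Q : probability T R) :
  (Q : set T -> \bar R) = local_law rho j -> sampling P Q (Z j) (S j).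
Proof.
have [[mZ mS] lawZ _ prodZS] := hZS => QE; split => [i|s|B A mB].
- exact: mZ.
- exact: mS.
pose B' j' i := if j' == j then B i else [set: T].
pose A' j' := if j' == j then A else [set: {set 'I_N}].
have mB' j' i : measurable (B' j' i) by rewrite /B'; case: eqP.
have := prodZS B' A' mB'.
have -> : (\bigcap_j' \bigcap_i (Z j' i @^-1` B' j' i)) `&` (\bigcap_j' (S j' @^-1` A' j')) =
    (\bigcap_i (Z j i @^-1` B i)) `&` S j @^-1` A.
  apply/seteqP; split => w [h1 h2]; split.
  - by move=> i _; have := h1 j I i I; rewrite /B' eqxx.
  - by have := h2 j I; rewrite /A' /preimage /= eqxx.
  - by move=> j' _ i _; rewrite /B' /preimage /=; case: eqP => [->|//]; exact: h1.
  - by move=> j' _; rewrite /A' /preimage /=; case: eqP => [->|//].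
move=> ->; congr (_ * _)%E.
  rewrite (bigD1 j) //= [X in (_ * X)%E]big1 ?mule1 => [|j' /negbTE nj].
    rewrite (big_morph EFin (@EFinM R) (erefl 1%E)); apply: eq_bigr => i _.
    rewrite /B' eqxx lawZ //.
    have -> : local_law rho j (B i) = Q (B i) by rewrite -QE.
    by rewrite fineK // fin_num_measure.
  by rewrite big1 // => i _; rewrite /B' nj preimage_setT probability_setT.
rewrite (bigD1 j) //= [X in (_ * X)%E]big1 ?mule1 => [|j' /negbTE nj].
  by rewrite /A' eqxx.
by rewrite /A' nj preimage_setT probability_setT.
Qed.

Lemma Ex_indS_is_sample j (s : {set 'I_N}) : #|s| != l -> Ex P (indS R (S j) s) = 0.
Proof.
have [[_ mS] _ lawS _] := hZS => /negbTE sl.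
have -> : indS R (S j) s = \1_(S j @^-1` [set s]).
  apply/funext => w; rewrite /indS indicE; congr (nat_of_bool _)%:R.
  by apply/idP/idP => [/eqP h|]; [rewrite inE|rewrite inE => /eqP].
rewrite /Ex /Rintegral integral_indic // setIT.
have e := lawS j s; rewrite sl in e; exact: (congr1 fine e).
Qed.

End FromSample.

(** * From the parts to the whole input space *)

Section Parts.
Context (R : realType) d (X : measurableType d).
Local Notation T := (X * measurableTypeR R)%type.
Context (rho : probability T R) (L : localization R X).
Hypothesis pa : partition_assumption rho L.

Lemma part_cover x : exists j : 'I_(nloc L), part j x.
Proof.
have [[cov _ _] _ _] := pa.
have : (\bigcup_(j in [set: 'I_(nloc L)]) part j) x by rewrite -/(cover _ _) cov.
by move=> [j _ jx]; exists j.
Qed.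

Lemma part_inj (j j' : 'I_(nloc L)) x : part j x -> part j' x -> j = j'.
Proof.
have [[_ triv _] _ _] := pa => jx j'x.
by apply: triv => //; exists x.
Qed.

(** At each x at most one summand is nonzero. With F the square, the squared error of the sum is the
    sum of the squared errors. *)
Lemma sum_vanishing (g : 'I_(nloc L) -> X -> R) (F : R -> R) x : F 0 = 0 ->
  (forall j x, x \notin part j -> g j x = 0) ->
  F (\sum_j g j x) = \sum_j F (g j x).
Proof.
move=> F0 g0; have [j jx] := part_cover x.
have out i : i != j -> g i x = 0.
  move=> ij; apply: g0; apply/negP; rewrite inE => ix.
  by rewrite (part_inj ix jx) eqxx in ij.
rewrite (bigD1 j) //= [in RHS](bigD1 j) //= !big1 ?addr0 // => i ij; rewrite out //.
Qed.

Let mfst A : measurable A -> measurable ((fst : T -> X) @^-1` A).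
Proof. by move=> mA; rewrite -[_ @^-1` _]setTI; exact: (@measurable_fst _ _ X (measurableTypeR R)). Qed.

Lemma weight_marginal (j : 'I_(nloc L)) :
  (weight rho j)%:E = rho ((fst : T -> X) @^-1` part j).
Proof.
by have [_ mp _] := pa; rewrite /weight fineK //; exact: fin_num_measure (mfst (mp j)).
Qed.

Lemma sum_weight_le1 : \sum_(j < nloc L) weight rho j <= 1.
Proof.
have [_ mp _] := pa; pose D (j : 'I_(nloc L)) : set T := fst @^-1` part j.
have mD j : measurable (D j) by exact: mfst.
have mI (j : 'I_(nloc L)) : measurable_fun setT (\1_(D j) : T -> R) by exact: measurable_indic.
have iI (j : 'I_(nloc L)) : integr rho (\1_(D j)).
  by apply: (integr_bdd _ (C := 1)) => // z; rewrite indicE ger0_norm // lern1 leq_b1.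
have wE (j : 'I_(nloc L)) : weight rho j = Ex rho (\1_(D j)).
  rewrite /Ex /Rintegral integral_indic // setIT.
  exact: (congr1 fine (weight_marginal j)).
rewrite (eq_bigr _ (fun j _ => wE j)) -Ex_sum // -(Ex_cst rho 1).
apply: Ex_le => [||z]; [exact: integr_sum|exact: integr_cst|].
have [j jz] := part_cover z.1; rewrite (bigD1 j) //= big1 ?addr0.
  by rewrite indicE lern1 leq_b1.
move=> i ij; rewrite indicE memNset // => iz.
by rewrite (part_inj iz jz) eqxx in ij.
Qed.

Lemma ae_local (j : 'I_(nloc L)) (Pr : X -> Prop) :
  {ae marginal rho, forall x, Pr x} ->
  {ae local_marginal rho j, forall x, Pr x /\ part j x}.
Proof.
have [_ mp w0] := pa => -[B [mB B0 PB]].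
exists (B `|` ~` part j); split.
- by apply: measurableU => //; apply: measurableC; exact: mp.
- rewrite /local_marginal setIUl setICl setU0.
  suff -> : marginal rho (B `&` part j) = 0%E by rewrite mule0.
  have mBj : measurable ((fst : T -> X) @^-1` (B `&` part j)).
    by apply: mfst; apply: measurableI => //; exact: mp.
  suff : rho ((fst : T -> X) @^-1` (B `&` part j)) = 0%E by [].
  by apply: (subset_measure0 mBj (mfst mB)) => // z [].
- move=> x /= nP; have [jx|jx] := pselect (part j x); last by right.
  by left; apply: PB => Px; apply: nP.
Qed.

Lemma hat_vanish (j : 'I_(nloc L)) g x : vectors (hat_space j) g -> x \notin part j -> g x = 0.
Proof. by move=> [h _ <-] xj; exact: ext_out. Qed.

Lemma weight_Ex (j : 'I_(nloc L)) (Q : probability T R) (psi : X -> R) :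
  (Q : set T -> \bar R) = local_law rho j -> measurable_fun setT psi ->
  (forall x, 0 <= psi x) -> (exists C, forall x, psi x <= C) ->
  (forall x, x \notin part j -> psi x = 0) ->
  Ex rho (fun z => psi z.1) = weight rho j * Ex Q (fun z => psi z.1).
Proof.
have [_ mp w0] := pa => QE mpsi psi0 [C psiC] psiout.
have mpsi1 : measurable_fun setT (fun z : T => psi z.1).
  exact: measurableT_comp mpsi measurable_fst.
have ib (P' : probability T R) : integr P' (fun z => psi z.1).
  by apply: (integr_bdd _ (C := C)) => // z; rewrite ger0_norm.
have mD : measurable (part j `*` [set: measurableTypeR R]) by apply: measurableX => //; exact: mp.
have c0 : 0 <= (weight rho j)^-1 by rewrite invr_ge0 ltW.
apply: EFin_inj; rewrite EFinM -!EFin_Ex //.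
have -> : (\int[Q]_z (psi z.1)%:E = \int[mscale (NngNum c0) (mrestr rho mD)]_z (psi z.1)%:E)%E.
  by rewrite QE.
rewrite integral_mscale_mrestr //; last 2 first.
- exact/measurable_EFinP.
- by move=> z; rewrite lee_fin.
rewrite muleA -EFinM mulfV ?gt_eqF // mul1e [RHS]integral_mkcond.
apply: eq_integral => z _; rewrite patchE.
case: (boolP (z \in _)) => // zj; rewrite psiout //.
by apply: contra zj; rewrite !inE.
Qed.

Lemma excess_risk_sum (rhoc : R.-pker X ~> measurableTypeR R) (f g : 'I_(nloc L) -> X -> R)
    (B sig2 : R) :
  is_conditional rho rhoc ->
  {ae marginal rho, forall x, regression rhoc x = \sum_j f j x} ->
  {ae marginal rho, forall x,
    (\int[rhoc x]_y ((`|y - regression rhoc x| ^+ 2)%R)%:E <= sig2%:E)%E} ->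
  (forall j x, x \notin part j -> f j x = 0) -> (forall j x, x \notin part j -> g j x = 0) ->
  (forall j, measurable_fun setT (f j)) -> (forall j, measurable_fun setT (g j)) ->
  (forall j x, `|f j x| <= B) -> (forall j x, `|g j x| <= B) ->
  (risk rho (fun x => \sum_j g j x)%R - risk rho (regression rhoc))%E =
  (\sum_j Ex rho (fun z => (g j z.1 - f j z.1) ^+ 2))%:E.
Proof.
move=> cond hf noise2 f0 g0 mf mg fB gB.
pose fstm : {mfun T >-> X} :=
  HB.pack (fst : T -> X) (isMeasurableFun.Build _ _ _ _ _ (@measurable_fst _ _ X (measurableTypeR R))).
pose nu : probability X R := distribution rho fstm.
have dis : disintegrates rhoc rho nu := disintegrates_conditional cond.
have bd (h : 'I_(nloc L) -> X -> R) : (forall j x, x \notin part j -> h j x = 0) ->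
    (forall j x, `|h j x| <= B) -> forall x, `|\sum_j h j x| <= B.
  move=> h0 hB x; have [j jx] := part_cover x.
  rewrite (bigD1 j) //= big1 ?addr0 // => i ij; apply: h0; apply/negP; rewrite inE => ix.
  by rewrite (part_inj ix jx) eqxx in ij.
have msum (h : 'I_(nloc L) -> X -> R) : (forall j, measurable_fun setT (h j)) ->
    measurable_fun setT (fun x => \sum_j h j x) by move=> mh; exact: measurable_sum.
rewrite (excess_risk dis (msum _ mf) (bd _ f0 fB) hf noise2 (msum _ mg) (bd _ g0 gB)).
congr EFin; rewrite -Ex_sum => [|j _]; last first.
  apply: (integr_bdd _ (C := (B + B) ^+ 2)) => [|z].
    apply: measurable_funX; apply: measurable_funB.
      exact: measurableT_comp (mg j) measurable_fst.
    exact: measurableT_comp (mf j) measurable_fst.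
  have h1 := gB j z.1; have h2 := fB j z.1; have h3 := ler_normB (g j z.1) (f j z.1).
  rewrite normrX ler_pXn2r ?nnegrE ?addr_ge0 //; try exact: le_trans (normr_ge0 _) h1.
  by apply: le_trans h3 _; exact: lerD.
apply: eq_Ex => z.
have := @sum_vanishing (fun j x => g j x - f j x) (fun t => t ^+ 2) z.1.
rewrite sumrB expr0n; apply => // j x xj.
by rewrite f0 // g0 // subrr.
Qed.

End Parts.

Lemma ae_imp (R : realType) d (X : measurableType d) (m : set X -> \bar R) (Pr Pr' : X -> Prop) :
  (forall x, Pr x -> Pr' x) -> {ae m, forall x, Pr x} -> {ae m, forall x, Pr' x}.
Proof.
move=> imp [B [mB B0 PB]]; exists B; split => // x /= nP'.
by apply: PB => Px; exact: nP' (imp x Px).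
Qed.

(** * Local error under the stated assumptions *)

Section LocalEstimate.
Context (R : realType) d (X : measurableType d).
Local Notation T := (X * measurableTypeR R)%type.
Context (rho : probability T R) (rhoc : R.-pker X ~> measurableTypeR R).
Context (L : localization R X) (kappa sigma M rad : R).
Hypothesis cond : is_conditional rho rhoc.
Hypothesis noise : noise_assumption rho rhoc sigma M.
Hypothesis pa : partition_assumption rho L.
Hypothesis ka : kernel_assumption L kappa.
Context (f : 'I_(nloc L) -> X -> R^o).
Hypothesis regE : {ae marginal rho, forall x, regression rhoc x = \sum_j f j x}.
Hypothesis fv : forall j, vectors (hat_space j) (f j).

(* The lower bound 1 makes it dominate the powers mu^(2s), s <= 1/2, of the
   eigenvalues as well. *)
Definition kernel_bound : R := Num.max 1 (kappa ^+ 2).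

Lemma lkernel_bound j (x : part j) : @lkernel _ _ _ L j x x <= kernel_bound.
Proof.
have [_ _ [/andP[k0 k1] kb] _ _] := ka j; apply: le_trans (kb x) _.
by rewrite le_max ler_pXn2r ?k1 ?orbT // nnegrE // (le_trans k0).
Qed.

Lemma kernel_bound_ge1 : 1 <= kernel_bound.
Proof. by rewrite le_max lexx. Qed.

Lemma hat_bounded (j : 'I_(nloc L)) g : vectors (hat_space j) g ->
  exists B, forall x, `|g x : R| <= B.
Proof.
have [_ _ _ rk _] := ka j => vg.
exists (Num.sqrt (dot (hat_space j) g g * kernel_bound)) => x.
rewrite -sqrtr_sqr ler_wsqrtr // (hat_repr rk x vg).
apply: le_trans (dot_cs (hat_ip rk) vg (hat_kvec rk x)) _.
rewrite ler_wpM2l ?(dot_ge0 (hat_ip rk)) // -(hat_repr rk x (hat_kvec rk x)).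
by apply: hat_kernel_bound => //; [exact: le_trans kernel_bound_ge1|exact: lkernel_bound].
Qed.

Lemma measurable_hat (j : 'I_(nloc L)) g : vectors (hat_space j) g ->
  measurable_fun setT (g : X -> R).
Proof.
have [_ mp _] := pa; have [_ mk _ rk _] := ka j => vg.
exact: (measurable_hat_vec rk (mp j) mk).
Qed.

Lemma noise2_marginal : {ae marginal rho, forall x,
  (\int[rhoc x]_y ((`|y - regression rhoc x| ^+ 2)%R)%:E <= (sigma ^+ 2)%:E)%E}.
Proof.
apply: ae_imp (noise (leqnn 2)) => x; congr (_ <= _%:E)%E.
by rewrite subnn expr0 mulr1 mulVf ?mul1r // pnatr_eq0.
Qed.

(** Bernstein's condition at k = 4, where 4! / 2 = 12. *)
Lemma noise4_marginal : {ae marginal rho, forall x,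
  (\int[rhoc x]_y ((`|y - regression rhoc x| ^+ 4)%R)%:E <= (12 * sigma ^+ 2 * M ^+ 2)%:E)%E}.
Proof.
apply: ae_imp (@noise 4 isT) => x; congr (_ <= _%:E)%E.
have -> : 4`!%:R = 24 :> R by [].
by rewrite -[(4 - 2)%N]/2%N; field.
Qed.

Context dO (Omega : measurableType dO) (P : probability Omega R) (N l q : nat).
Context (Z : 'I_(nloc L) -> 'I_N -> Omega -> T) (S : 'I_(nloc L) -> Omega -> {set 'I_N}).
Hypothesis hZS : is_sample P rho l Z S.
Hypotheses (q0 : (0 < q)%N) (ql : (q <= l)%N) (lN : (l <= N)%N).
Context (j : 'I_(nloc L)) (h : X -> R^o) (lam delta theta : R).
Hypotheses (lam0 : 0 < lam) (delta0 : 0 < delta) (delta_lam : delta <= lam).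
Hypothesis theta0 : 0 < theta.
Hypotheses (s0 : 0 < lexp j) (s1 : lexp j <= 2^-1).
Hypotheses (hv : vectors (hat_space j) h) (hrad : hnorm (hat_space j) h <= rad).
Hypothesis pow : is_power (hat_space j) (local_cov_operator rho j) (lexp j) h (f j).
Local Notation est w := (nystroem (hat_kernel j) (Z j ^~ w) (S j w) lam).

Definition fail_bound : R :=
  8 * ((kernel_bound / lam / (l %/ q)%:R) ^+ q * (kernel_bound / lam)) + N%:R * delta / lam.

Definition local_rate (C K NN : R) : R :=
  34 * C ^+ 2 * (3 * (C * K) + 2 * (C * (C * K)) + K +
     2 * sigma ^+ 2 * (N%:R^-1 * NN + delta / lam)) +
  (2 * kernel_bound / lam * (2 * (theta * fail_bound + theta^-1 * (12 * sigma ^+ 2 * M ^+ 2)) +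
     2 * kernel_bound * (rad ^+ 2 * kernel_bound) * fail_bound) +
   2 * kernel_bound * (rad ^+ 2 * kernel_bound) * fail_bound).

(** G and NN are existential because they depend on the frame, the truncation level and the blocks,
    all chosen inside. NN is the truncated effective dimension, a real number even if the full one
    is not known to be finite. *)
Lemma local_estimate : exists (G : Omega -> R) (NN : R),
  [/\ integr P G, forall w, 0 <= G w,
      forall w, vectors (hat_space j) (est w) /\
        Ex rho (fun z => (est w z.1 - f j z.1) ^+ 2) <= weight rho j * G w,
      (NN%:E <= effective_dimension (hat_space j) (local_cov_operator rho j) lam)%E
    & Ex P G <= local_rate (lower_const R q)
        (lam ^+ 2 * (rad ^+ 2 * lam `^ (2 * lexp j - 1))) NN].
Proof.
have [_ mp w0] := pa; have [_ mk _ rk sep] := ka j.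
have kap0 : 0 <= kernel_bound := le_trans ler01 kernel_bound_ge1.
have [Q QE] := ex_local_law (mp j) (w0 j).
have [nu [nuE _]] := ex_local_marginal QE.
have dis : disintegrates rhoc Q nu by rewrite QE nuE; exact: disintegrates_local.
have [e [lm fE Ndim]] := local_model_of_power (mp j) rk sep mk kap0 (@lkernel_bound j) QE pow hv.
have [D Edelta] := tau_small lm delta0.
have [blk hblk] := ex_blocks N q.
have sam := sampling_of_is_sample hZS QE.
have ipH := lm_ip lm.
have hrad2 : dot (hat_space j) h h <= rad ^+ 2.
  rewrite -(sqr_hnorm ipH hv) ler_pXn2r ?nnegrE ?sqrtr_ge0 //.
  by apply: le_trans hrad; exact: sqrtr_ge0.
have K0 : 0 <= lam ^+ 2 * (rad ^+ 2 * lam `^ (2 * lexp j - 1)).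
  by rewrite mulr_ge0 ?sqr_ge0 // mulr_ge0 ?sqr_ge0 ?powR_ge0.
have dual g : vectors (hat_space j) g -> (lam * dot (hat_space j) (f j) g) ^+ 2 <=
    lam ^+ 2 * (rad ^+ 2 * lam `^ (2 * lexp j - 1)) * lnorm Q (hat_space j) lam g.
  move=> vg; rewrite exprMn -[leRHS]mulrA ler_wpM2l ?sqr_ge0 //.
  exact: (source_dot lm (fv j) hv s0 s1 lam0 hrad2 fE vg).
have fF := source_norm lm (fv j) hv s0 s1 hrad2 fE kernel_bound_ge1.
have regj : {ae nu, forall x, regression rhoc x = f j x}.
  rewrite nuE; apply: ae_imp (ae_local pa j regE) => x [-> jx].
  rewrite (bigD1 j) //= big1 ?addr0 // => i ij; apply: (hat_vanish (fv i)).
  apply/negP; rewrite inE => ix; by rewrite (part_inj pa ix jx) eqxx in ij.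
have noise2 : {ae nu, forall x,
    (\int[rhoc x]_y ((`|y - regression rhoc x| ^+ 2)%R)%:E <= (sigma ^+ 2)%:E)%E}.
  by rewrite nuE; apply: ae_imp (ae_local pa j noise2_marginal) => x [].
have noise4 : {ae nu, forall x,
    (\int[rhoc x]_y ((`|y - regression rhoc x| ^+ 4)%R)%:E <= (12 * sigma ^+ 2 * M ^+ 2)%:E)%E}.
  by rewrite nuE; apply: ae_imp (ae_local pa j noise4_marginal) => x [].
have mf := measurable_hat (fv j).
have n1 g : vectors (hat_space j) g ->
    integr Q (fun z : T => (z.2 - f j z.1) * g z.1) /\
    Ex Q (fun z : T => (z.2 - f j z.1) * g z.1) = 0.
  move=> vg; have [B gB] := hat_bounded vg.
  exact: (noise_mean dis mf regj noise2 (measurable_hat vg) gB).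
have n2 (phi : X -> R) : measurable_fun setT phi -> (exists B, forall x, 0 <= phi x <= B) ->
    integr Q (fun z : T => (z.2 - f j z.1) ^+ 2 * phi z.1) /\
    Ex Q (fun z : T => (z.2 - f j z.1) ^+ 2 * phi z.1) <= sigma ^+ 2 * Ex Q (fun z => phi z.1).
  by move=> mphi phiB; apply: (noise_var dis mf regj noise2) => //; exact: sqr_ge0.
have n4 : integr Q (fun z : T => (z.2 - f j z.1) ^+ 4) /\
    Ex Q (fun z : T => (z.2 - f j z.1) ^+ 4) <= 12 * sigma ^+ 2 * M ^+ 2.
  by apply: (noise_moment4 dis mf regj noise4); rewrite mulr_ge0 ?sqr_ge0 // mulr_ge0 ?sqr_ge0.
have [iG G0 errG EG] := local_bound lm sam (fv j) lam0 q0 ql lN hblk Edelta delta_lam K0 fF dual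
  (fun s => @Ex_indS_is_sample _ _ _ _ _ _ _ _ _ _ _ _ hZS j s) n1 (sqr_ge0 sigma) n2 n4 theta0.
eexists; exists (\sum_(i < D) mu Q e i / (mu Q e i + lam)); split; first exact: iG.
- exact: G0.
- move=> w; have ve : vectors (hat_space j) (est w) by exact: (nystroem_vec lm).
  split=> //; have vd := vecB ipH ve (fv j).
  have md := measurable_hat vd; have [B dB] := hat_bounded vd.
  rewrite (weight_Ex pa (psi := fun x => (est w x - f j x) ^+ 2) QE).
  + by rewrite ler_wpM2l ?(ltW (w0 j)) //; exact: errG.
  + by apply: measurable_funX; exact: md.
  + by move=> x; exact: sqr_ge0.
  + exists (B ^+ 2) => x; rewrite -[leLHS]real_normK ?num_real //.
    rewrite ler_pXn2r ?nnegrE //; first exact: dB.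
    exact: le_trans (normr_ge0 _) (dB x).
  + by move=> x xj; rewrite (hat_vanish ve xj) (hat_vanish (fv j) xj) subrr expr0n.
- exact: Ndim.
- exact: EG.
Qed.

End LocalEstimate.

(** * Rates *)

Section Asymptotics.
Context (R : realType).
Context (r gamma kappa sigma M rad cl clam clam' C12 : R) (q : nat).
Hypotheses (r0 : 0 < r) (r1 : r <= 2^-1) (g0 : 0 < gamma) (g1 : gamma <= 1).
Hypotheses (cl0 : 0 < cl) (clam0 : 0 < clam) (clam'0 : 0 < clam') (C120 : 0 <= C12).
(* 16 >= 1 + 5 p, so that the failure probability is O(n^-4). *)
Hypotheses (q0 : (0 < q)%N) (hq : 16 <= gamma * q%:R).
Let p := 2 * r + 1 + gamma.
Let kb := kernel_bound kappa.
Let Cq : R := lower_const R q.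

Let kb1 : 1 <= kb. Proof. exact: kernel_bound_ge1. Qed.
Let kb0 : 0 < kb. Proof. exact: lt_le_trans ltr01 kb1. Qed.
Let p0 : 0 < p. Proof. by rewrite /p; move: r0 g0; lra. Qed.
Let p1 : 1 <= p. Proof. by rewrite /p; move: r0 g0; lra. Qed.
Let p3 : p <= 3. Proof. by rewrite /p; move: r1 g1; lra. Qed.

Section Powers.
Context (x : R).
Hypotheses (x0 : 0 < x) (x1 : x <= 1).

Let powD a b : x `^ (a + b) = x `^ a * x `^ b.
Proof. by rewrite powRD // (gt_eqF x0) /= implybT. Qed.

Let pow_anti a b : a <= b -> x `^ b <= x `^ a.
Proof. by move=> ab; apply: ger_powR => //; rewrite x0. Qed.

(** As l is of order n^((1 + gamma) / p) and lam of order n^(-1/p), this says that lam l is of order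
    n^(gamma / p). *)
Lemma rate_split : x `^ ((1 + gamma) / p) = x `^ p^-1 * x `^ (gamma / p).
Proof. by rewrite -powD mulrDl mul1r. Qed.

(** Equivalently, the variance n^-1 lam^-gamma has the target rate. *)
Lemma rate_complement : x `^ (gamma / p) * x `^ ((2 * r + 1) / p) = x.
Proof.
rewrite -powD -mulrDl -[RHS]powRr1 ?(ltW x0) //; congr (x `^ _).
by rewrite addrC mulfV // gt_eqF.
Qed.

Lemma rate_ge : x <= x `^ ((2 * r + 1) / p).
Proof.
rewrite -[leLHS]powRr1 ?(ltW x0) //; apply: pow_anti.
by rewrite ler_pdivrMr // mul1r /p; move: g0; lra.
Qed.

Lemma root_ge : x <= x `^ p^-1.
Proof. by rewrite -[leLHS]powRr1 ?(ltW x0) //; apply: pow_anti; rewrite invf_le1. Qed.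

(** The factor x^(1/p) compensates the 1 / lam that the trace contributes to the failure
    probability. *)
Lemma rate_pow : (x `^ (gamma / p)) ^+ q <= x `^ p^-1 * x ^+ 5.
Proof.
rewrite -powR_mulrn ?powR_ge0 // -powRrM -[x ^+ 5]powR_mulrn ?(ltW x0) // -powD.
apply: pow_anti; rewrite mulrAC ler_pdivlMr // mulrDl mulVf ?gt_eqF //.
by move: hq p3; lra.
Qed.

End Powers.

Context (n N l m : nat) (lam s : R).
Hypotheses (n0 : (0 < n)%N) (m0 : (0 < m)%N) (NE : N = (n %/ m)%N).
Hypotheses (ql : (q <= l)%N) (lN : (l <= N)%N).
Let x : R := n%:R^-1.
Let T := x `^ ((2 * r + 1) / p).
Hypothesis hl : cl * n%:R `^ ((1 + gamma) / p) <= l%:R.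
Hypotheses (lam_ge : clam * x `^ p^-1 <= lam) (lam_le : lam <= clam' * x `^ p^-1).
Hypotheses (lam1 : lam <= 1) (rs : r <= s).
(** With this delta the truncation fails at one of N <= n points with probability at most n^-4. With
    theta = n^2 below, theta times the failure probability and theta^-1 are both of order n^-2. *)
Let delta := lam * x ^+ 5.
Let theta : R := n%:R ^+ 2.

Let nR : 0 < n%:R :> R. Proof. by rewrite ltr0n. Qed.
Let x0 : 0 < x. Proof. by rewrite invr_gt0. Qed.
Let x1 : x <= 1. Proof. by rewrite invf_le1 // ler1n. Qed.
Let y0 : 0 < x `^ p^-1. Proof. exact: powR_gt0. Qed.
Let z0 : 0 < x `^ (gamma / p). Proof. exact: powR_gt0. Qed.
Let T0 : 0 < T. Proof. exact: powR_gt0. Qed.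
Let lam0 : 0 < lam. Proof. by apply: lt_le_trans lam_ge; exact: mulr_gt0. Qed.
Let N0 : (0 < N)%N. Proof. exact: leq_trans (leq_trans q0 ql) lN. Qed.
Let xn : x * n%:R = 1. Proof. by rewrite mulVf // gt_eqF. Qed.

Definition block_rate : R := 2 * q%:R * kb / (clam * cl).

Definition fail_const : R := 8 * (block_rate ^+ q * (kb / clam)) + 1.

Lemma block_rate_ge0 : 0 <= block_rate.
Proof. by rewrite divr_ge0 ?mulr_ge0 // ltW. Qed.

Lemma kb_lam_le : kb / lam <= kb / clam / x `^ p^-1.
Proof.
rewrite -mulrA -invfM ler_wpM2l ?(ltW kb0) // lef_pV2 ?posrE //.
exact: mulr_gt0.
Qed.

Lemma block_rate_le : kb / lam / (l %/ q)%:R <= block_rate * x `^ (gamma / p).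
Proof.
have lq0 : 0 < (l %/ q)%:R :> R by rewrite ltr0n divn_gt0.
rewrite ler_pdivrMr //; apply: le_trans kb_lam_le _.
rewrite ler_pdivrMr //.
have l2 : (l%:R : R) <= 2 * q%:R * (l %/ q)%:R.
  by rewrite -!natrM ler_nat block_size_le.
have cyz : cl <= l%:R * (x `^ p^-1 * x `^ (gamma / p)).
  have e : n%:R `^ ((1 + gamma) / p) * x `^ ((1 + gamma) / p) = 1.
    by rewrite -powRM ?(ltW x0) ?(ltW nR) // mulrC xn powR1.
  rewrite -rate_split // -[leLHS]mulr1 -[X in _ * X <= _]e mulrA ler_wpM2r ?powR_ge0 //.
have -> : block_rate * x `^ (gamma / p) * (l %/ q)%:R * x `^ p^-1 =
    kb / clam * (2 * q%:R * (l %/ q)%:R * (x `^ p^-1 * x `^ (gamma / p)) / cl).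
  by rewrite /block_rate; field; rewrite !gt_eqF.
rewrite -[leLHS]mulr1 ler_wpM2l ?divr_ge0 ?(ltW kb0) ?(ltW clam0) //.
rewrite ler_pdivlMr // mul1r; apply: le_trans cyz _.
by rewrite ler_wpM2r // mulr_ge0 // ltW.
Qed.

Lemma fail_bound_le : fail_bound kappa N l q lam delta <= fail_const * x ^+ 4.
Proof.
have lq0 : 0 < (l %/ q)%:R :> R by rewrite ltr0n divn_gt0.
have b0 := block_rate_ge0.
have h1 : (kb / lam / (l %/ q)%:R) ^+ q * (kb / lam) <=
    block_rate ^+ q * (kb / clam) * x ^+ 5.
  apply: (@le_trans _ _ ((block_rate * x `^ (gamma / p)) ^+ q * (kb / clam / x `^ p^-1))).
    apply: ler_pM.
    - by rewrite exprn_ge0 // !divr_ge0 // ltW.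
    - by rewrite divr_ge0 // ltW.
    - apply: lerXn2r; rewrite ?nnegrE; last exact: block_rate_le.
        by rewrite !divr_ge0 // ltW.
      by rewrite mulr_ge0 // ltW.
    - exact: kb_lam_le.
  have -> : (block_rate * x `^ (gamma / p)) ^+ q * (kb / clam / x `^ p^-1) =
      block_rate ^+ q * (kb / clam) * ((x `^ (gamma / p)) ^+ q / x `^ p^-1).
    by rewrite exprMn; ring.
  rewrite ler_wpM2l //; first by rewrite mulr_ge0 ?exprn_ge0 // divr_ge0 // ltW.
  by rewrite ler_pdivrMr // [leRHS]mulrC; exact: rate_pow.
have h2 : N%:R * delta / lam <= x ^+ 4.
  have -> : N%:R * delta / lam = N%:R * x * x ^+ 4.
    by rewrite /delta; field; rewrite gt_eqF.
  rewrite -[leRHS]mul1r ler_wpM2r ?exprn_ge0 ?(ltW x0) //.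
  by rewrite -[leRHS]xn mulrC ler_wpM2l ?(ltW x0) // ler_nat NE leq_div.
have h3 : x ^+ 5 <= x ^+ 4 by rewrite exprS ler_piMl // exprn_ge0 // ltW.
rewrite /fail_const [leRHS]mulrDl [X in _ <= _ + X]mul1r; apply: lerD; last exact: h2.
rewrite -[leRHS]mulrA ler_wpM2l //; apply: (le_trans h1).
by rewrite ler_wpM2l // mulr_ge0 ?exprn_ge0 // divr_ge0 // ltW.
Qed.

Lemma fail_const_ge0 : 0 <= fail_const.
Proof.
have b0 := block_rate_ge0.
by rewrite addr_ge0 // mulr_ge0 // mulr_ge0 ?exprn_ge0 // divr_ge0 // ltW.
Qed.

Let D0 := 2 * kb * (rad ^+ 2 * kb).
Let s4 := 12 * sigma ^+ 2 * M ^+ 2.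

Definition crude_const : R :=
  2 * kb / clam * (2 * (fail_const + s4) + D0 * fail_const) + D0 * fail_const.

Definition bias_const : R :=
  34 * Cq ^+ 2 * ((3 * Cq + 2 * (Cq * Cq) + 1) * (rad ^+ 2 * clam' `^ (2 * r + 1)) +
    2 * sigma ^+ 2) + crude_const.

Definition var_const : R := 34 * Cq ^+ 2 * (2 * sigma ^+ 2).

Let D00 : 0 <= D0.
Proof. by rewrite /D0 mulr_ge0 // mulr_ge0 ?sqr_ge0 // ltW. Qed.

Let s40 : 0 <= s4.
Proof. by rewrite /s4 mulr_ge0 ?sqr_ge0 // mulr_ge0 ?sqr_ge0. Qed.

(** The exceptional event contributes n^-2 / lam up to constants, and 1 / lam is at most of order n,
    which leaves n^-1, below the target rate. *)
Lemma crude_rate : 2 * kb / lam * (2 * (theta * fail_bound kappa N l q lam delta +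
    theta^-1 * s4) + D0 * fail_bound kappa N l q lam delta) +
    D0 * fail_bound kappa N l q lam delta <= crude_const * T.
Proof.
have fb := fail_bound_le; have fc0 := fail_const_ge0.
have th : theta * x ^+ 4 = x ^+ 2.
  have -> : theta * x ^+ 4 = (x * n%:R) ^+ 2 * x ^+ 2 by rewrite /theta; ring.
  by rewrite xn expr1n mul1r.
have thV : theta^-1 = x ^+ 2 by rewrite /theta /x exprVn.
have theta0 : 0 <= theta by rewrite /theta sqr_ge0.
have f1 : theta * fail_bound kappa N l q lam delta <= fail_const * x ^+ 2.
  by rewrite -th mulrCA ler_wpM2l.
have x20 : 0 <= x ^+ 2 by exact: sqr_ge0.
have x42 : x ^+ 4 <= x ^+ 2.
  by rewrite -[4%N]/(2 + 2)%N exprD ler_piMl // exprn_ile1 // ltW.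
have f2 : D0 * fail_bound kappa N l q lam delta <= D0 * fail_const * x ^+ 2.
  rewrite -mulrA ler_wpM2l //; apply: le_trans fb _; exact: ler_wpM2l.
have inner : 2 * (theta * fail_bound kappa N l q lam delta + theta^-1 * s4) +
    D0 * fail_bound kappa N l q lam delta <=
    (2 * (fail_const + s4) + D0 * fail_const) * x ^+ 2.
  by rewrite thV; move: f1 f2; lra.
have in0 : 0 <= 2 * (fail_const + s4) + D0 * fail_const.
  apply: addr_ge0; last exact: mulr_ge0.
  by apply: mulr_ge0 => //; exact: addr_ge0.
have xT : x <= T by exact: rate_ge.
rewrite /crude_const [leRHS]mulrDl; apply: lerD; last first.
  apply: (le_trans f2); apply: ler_wpM2l; first exact: mulr_ge0.
  by apply: le_trans xT; rewrite expr2 ler_piMl // ltW.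
apply: le_trans (_ : 2 * (kb / clam / x `^ p^-1) *
    ((2 * (fail_const + s4) + D0 * fail_const) * x ^+ 2) <= _).
  rewrite -!(mulrA 2) ler_wpM2l //.
  apply: le_trans (ler_wpM2l _ inner) _; first by rewrite divr_ge0 // ltW.
  by apply: ler_wpM2r; [exact: mulr_ge0|exact: kb_lam_le].
have -> : 2 * (kb / clam / x `^ p^-1) * ((2 * (fail_const + s4) + D0 * fail_const) * x ^+ 2) =
    2 * kb / clam * (2 * (fail_const + s4) + D0 * fail_const) * (x * (x / x `^ p^-1)).
  by field; rewrite !gt_eqF.
rewrite ler_wpM2l //.
  by apply: mulr_ge0 => //; rewrite divr_ge0 ?mulr_ge0 // ltW.
apply: le_trans xT; rewrite -[leRHS]mulr1 ler_wpM2l ?(ltW x0) //.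
by rewrite ler_pdivrMr // mul1r root_ge.
Qed.

(** The powers combine to lam^(2s + 1); since lam <= 1, the smallest exponent r is the worst one. *)
Lemma bias_rate : lam ^+ 2 * (rad ^+ 2 * lam `^ (2 * s - 1)) <=
  rad ^+ 2 * clam' `^ (2 * r + 1) * T.
Proof.
have -> : lam ^+ 2 * (rad ^+ 2 * lam `^ (2 * s - 1)) = rad ^+ 2 * lam `^ (2 * s + 1).
  have -> : 2 * s + 1 = 2%:R + (2 * s - 1) by ring.
  rewrite [X in _ = _ * X]powRD; last by rewrite (gt_eqF lam0) /= implybT.
  by rewrite powR_mulrn ?(ltW lam0) // mulrCA.
rewrite -mulrA ler_wpM2l ?sqr_ge0 //.
apply: (@le_trans _ _ (lam `^ (2 * r + 1))).
  by apply: ger_powR; [rewrite lam0|move: rs; lra].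
have -> : clam' `^ (2 * r + 1) * T = (clam' * x `^ p^-1) `^ (2 * r + 1).
  rewrite powRM ?powR_ge0 ?(ltW clam'0) // -powRrM; congr (_ * x `^ _).
  by rewrite mulrC.
apply: ge0_ler_powR; rewrite ?nnegrE ?(ltW lam0) ?mulr_ge0 ?(ltW clam'0) ?(ltW y0) //.
by move: r0; lra.
Qed.

Lemma local_rate_le NN : local_rate kappa sigma M rad N l q lam delta theta Cq
    (lam ^+ 2 * (rad ^+ 2 * lam `^ (2 * s - 1))) NN <=
  bias_const * T + var_const * (N%:R^-1 * NN).
Proof.
have dl : delta / lam <= T.
  have -> : delta / lam = x ^+ 5 by rewrite /delta; field; rewrite gt_eqF.
  apply: le_trans (rate_ge x0 x1); rewrite exprS ler_piMr ?(ltW x0) // exprn_ile1 //.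
  exact: ltW.
have C0 : 0 <= 3 * Cq + 2 * (Cq * Cq) + 1.
  have c1 : 0 <= Cq := le_trans ler01 (lower_const_ge1 R q).
  by rewrite !addr_ge0 // mulr_ge0 // mulr_ge0.
have CC0 : 0 <= 34 * Cq ^+ 2 by rewrite mulr_ge0 ?sqr_ge0.
have b := ler_wpM2l C0 bias_rate; have cr := crude_rate.
have sd := ler_wpM2l (mulr_ge0 (ler0n R 2) (sqr_ge0 sigma)) dl.
apply: (@le_trans _ _ (34 * Cq ^+ 2 * (((3 * Cq + 2 * (Cq * Cq) + 1) *
   (rad ^+ 2 * clam' `^ (2 * r + 1)) + 2 * sigma ^+ 2) * T + 2 * sigma ^+ 2 * (N%:R^-1 * NN)) +
   crude_const * T)); last first.
  by rewrite le_eqVlt /bias_const /var_const; apply/orP; left; apply/eqP; ring.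
apply: lerD; last exact: cr.
rewrite ler_wpM2l //.
move: b sd; move: (lam ^+ 2 * _) (delta / lam) => K dd b sd.
have -> : 3 * (Cq * K) + 2 * (Cq * (Cq * K)) + K = (3 * Cq + 2 * (Cq * Cq) + 1) * K by ring.
move: b sd; move: (3 * Cq + _ + 1) (rad ^+ 2 * _) (2 * sigma ^+ 2) T (N%:R^-1 * NN) => c1 c2 c3 t v.
move=> b sd; rewrite [leRHS](_ : _ = c1 * (c2 * t) + c3 * (v + t)); last by ring.
by rewrite !(mulrDr c3); move: b sd; lra.
Qed.

(** The factor m on the left turns 1 / N into 1 / n up to the 2 lost in rounding N = n / m. The m
    inside the negative power is at least 1 and is dropped. *)
Lemma variance_rate (W : R) : m%:R * W <= C12 * (m%:R * lam) `^ (- gamma) ->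
  N%:R^-1 * W <= 2 * C12 * clam `^ (- gamma) * T.
Proof.
move=> hW; have mR : 0 < m%:R :> R by rewrite ltr0n.
have m1 : 1 <= m%:R :> R by rewrite ler1n.
have NR : 0 < N%:R :> R by rewrite ltr0n.
have nN : (n%:R : R) <= 2 * (m%:R * N%:R).
  have : (n < 2 * (m * N))%N.
    have := ltn_pmod n m0; have := divn_eq n m; rewrite -NE.
    have := leq_pmulr m N0; move: (n %% m)%N (m * N)%N (mulnC m N) => a b <-.
    by rewrite mul2n -addnn => h1 -> h2; rewrite ltn_add2l (leq_trans h2).
  by rewrite -!natrM ler_nat => /ltnW.
have mlam0 : 0 < m%:R * lam by exact: mulr_gt0.
have y0' : 0 < clam * x `^ p^-1 by exact: mulr_gt0.
have step : C12 * (m%:R * lam) `^ (- gamma) <= C12 * clam `^ (- gamma) * (T * n%:R).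
  rewrite -mulrA ler_wpM2l //.
  apply: (@le_trans _ _ ((clam * x `^ p^-1) `^ (- gamma))).
    rewrite !powRN lef_pV2 ?posrE ?powR_gt0 //.
    apply: ge0_ler_powR; rewrite ?nnegrE ?(ltW g0) ?(ltW y0') ?(ltW mlam0) //.
    by apply: le_trans lam_ge _; rewrite ler_peMl // ltW.
  rewrite powRM ?powR_ge0 ?(ltW clam0) // ler_wpM2l ?powR_ge0 //.
  rewrite -powRrM mulrN powRN (mulrC p^-1) le_eqVlt; apply/orP; left; apply/eqP.
  have h := rate_complement x0; rewrite -/T in h.
  have zn : x `^ (gamma / p) != 0 by rewrite gt_eqF.
  by apply: (mulfI zn); rewrite mulfV // mulrA h.
rewrite ler_pdivrMl //.
have W1 : m%:R * W <= C12 * clam `^ (- gamma) * (T * n%:R) := le_trans hW step.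
have B0 : 0 <= C12 * clam `^ (- gamma) * T by rewrite !mulr_ge0 ?powR_ge0 // ltW.
rewrite -(ler_pM2l mR); apply: le_trans W1 _.
apply: le_trans (_ : C12 * clam `^ (- gamma) * T * (2 * (m%:R * N%:R)) <= _).
  by rewrite mulrA; exact: ler_wpM2l.
by rewrite le_eqVlt; apply/orP; left; apply/eqP; ring.
Qed.

End Asymptotics.

(** * Thresholds in n and the final summation *)

Lemma exists_nat_ge (R : realType) (a : R) : exists n : nat, forall m, (n <= m)%N -> a <= m%:R.
Proof.
exists (Num.bound `|a|) => m nm; apply: le_trans (ler_norm _) _.
by apply: le_trans (ltW (archi_boundP (normr_ge0 a))) _; rewrite ler_nat.
Qed.

Lemma powR_natr_ge (R : realType) (a b : R) : 0 <= a -> 0 < b ->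
  exists n : nat, forall m, (n <= m)%N -> a <= m%:R `^ b.
Proof.
move=> a0 b0; have [n hn] := exists_nat_ge (a `^ b^-1); exists n => m /hn h.
have -> : a = (a `^ b^-1) `^ b by rewrite -powRrM mulVf ?gt_eqF // powRr1.
by apply: ge0_ler_powR; rewrite ?nnegrE ?powR_ge0 // ltW.
Qed.

Theorem theorem4 (R : realType)
  (r gamma kappa sigma M rad alpha : R) (C1 C2 cm cl cl' clam clam' : R)
  (hr : 0 < r <= 2^-1) (hgamma : 0 < gamma <= 1)
  (hsigma : 0 < sigma) (hM : 0 < M) (hrad : 0 < rad)
  (halpha : alpha <= 2 * r / (2 * r + 1 + gamma))
  (hC1 : 0 < C1) (hC2 : 0 < C2) (hcm : 0 < cm)
  (hcl : 0 < cl) (hcl' : 0 < cl') (hclam : 0 < clam) (hclam' : 0 < clam') :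
  exists2 C : R, 0 < C &
  forall (d : measure_display) (X : measurableType d)
    (rho : probability (X * measurableTypeR R)%type R)
    (rhoc : R.-pker X ~> measurableTypeR R)
    (L : nat -> localization R X) (l : nat -> nat) (lam : nat -> R)
    (dO : nat -> measure_display)
    (Omega : forall n : nat, measurableType (dO n))
    (P : forall n : nat, probability (Omega n) R)
    (Z : forall n : nat, 'I_(nloc (L n)) -> 'I_(n %/ nloc (L n)) ->
           Omega n -> X * measurableTypeR R)
    (S : forall n : nat, 'I_(nloc (L n)) ->
           Omega n -> {set 'I_(n %/ nloc (L n))}),
  standard_borel R X ->
  is_conditional rho rhoc ->
  noise_assumption rho rhoc sigma M ->
  (forall n : nat, (0 < n)%N ->
     [/\ partition_assumption rho (L n),
         kernel_assumption (L n) kappa,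
         regularity_assumption rho rhoc (L n) rad /\ min_exponent (L n) r,
         capacity_assumption rho (L n) gamma C1 C2
       & is_sample (P n) rho (l n) (Z n) (S n)]) ->
  (forall n : nat, (0 < n)%N ->
     [/\ (1 <= l n)%N /\ (l n * nloc (L n) <= n)%N,
         cl * n%:R `^ ((1 + gamma) / (2 * r + 1 + gamma)) <= (l n)%:R
           <= cl' * n%:R `^ ((1 + gamma) / (2 * r + 1 + gamma)),
         (nloc (L n))%:R <= cm * n%:R `^ alpha
       & clam * n%:R^-1 `^ (2 * r + 1 + gamma)^-1 <= lam n
           <= clam' * n%:R^-1 `^ (2 * r + 1 + gamma)^-1]) ->
  \forall n \near \oo,
    (\int[P n]_w
       (risk rho (partitioned_nystroem (fun j i => Z n j i w)
                    (fun j => S n j w) (lam n))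
        - risk rho (regression rhoc))
     <= (C * (rad ^+ 2 *
           n%:R^-1 `^ ((2 * r + 1) / (2 * r + 1 + gamma))))%:E)%E.
Proof.
have /andP[r0 r1] := hr; have /andP[g0 g1] := hgamma.
have p0 : 0 < 2 * r + 1 + gamma by move: r0 g0; lra.
(* The number q of blocks depends on gamma alone, so every constant built from it is fixed before
   n. *)
have [q1 hq1] := exists_nat_ge (16 / gamma).
pose q := q1.+1; have q0 : (0 < q)%N by [].
have hq : 16 <= gamma * q%:R by rewrite mulrC -ler_pdivrMr //; exact: hq1.
pose C12 := C1 * C2; have C120 : 0 <= C12 by rewrite mulr_ge0 // ltW.
pose bias := bias_const r kappa sigma M rad cl clam clam' q.
pose var := var_const sigma q.
have var0 : 0 <= var.
  by apply: mulr_ge0; apply: mulr_ge0 => //; exact: sqr_ge0.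
pose C0 := `|bias| + var * (2 * C12 * clam `^ (- gamma)).
have C00 : 0 <= C0.
  apply: addr_ge0 => //; apply: mulr_ge0 => //; apply: mulr_ge0; last exact: powR_ge0.
  exact: mulr_ge0.
have rad20 : 0 < rad ^+ 2 by exact: exprn_gt0.
(* The estimates produce [C0] without a separate factor [rad ^+ 2]; dividing by it gives the stated
   form, with a constant that may depend on [rad]. The 1 makes it positive. *)
exists ((C0 + 1) / rad ^+ 2); first by rewrite divr_gt0 // ltr_wpDl.
move=> d X rho rhoc L l lam dO Omega P Z S _ cond noise hmodel hrates.
have bpos : 0 < (1 + gamma) / (2 * r + 1 + gamma) by rewrite divr_gt0 // ltr_wpDr // ltW.
have ipos : 0 < (2 * r + 1 + gamma)^-1 by rewrite invr_gt0.
have [n1 hn1] := powR_natr_ge (divr_ge0 (ler0n R q) (ltW hcl)) bpos.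
have [n2 hn2] := powR_natr_ge (ltW hclam') ipos.
(* Beyond n1 the subsample can be cut into q nonempty blocks; beyond n2 the regularization parameter
   is at most 1. *)
exists (maxn 1 (maxn n1 n2)) => // n /=; rewrite !geq_max => /and3P[n0 /hn1 nq /hn2 nlam].
have [pa ka [[lexps [f [regE hf]]] [[j0 _] rmin]] cap sam] := hmodel n n0.
have [[_ lmn] /andP[hl _] _ /andP[lam_ge lam_le]] := hrates n n0.
set m := nloc (L n) in f regE hf j0 rmin cap sam lmn *.
have m0 : (0 < m)%N := leq_ltn_trans (leq0n j0) (ltn_ord j0).
pose N := (n %/ m)%N; have lN : (l n <= N)%N by rewrite leq_divRL.
have ql : (q <= l n)%N.
  rewrite -(ler_nat R); apply: le_trans hl; rewrite mulrC -ler_pdivrMr //.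
pose x : R := n%:R^-1; have nR : 0 < n%:R :> R by rewrite ltr0n.
have x0 : 0 < x by rewrite invr_gt0.
have x1 : x <= 1 by rewrite invf_le1 // ler1n.
have lam0 : 0 < lam n by apply: lt_le_trans lam_ge; rewrite mulr_gt0 ?powR_gt0.
have lam1 : lam n <= 1.
  apply: le_trans lam_le _.
  have e : n%:R `^ (2 * r + 1 + gamma)^-1 * x `^ (2 * r + 1 + gamma)^-1 = 1.
    by rewrite -powRM ?(ltW x0) ?(ltW nR) // mulfV ?powR1 // gt_eqF.
  by rewrite -[leRHS]e ler_wpM2r ?powR_ge0.
pose T := x `^ ((2 * r + 1) / (2 * r + 1 + gamma)).
have T0 : 0 <= T by exact: powR_ge0.
pose delta := lam n * x ^+ 5; pose theta : R := n%:R ^+ 2.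
have x50 : 0 < x ^+ 5 by exact: exprn_gt0.
have delta0 : 0 < delta by exact: mulr_gt0.
have delta_lam : delta <= lam n by rewrite ler_piMr ?(ltW lam0) // exprn_ile1 // ltW.
have theta0 : 0 < theta by exact: exprn_gt0.
have [_ _ w0] := pa.
have fv j : vectors (hat_space j) (f j) by have [h [_ _ [E [e []]]]] := hf j.
have est (j : 'I_m) : exists GN : (Omega n -> R) * R,
  [/\ integr (P n) GN.1, forall w, 0 <= GN.1 w,
    forall w, vectors (hat_space j) (nystroem (hat_kernel j) (Z n j ^~ w) (S n j w) (lam n)) /\
      Ex rho (fun z => (nystroem (hat_kernel j) (Z n j ^~ w) (S n j w) (lam n) z.1 -
        f j z.1) ^+ 2) <= weight rho j * GN.1 w,
    (GN.2%:E <= effective_dimension (hat_space j) (local_cov_operator rho j) (lam n))%E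
  & Ex (P n) GN.1 <= bias * T + var * (N%:R^-1 * GN.2)].
  have [h [hv hrad' pow]] := hf j; have /andP[s0 s1] := lexps j.
  have [G [NN [h1 h2 h3 h4 h5]]] := local_estimate cond noise pa ka regE fv sam q0 ql lN
    lam0 delta0 delta_lam theta0 s0 s1 hv hrad' pow.
  exists (G, NN); split => //; apply: le_trans h5 _.
  exact: (local_rate_le kappa sigma M rad r0 r1 g0 g1 hcl hclam hclam' q0 hq n0 (erefl N)
    ql hl lam_ge lam_le lam1 (rmin j)).
have {est} [GN hGN] := choice est.
pose G w := \sum_j weight rho j * (GN j).1 w.
have iG : integr (P n) G.
  by apply: integr_sum => j _; apply: integrZ; case: (hGN j).
have G0 w : 0 <= G w.
  apply: sumr_ge0 => j _; apply: mulr_ge0; first exact: ltW (w0 j).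
  by case: (hGN j).
apply: le_trans (integral_le_Ex (f := G) iG G0 _) _.
  move=> w; pose g j := nystroem (hat_kernel j) (Z n j ^~ w) (S n j w) (lam n).
  have gv j : vectors (hat_space j) (g j) by case: (hGN j) => _ _ /(_ w)[].
  have [Bf hBf] := choice (fun j => hat_bounded ka (fv j)).
  have [Bg hBg] := choice (fun j => hat_bounded ka (gv j)).
  (* This bound may depend on w; it only makes the functions bounded, as the excess risk formula
     requires, and does not enter the estimate. *)
  pose B := \sum_j (Bf j + Bg j).
  have Bf0 j : 0 <= Bf j := le_trans (normr_ge0 _) (hBf j point).
  have Bg0 j : 0 <= Bg j := le_trans (normr_ge0 _) (hBg j point).
  have BB j : Bf j <= B /\ Bg j <= B.
    have : Bf j + Bg j <= B.
      by rewrite /B (bigD1 j) //= lerDl; apply: sumr_ge0 => i _; exact: addr_ge0.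
    by move: (Bf0 j) (Bg0 j); split; lra.
  have -> : (risk rho (partitioned_nystroem (fun j i => Z n j i w) (fun j => S n j w) (lam n))
        - risk rho (regression rhoc))%E = (\sum_j Ex rho (fun z => (g j z.1 - f j z.1) ^+ 2))%:E.
    apply: (excess_risk_sum pa (f := f) (g := g) (B := B) cond regE (noise2_marginal noise)).
    - by move=> j y; exact: (hat_vanish (fv j)).
    - by move=> j y; exact: (hat_vanish (gv j)).
    - by move=> j; exact: (measurable_hat pa ka (fv j)).
    - by move=> j; exact: (measurable_hat pa ka (gv j)).
    - by move=> j y; apply: le_trans (hBf j y) _; case: (BB j).
    - by move=> j y; apply: le_trans (hBg j y) _; case: (BB j).
  rewrite lee_fin; apply: ler_sum => j _.
  by case: (hGN j) => _ _ /(_ w)[].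
rewrite lee_fin.
have -> : (C0 + 1) / rad ^+ 2 * (rad ^+ 2 * n%:R^-1 `^ ((2 * r + 1) / (2 * r + 1 + gamma))) =
    (C0 + 1) * T by rewrite mulrA divfK ?gt_eqF.
rewrite Ex_sum => [|j _]; last by apply: integrZ; case: (hGN j).
apply: (@le_trans _ _ (\sum_(j < m) weight rho j * (`|bias| * T + var * (N%:R^-1 * (GN j).2)))).
  apply: ler_sum => j _; have [i1 _ _ _ e1] := hGN j.
  rewrite ExZ // ler_wpM2l ?(ltW (w0 j)) //; apply: le_trans e1 _.
  by rewrite lerD2r ler_wpM2r // ler_norm.
pose W := \sum_(j < m) weight rho j * (GN j).2.
have -> : \sum_(j < m) weight rho j * (`|bias| * T + var * (N%:R^-1 * (GN j).2)) =
    `|bias| * T * (\sum_(j < m) weight rho j) + var * (N%:R^-1 * W).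
  rewrite /W !mulr_sumr -big_split; apply: eq_bigr => j _ /=; ring.
(* The first capacity bound is used at lam, the second at m lam, where the first one leads. *)
have hW : m%:R * W <= C12 * (m%:R * lam n) `^ (- gamma).
  have ml0 : 0 < m%:R * lam n by rewrite mulr_gt0 // ltr0n.
  have [c1 _] := cap _ lam0; have [_ c2] := cap _ ml0.
  rewrite -lee_fin EFinM; apply: le_trans (le_trans _ c1) _.
    apply: lee_wpmul2l; first by rewrite lee_fin.
    rewrite -sumEFin; apply: lee_sum => j _; rewrite EFinM.
    by apply: lee_wpmul2l; [rewrite lee_fin ltW|case: (hGN j)].
  apply: le_trans (lee_wpmul2l _ c2) _; first by rewrite lee_fin ltW.
  by rewrite -EFinM lee_fin mulrA.
have v1 : N%:R^-1 * W <= 2 * C12 * clam `^ (- gamma) * T.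
  exact: (variance_rate r0 g0 hclam C120 q0 n0 m0 (erefl N) ql lN lam_ge hW).
have b1 : `|bias| * T * (\sum_(j < m) weight rho j) <= `|bias| * T.
  rewrite -[leRHS]mulr1 ler_wpM2l ?mulr_ge0 //; exact: sum_weight_le1.
have := ler_wpM2l var0 v1; move: b1; rewrite /C0 => b1 v2.
apply: (le_trans (lerD b1 v2)).
have -> : (`|bias| + var * (2 * C12 * clam `^ (- gamma)) + 1) * T =
  `|bias| * T + var * (2 * C12 * clam `^ (- gamma) * T) + T by ring.
by rewrite lerDl.
Qed.
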